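(* Let $0<H\le\frac34$ and let $B^H=(B^H_t)_{t\ge0}$ be a fractional Brownian motion with Hurst index $H$. For $n\ge1$ let $$F_n=\frac{n^{2H}}{\sigma_n}\sum_{k=0}^{n-1}\Bigl[\bigl(B^H_{(k+1)/n}-B^H_{k/n}\bigr)^2-n^{-2H}\Bigr],$$ where $\sigma_n>0$ is chosen such that $\mathbb E(F_n^2)=1$. Then there are a constant $c_H>0$ depending only on $H$ and a constant $c>0$ not depending on $n$ and $z$ such that, with $$A_n=c_H\times\begin{cases}\dfrac1{\sqrt n}, & 0<H<\frac58,\\[1ex] \dfrac{(\log n)^{3/2}}{\sqrt n}, & H=\frac58,\\[1ex] \dfrac1{n^{3-4H}}, & \frac58<H<\frac34,\\[1ex] \dfrac1{\log n}, & H=\frac34,\end{cases}$$ for all $n\ge2$ and all $z\in\mathbb R$, $$|\mathbb P(F_n\le z)-\Phi(z)|\le\Bigl(\sqrt2\,\exp\Bigl(-\frac18\min\Bigl\{\frac{z^2}8,\;2^{-13/4}A_n^{-1/2}z\Bigr\}\Bigr)+c\,\exp(-z^2/4)\Bigr)A_n.$$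
   Context: A fractional Brownian motion with Hurst index $H\in(0,1)$ is a continuous centered Gaussian process $(B^H_t)_{t\ge0}$ with covariance $\mathbb E[B^H_tB^H_s]=\frac12(t^{2H}+s^{2H}-|t-s|^{2H})$, $s,t\ge0$. $\Phi$ is the distribution function of $\mathcal N(0,1)$. *)

(* Defs.v *)
From HB Require Import structures.
From mathcomp Require Import all_boot all_order all_algebra.
From mathcomp Require Import all_classical all_reals all_analysis.

Set Implicit Arguments.
Unset Strict Implicit.
Unset Printing Implicit Defensive.

Import Order.TTheory GRing.Theory Num.Theory.
Import numFieldNormedType.Exports.

Local Open Scope classical_set_scope.
Local Open Scope ring_scope.

(* [normal_prob m 0] is not the Dirac mass at [m] in the library (it has density
   [\1_`[0, 1]]), so the degenerate case is spelled out; it is needed, e.g.,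
   for the value at time 0 of a fractional Brownian motion. *)
Definition gaussian_variable d (T : measurableType d) (R : realType)
    (P : probability T R) (X : T -> R) : Prop :=
  exists m s : R, 0 <= s /\
    forall A : set R, measurable A ->
      P (X @^-1` A) = if s == 0 then \d_m A else normal_prob m s A.

(* Processes are indexed by all of [R]; only times [t >= 0] are constrained. *)
Definition gaussian_process d (T : measurableType d) (R : realType)
    (P : probability T R) (B : R -> {RV P >-> R}) : Prop :=
  forall (m : nat) (t a : 'I_m -> R), (forall i, 0 <= t i) ->
    gaussian_variable P (fun w => \sum_(i < m) a i * B (t i) w).

Definition fractional_brownian_motion d (T : measurableType d) (R : realType)
    (P : probability T R) (H : R) (B : R -> {RV P >-> R}) : Prop :=
  [/\ gaussian_process B,
      forall t : R, 0 <= t -> 'E_P[B t]%E = 0%E,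
      forall s t : R, 0 <= s -> 0 <= t ->
        'E_P[(fun w => B t w * B s w)%R]%E =
          (2^-1 * (t `^ (2 * H) + s `^ (2 * H) - `|t - s| `^ (2 * H)))%:E
    & {ae P, forall w,
        {within `[0, +oo[%classic, continuous (fun t : R => B t w)}}].

Definition quadratic_variation_stat d (T : measurableType d) (R : realType)
    (P : probability T R) (H : R) (B : R -> {RV P >-> R}) (sigma : nat -> R)
    (n : nat) (w : T) : R :=
  n%:R `^ (2 * H) / sigma n *
    \sum_(k < n) ((B (k.+1%:R / n%:R) w - B (k%:R / n%:R) w) ^+ 2
                  - n%:R `^ (- (2 * H))).

Definition std_normal_cdf (R : realType) (z : R) : R :=
  fine (normal_prob 0 1 `]-oo, z]%classic).

(* The last branch is meant for [H = 3 / 4]. *)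
Definition berry_esseen_rate (R : realType) (H cH : R) (n : nat) : R :=
  cH * (if H < 5 / 8 then 1 / Num.sqrt n%:R
        else if H == 5 / 8 then ln n%:R `^ (3 / 2) / Num.sqrt n%:R
        else if H < 3 / 4 then 1 / n%:R `^ (3 - 4 * H)
        else 1 / ln n%:R).

(* Main.v *)
Require Import Defs.
From HB Require Import structures.
From mathcomp Require Import all_boot all_order all_algebra.
From mathcomp Require Import all_classical all_reals all_analysis.
From mathcomp Require Import measurable_realfun.
From mathcomp Require Import ring lra.
Import Order.TTheory GRing.Theory Num.Theory.
Import numFieldNormedType.Exports.
Local Open Scope classical_set_scope.
Local Open Scope ring_scope.
Set Implicit Arguments.
Unset Strict Implicit.
Unset Printing Implicit Defensive.

(** After normalization, [F_n] is a centered quadratic form [F = Q - tr C] in the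
Gaussian vector [Y] of rescaled increments, with [Q] the squared norm of [Y] and
[C] its covariance matrix. The theorem is an instance of a nonuniform
Berry-Esseen bound for such forms ([quadratic_form_berry_esseen]), combined with
an estimate of the matrix [C] ([berry_esseen_rate_bound]).

The bound for quadratic forms is Stein's method. Gaussian integration by parts
gives [E[F f(F)] = E[2 V f'(F)]] with [V = Y^T C Y] ([quadratic_stein]). For the
solution [f] of Stein's equation at [z] this yields
[P(F <= z) - Phi(z) = E[f'(F) (1 - 2 V)]], and when [E F ^ 2 = 1] the second
moment of [1 - 2 V] is [8 * hs4 C], where [hs4 C] is the squared Hilbert-Schmidt
norm of [C * C] ([covquad_variance], from Isserlis' formula). Since [f'] is
bounded by [2] and is of order [exp(- z ^ 2 / 4)] on [F <= z / 2], the
Cauchy-Schwarz inequality leaves the tail [P(F > z / 2) ^ (1 / 2)] as the only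
other contribution.

The tail ([quadratic_tail]) follows from a differential inequality for the
Laplace transform [M(u) = E exp(u F)]. The same integration by parts, applied to
[F] and to [V], and the operator inequality [C * C <= lam * C] with
[lam ^ 4 = hs4 C] give [M' <= 2 u M] for [4 u lam <= 1], so that
[M(u) <= exp(u ^ 2)] in this range. The restriction on [u] is what produces the
minimum of a quadratic and a linear function of [z] in the exponent.

Integration by parts is obtained in four steps. Differentiating the
characteristic function of linear forms of [Y] gives the identity for
trigonometric functions. Averaging over normal frequencies turns these into
Gaussian weights ([expect_coord2_gauss_cos]), that is, into exponentials of [Q].
Bernstein polynomials in [exp(- Q)] then give functions with compactly supported
derivative, and local averages give Lipschitz functions with a prescribed left
derivative ([ibp_pair_lipschitz]), among them the solution of Stein's equation
and truncated exponentials.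

For the fractional increments, the correlation at lag [r] is at most of
order [r ^ (2 H - 2)]. The sum [hs4 C] runs over closed walks of length four, and by the
inequality of arithmetic and geometric means it is dominated by sums over paths
of length three ([hs4_le]), hence by [n] times the cube of the sum of
[r ^ (4 (2 H - 2) / 3)] over [r < n]. Divided by the square of [hs2 C], the squared
Hilbert-Schmidt norm of [C], which is at least of order [n], and of order
[n log n] when [H = 3 / 4], this is the square of the rate in each of the four
regimes. *)

(** * Dominated convergence and one-variable calculus *)

Section Domination.
Context d (T : measurableType d) (R : realType).
Variable mu : {measure set T -> \bar R}.

Lemma dom_integrable (f g : T -> R) :
  mu.-integrable setT (EFin \o g) -> measurable_fun setT f ->
  (forall x, `|f x| <= g x) -> mu.-integrable setT (EFin \o f).
Proof.
move=> ig mf fg; apply: (le_integrable _ _ _ ig) => //.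
  exact/measurable_EFinP.
by move=> x _ /=; rewrite lee_fin (le_trans (fg x))// ler_norm.
Qed.

Lemma integrable_scale (c : R) (f : T -> R) :
  mu.-integrable setT (EFin \o f) ->
  mu.-integrable setT (EFin \o (fun x => c * f x)).
Proof. by move=> fi; exact: (integrableZl measurableT c fi). Qed.

Lemma integrable_add (f g : T -> R) :
  mu.-integrable setT (EFin \o f) -> mu.-integrable setT (EFin \o g) ->
  mu.-integrable setT (EFin \o (fun x => f x + g x)).
Proof. by move=> fi gi; exact: (integrableD measurableT fi gi). Qed.

Lemma integrable_sub (f g : T -> R) :
  mu.-integrable setT (EFin \o f) -> mu.-integrable setT (EFin \o g) ->
  mu.-integrable setT (EFin \o (fun x => f x - g x)).
Proof. by move=> fi gi; exact: (integrableB measurableT fi gi). Qed.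

Lemma Rintegral_cvg (f_ : nat -> T -> R) (f g : T -> R) :
  (forall n, measurable_fun setT (f_ n)) -> measurable_fun setT f ->
  (forall x, f_ n x @[n --> \oo] --> f x) ->
  mu.-integrable setT (EFin \o g) ->
  (forall n x, `|f_ n x| <= g x) ->
  \int[mu]_x f_ n x @[n --> \oo] --> \int[mu]_x f x.
Proof.
move=> mf_ mf ff ig fg; rewrite /Rintegral.
have [|||||iF _ Hc] := @dominated_convergence _ _ _ mu _ measurableT
  (fun n x => (f_ n x)%:E) (EFin \o f) (EFin \o g).
- by move=> n; exact/measurable_EFinP.
- exact/measurable_EFinP.
- by apply: aeW => x _; apply: cvg_EFin; [exact: nearW|exact: ff].
- exact: ig.
- by apply: aeW => x n _; rewrite /= lee_fin; exact: fg.
by apply: fine_cvg; rewrite fineK//; exact: integrable_fin_num.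
Qed.

End Domination.

Section Calculus.
Context (R : realType).
Implicit Types (f g : R -> R) (x a b M K : R).
Local Notation mu := (@lebesgue_measure R).

Lemma cvg_eventually (u : nat -> R) (l : R) :
  (\forall n \near \oo, u n = l) -> u n @[n --> \oo] --> l.
Proof.
move=> h; apply/cvgrPdist_lt => e e0; near=> n.
by rewrite (_ : u n = l) ?subrr ?normr0//; near: n.
Unshelve. all: by end_near. Qed.

Lemma is_derive_continuous f (df : R -> R) :
  (forall x, is_derive (x : R) (1 : R) f (df x)) -> continuous f.
Proof.
by move=> h x; apply: differentiable_continuous; apply/derivable1_diffP;
  exact: (@ex_derive _ _ _ _ _ _ _ (h x)).
Qed.

Lemma is_derive_add f g x a b : is_derive (x : R) (1 : R) f a ->
  is_derive (x : R) (1 : R) g b ->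
  is_derive (x : R) (1 : R) (fun y => f y + g y) (a + b).
Proof. by move=> df dg; exact: is_deriveD. Qed.

Lemma is_derive_opp f x a : is_derive (x : R) (1 : R) f a ->
  is_derive (x : R) (1 : R) (fun y => - f y) (- a).
Proof. by move=> df; exact: is_deriveN. Qed.

Lemma is_derive_sub f g x a b : is_derive (x : R) (1 : R) f a ->
  is_derive (x : R) (1 : R) g b ->
  is_derive (x : R) (1 : R) (fun y => f y - g y) (a - b).
Proof. by move=> df dg; exact: is_deriveB. Qed.

Lemma is_derive_mul f g x a b : is_derive (x : R) (1 : R) f a ->
  is_derive (x : R) (1 : R) g b ->
  is_derive (x : R) (1 : R) (fun y => f y * g y) (a * g x + f x * b).
Proof.
move=> df dg; apply: (is_derive_eq (is_deriveM df dg)).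
by rewrite /GRing.scale/= addrC [g x * a]mulrC.
Qed.

Lemma is_derive_scale f (c : R) x a : is_derive (x : R) (1 : R) f a ->
  is_derive (x : R) (1 : R) (fun y => c * f y) (c * a).
Proof. by move=> df; exact: is_deriveZ. Qed.

Lemma is_derive_expn f n x a : is_derive (x : R) (1 : R) f a ->
  is_derive (x : R) (1 : R) (fun y => f y ^+ n.+1) (n.+1%:R * f x ^+ n * a).
Proof.
move=> df; rewrite (_ : (fun y => f y ^+ n.+1) = f ^+ n.+1).
  by apply: (is_derive_eq (is_deriveX n.+1 df)).
by apply/funext => y; rewrite exprfctE.
Qed.

Lemma is_derive_idfun x : is_derive (x : R) (1 : R) (fun y => y) 1.
Proof. exact: is_derive_id. Qed.

Lemma is_derive_cstfun (c : R) x : is_derive (x : R) (1 : R) (fun=> c) 0.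
Proof. exact: is_derive_cst. Qed.

Lemma is_derive_compf f g x a b : is_derive (g x) (1 : R) f a ->
  is_derive (x : R) (1 : R) g b ->
  is_derive (x : R) (1 : R) (fun y => f (g y)) (a * b).
Proof. by move=> df dg; exact: is_derive1_comp. Qed.

Lemma is_derive_expRf f x a : is_derive (x : R) (1 : R) f a ->
  is_derive (x : R) (1 : R) (fun y => expR (f y)) (expR (f x) * a).
Proof. by move=> df; apply: (is_derive_compf (is_derive_expR _)). Qed.

Lemma mean_value f (df : R -> R) a b :
  (forall x, is_derive (x : R) (1 : R) f (df x)) ->
  exists2 c, Num.min a b <= c <= Num.max a b & f b - f a = df c * (b - a).
Proof.
move=> h; have cf : continuous f by exact: is_derive_continuous h.
have [ab|ba] := leP a b.
- have [|c cab ->] := @MVT_segment R f df a b ab.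
    exact: continuous_subspaceT.
  by exists c => //; rewrite in_itv/= in cab.
- have [|c cab e] := @MVT_segment R f df b a (ltW ba).
    exact: continuous_subspaceT.
  exists c; first by rewrite in_itv/= in cab.
  by rewrite -(opprB (f a)) e -mulrN opprB.
Qed.

Lemma mean_value_le f (df : R -> R) M a b :
  (forall x, is_derive (x : R) (1 : R) f (df x)) ->
  (forall x, Num.min a b <= x <= Num.max a b -> `|df x| <= M) ->
  `|f b - f a| <= M * `|b - a|.
Proof.
move=> h hM; have [c cab ->] := mean_value a b h.
by rewrite normrM ler_wpM2r// hM.
Qed.

Lemma is_derive_nondecreasing f (df : R -> R) a b :
  (forall x, is_derive (x : R) (1 : R) f (df x)) ->
  (forall x, a <= x <= b -> 0 <= df x) -> a <= b -> f a <= f b.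
Proof.
move=> h h0 ab; have [c cab e] := mean_value a b h.
rewrite -subr_ge0 e mulr_ge0 ?subr_ge0// h0//.
by move: cab; rewrite (min_idPl ab) (max_idPr ab).
Qed.

Lemma is_derive_eq0_cst f a b :
  (forall x, is_derive (x : R) (1 : R) f 0) -> f a = f b.
Proof.
by move=> h; apply/eqP; rewrite eq_sym -subr_eq0;
  have [c _ ->] := mean_value a b h; rewrite mul0r.
Qed.

(** Through this criterion, differentiation under an integral sign reduces to a
pointwise Taylor estimate. *)
Lemma quadratic_is_derive f (x l K : R) :
  (forall h, `|h| <= 1 -> `|f (x + h) - f x - h * l| <= K * h ^+ 2) ->
  is_derive (x : R) (1 : R) f l.
Proof.
move=> H.
suff C : h^-1 *: (f (h *: 1 + x) - f x) @[h --> 0^'] --> l.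
  by apply: DeriveDef; [apply/cvg_ex; exists l|exact/cvg_lim].
apply/cvgrPdist_le => e e0.
have K0 : 0 <= K.
  by have := H 1; rewrite normr1 lexx expr1n mulr1 => /(_ isT); exact: le_trans.
near=> h.
have h0 : h != 0 by near: h; exact: nbhs_dnbhs_neq.
have hn : 0 < `|h| by rewrite normr_gt0.
rewrite [h *: 1]mulr1 [h + x]addrC distrC.
rewrite -(ler_pM2l hn) -normrM mulrBr.
rewrite [h * (_ *: _)]mulrA mulfV// mul1r.
have h1 : `|h| <= 1 by near: h; apply: dnbhs0_le.
apply: (le_trans (H h h1)); rewrite -[h ^+ 2]real_normK ?num_real// expr2.
rewrite mulrCA ler_wpM2l ?normr_ge0//.
have hd : `|h| <= e / (K + 1).
  by near: h; apply: dnbhs0_le; rewrite divr_gt0// ltr_wpDl.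
apply: (le_trans (ler_wpM2l K0 hd)).
rewrite mulrCA ger_pMr// ler_pdivrMr ?ltr_wpDl// mul1r; lra.
Unshelve. all: by end_near. Qed.

(** The fundamental theorem of calculus on [[-n, n]], with [n] going to
infinity. *)
Lemma integral_derivative_eq0 f (g : R -> R) :
  (forall x, is_derive (x : R) (1 : R) f (g x)) -> continuous g ->
  mu.-integrable setT (EFin \o g) ->
  f n%:R @[n --> \oo] --> (0:R) -> f (- n%:R) @[n --> \oo] --> (0:R) ->
  \int[mu]_x g x = 0.
Proof.
move=> dF cg ig fy fNy.
have cF : continuous f by exact: is_derive_continuous dF.
have mg : measurable_fun setT g by exact: continuous_measurable_fun.
pose I (n : nat) : set R := `[- n.+1%:R, n.+1%:R]%classic.
have intI n : \int[mu]_(x in I n) g x = f n.+1%:R - f (- n.+1%:R).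
  rewrite /Rintegral /I (@continuous_FTC2 _ g f)//.
  - by have n0 : (0 : R) < n.+1%:R by []; lra.
  - exact: continuous_subspaceT.
  - split; first by move=> x _; exact: (@ex_derive _ _ _ _ _ _ _ (dF x)).
    + exact/cvg_at_right_filter/cF.
    + exact/cvg_at_left_filter/cF.
  - by move=> x _; rewrite derive1E; exact: (@derive_val _ _ _ _ _ _ _ (dF x)).
have H1 : \int[mu]_x (g \_ (I n)) x @[n --> \oo] --> \int[mu]_x g x.
  apply: (@Rintegral_cvg _ _ _ mu _ g (fun x => `|g x|)) => //.
  - move=> n; have mI : measurable (I n) by exact: measurable_itv.
    by apply/(measurable_restrictT g mI); exact: measurable_funTS.
  - move=> x; suff H : \forall n \near \oo, (g \_ (I n)) x = g x.
      exact: cvg_eventually.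
    near=> n.
    rewrite /patch ifT// inE /I/= in_itv/= -ler_norml.
    apply: (@le_trans _ _ n%:R); last by rewrite ler_nat.
    by near: n; exact: nbhs_infty_ger.
  - exact: integrable_norm.
  - by move=> n x; rewrite /patch; case: ifP => // _; rewrite normr0.
have H2 : f n.+1%:R - f (- n.+1%:R) @[n --> \oo] --> (0 - 0 : R).
  apply: cvgB; first by have := fy; rewrite -(cvg_shiftS (fun n => f n%:R)).
  by have := fNy; rewrite -(cvg_shiftS (fun n => f (- n%:R))).
have H3 : \int[mu]_x (g \_ (I n)) x @[n --> \oo] --> (0 : R).
  rewrite subr0 in H2.
  by under eq_fun do rewrite -Rintegral_mkcond intI.
exact: (cvg_unique _ H1 H3).
Unshelve. all: by end_near. Qed.

End Calculus.

(** * Gaussian laws on the line *)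

Section NormalLaw.
Context (R : realType).
Implicit Types (f h : R -> R) (x s m M : R).
Local Notation mu := (@lebesgue_measure R).

Lemma normal_ge0_integralE m s f : measurable_fun setT f ->
  (forall x, 0 <= f x) ->
  (\int[normal_prob m s]_x (f x)%:E = \int[mu]_x (f x * normal_pdf m s x)%:E)%E.
Proof.
move=> mf f0; have dom := @normal_prob_dominates R m s.
rewrite -(Radon_Nikodym_SigmaFinite.change_of_variables dom)//=; last exact/measurable_EFinP.
apply: ae_eq_integral => //.
- apply: emeasurable_funM => //; first exact/measurable_EFinP.
  by apply: (measurable_int mu); apply: Radon_Nikodym_SigmaFinite.f_integrable.
- apply: measurableT_comp => //; apply: measurable_funM => //.
  exact: measurable_normal_pdf.
- under [X in ae_eq _ _ _ X]eq_fun do rewrite EFinM.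
  apply: ae_eqe_mul2l => /=.
  apply: integral_ae_eq => //=.
  + exact: Radon_Nikodym_SigmaFinite.f_integrable.
  + by apply: measurableT_comp => //; exact: measurable_normal_pdf.
  + move=> E E01 mE; rewrite -Radon_Nikodym_SigmaFinite.f_integral//.
Qed.

Lemma normal_integrable m s f : measurable_fun setT f ->
  mu.-integrable setT (EFin \o (fun x => f x * normal_pdf m s x)) ->
  (normal_prob m s).-integrable setT (EFin \o f).
Proof.
move=> mf /integrableP[_ fi]; apply/integrableP; split.
  exact/measurable_EFinP.
move: fi; under eq_integral do
  rewrite /= normrM (ger0_norm (normal_pdf_ge0 _ _ _)).
rewrite -(@normal_ge0_integralE m s (fun x => `|f x|))//.
exact: measurableT_comp.
Qed.

Lemma normal_RintegralE m s f : measurable_fun setT f ->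
  mu.-integrable setT (EFin \o (fun x => f x * normal_pdf m s x)) ->
  \int[normal_prob m s]_x f x = \int[mu]_x (f x * normal_pdf m s x).
Proof.
move=> mf fi; pose fp x := Num.max (f x) 0; pose fn x := Num.max (- f x) 0.
have mp : measurable_fun setT (normal_pdf m s) by exact: measurable_normal_pdf.
have mfp : measurable_fun setT fp by exact: measurable_maxr.
have mfn : measurable_fun setT fn.
  by apply: measurable_maxr => //; exact: measurableT_comp.
have fE (x : R) : f x = fp x - fn x.
  rewrite /fp /fn /Num.max; by case: (ltP (f x) 0) => h1; case: (ltP (- f x) 0) => h2; lra.
have part (g : R -> R) : measurable_fun setT g -> (forall x : R, 0 <= g x <= `|f x|) ->
    [/\ mu.-integrable setT (EFin \o (fun x => g x * normal_pdf m s x)),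
        (normal_prob m s).-integrable setT (EFin \o g) &
        \int[normal_prob m s]_x g x = \int[mu]_x (g x * normal_pdf m s x)].
  move=> mg gf; have g0 x : 0 <= g x by have /andP[] := gf x.
  have ig : mu.-integrable setT (EFin \o (fun x => g x * normal_pdf m s x)).
    apply: (dom_integrable (integrable_norm fi)); first exact: measurable_funM.
    move=> x; rewrite /= !normrM ler_wpM2r// ger0_norm//.
    by have /andP[] := gf x.
  by split=> //; [exact: normal_integrable|rewrite /Rintegral normal_ge0_integralE].
have [|ip ip' Ep] := part fp mfp.
  by move=> x; rewrite le_max lexx orbT/= ge_max ler_norm normr_ge0.
have [|im im' En] := part fn mfn.
  by move=> x; rewrite le_max lexx orbT/= ge_max -normrN ler_norm normr_ge0.
have -> : f = fun x => fp x - fn x by apply/funext.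
rewrite (RintegralB measurableT ip' im') Ep En -(RintegralB measurableT ip im).
by apply: eq_Rintegral => x _; rewrite mulrBl.
Qed.

Lemma normal_pdf_gt0E s x : 0 < s ->
  normal_pdf 0 s x = normal_peak s * expR (- x ^+ 2 / (s ^+ 2 *+ 2)).
Proof.
by move=> s0; rewrite normal_pdfE ?gt_eqF// /normal_fun subr0.
Qed.

(** Doubling the standard deviation absorbs polynomial factors. *)
Lemma normal_pdf_poly s : 0 < s -> exists2 M, 0 <= M &
  forall x, (1 + x ^+ 8) * normal_pdf 0 s x <= M * normal_pdf 0 (2 * s) x.
Proof.
move=> s0; have ss0 : 0 < 2 * s by rewrite mulr_gt0.
pose p := normal_peak s; pose p2 := normal_peak (2 * s).
have p0 : 0 <= p by exact: normal_peak_ge0.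
have p20 : 0 < p2 by apply: normal_peak_gt0; rewrite gt_eqF.
pose c := (8 * s ^+ 2) ^+ 4.
have c0 : 0 <= c by rewrite exprn_ge0// mulr_ge0// sqr_ge0.
exists ((1 + 24 * c) * (p / p2)).
  by rewrite mulr_ge0 ?divr_ge0 ?(ltW p20)// addr_ge0// mulr_ge0.
move=> x; rewrite !normal_pdf_gt0E// -/p -/p2.
set y := x ^+ 2 / (8 * s ^+ 2).
have sn0 : s != 0 by rewrite gt_eqF.
have y0 : 0 <= y by rewrite divr_ge0 ?sqr_ge0// mulr_ge0// sqr_ge0.
have -> : - x ^+ 2 / (s ^+ 2 *+ 2) = - y - 3 * y by rewrite /y; field.
have -> : - x ^+ 2 / ((2 * s) ^+ 2 *+ 2) = - y by rewrite /y; field.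
have -> : x ^+ 8 = c * y ^+ 4 by rewrite /c /y; field.
have e1 : 1 + y ^+ 4 / 24 <= expR y by have := expR_ge1Dxn 3 y0.
have e2 : expR (- (3 * y)) * expR y <= 1.
  by rewrite -expRD -[leRHS]expR0 ler_expR; lra.
rewrite expRD.
have -> : (1 + 24 * c) * (p / p2) * (p2 * expR (- y)) =
  p * expR (- y) * (1 + 24 * c) by field; rewrite gt_eqF.
rewrite [leLHS](_ : _ = p * expR (- y) * (expR (- (3 * y)) * (1 + c * y ^+ 4)));
  last by ring.
apply: ler_wpM2l; first by rewrite mulr_ge0// expR_ge0.
have e3 : 1 + c * y ^+ 4 <= (1 + 24 * c) * expR y.
  have y4 : 0 <= y ^+ 4 by rewrite exprn_ge0.
  nra.
apply: (le_trans (ler_wpM2l (expR_ge0 _) e3)).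
rewrite mulrCA ler_piMr// addr_ge0// mulr_ge0//.
Qed.

Lemma normal_poly_integrable s f M : 0 < s -> measurable_fun setT f ->
  (forall x, `|f x| <= M * (1 + x ^+ 8)) ->
  mu.-integrable setT (EFin \o (fun x => f x * normal_pdf 0 s x)).
Proof.
move=> s0 mf fM; have [K K0 HK] := normal_pdf_poly s0.
have x8 x : 0 <= 1 + x ^+ 8 by rewrite addr_ge0// exprn_even_ge0.
have M0 : 0 <= M by have := fM 0; rewrite expr0n addr0 mulr1; exact: le_trans.
apply: (@dom_integrable _ _ _ mu _ (fun x => M * K * normal_pdf 0 (2 * s) x)).
- by apply: integrable_scale; exact: integrable_normal_pdf.
- by apply: measurable_funM => //; exact: measurable_normal_pdf.
- move=> x; rewrite normrM (ger0_norm (normal_pdf_ge0 _ _ _)).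
  apply: (le_trans (ler_wpM2r (normal_pdf_ge0 _ _ _) (fM x))).
  by rewrite -!mulrA ler_wpM2l.
Qed.

Lemma cvg_inv_dom (u : nat -> R) (C : R) :
  (forall n, `|u n| * n%:R <= C) -> u n @[n --> \oo] --> (0 : R).
Proof.
move=> H; apply/cvgr0Pnorm_le => e e0.
have C0 : 0 <= C by apply: le_trans (H 0%N); rewrite mulr0.
near=> n; have n0 : (0 : R) < n%:R.
  by rewrite ltr0n; near: n; exact: nbhs_infty_gt.
rewrite -(ler_pM2r n0); apply: (le_trans (H n)).
rewrite -ler_pdivrMl//; near: n; apply: nbhs_infty_ger.
Unshelve. all: by end_near. Qed.

(** Stein's identity: the density satisfies [s ^ 2 * p' = - x * p]. *)
Lemma normal_stein s h (dh : R -> R) M : 0 < s ->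
  (forall x, is_derive (x : R) (1 : R) h (dh x)) -> continuous dh ->
  (forall x, `|h x| <= M * (1 + x ^+ 4)) ->
  (forall x, `|dh x| <= M * (1 + x ^+ 4)) ->
  \int[normal_prob 0 s]_x (x * h x) = s ^+ 2 * \int[normal_prob 0 s]_x dh x.
Proof.
move=> s0 Dh cdh hM dhM; have ch : continuous h by exact: is_derive_continuous Dh.
have sn0 : s != 0 by rewrite gt_eqF.
have mh : measurable_fun setT h by exact: continuous_measurable_fun.
have mdh : measurable_fun setT dh by exact: continuous_measurable_fun.
have M0 : 0 <= M by have := hM 0; rewrite expr0n addr0 mulr1; exact: le_trans.
have x4 x : 0 <= x ^+ 4 by rewrite exprn_even_ge0.
have b1 x : 1 + x ^+ 4 <= 2 * (1 + x ^+ 8).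
  have := x4 x; rewrite (exprM x 4 2) => y0; nra.
have b2 x : `|x| * (1 + x ^+ 4) <= 2 * (1 + x ^+ 8).
  have <- : `|x| ^+ 4 = x ^+ 4 by rewrite -normrX ger0_norm.
  have <- : `|x| ^+ 8 = x ^+ 8 by rewrite -normrX ger0_norm// exprn_even_ge0.
  have : 0 <= `|x| by []; move: `|x| => t t0.
  have [t1|t1] := leP t 1.
    have : t ^+ 4 <= 1 by rewrite exprn_ile1.
    have : 0 <= t ^+ 8 by rewrite exprn_ge0.
    have : 0 <= t ^+ 4 by rewrite exprn_ge0.
    nra.
  have h1 : t <= t ^+ 8 by rewrite -[leLHS]expr1 ler_weXn2l// ltW.
  have h2 : t ^+ 5 <= t ^+ 8 by rewrite ler_weXn2l// ltW.
  rewrite mulrDr mulr1 -exprS; lra.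
have mx : measurable_fun setT (fun x : R => x) by exact: measurable_id.
have I1 : mu.-integrable setT (EFin \o (fun x => x * h x * normal_pdf 0 s x)).
  apply: (@normal_poly_integrable _ _ (M * 2)) => //; first exact: measurable_funM.
  move=> x; rewrite normrM mulrC -mulrA.
  apply: (le_trans (ler_wpM2r _ (hM x))) => //.
  by rewrite -mulrA [_ * `|x|]mulrC ler_wpM2l.
have I2 : mu.-integrable setT (EFin \o (fun x => dh x * normal_pdf 0 s x)).
  apply: (@normal_poly_integrable _ _ (M * 2)) => //.
  move=> x; apply: (le_trans (dhM x)).
  by rewrite -mulrA ler_wpM2l.
rewrite !normal_RintegralE//; last exact: measurable_funM.
pose G x := h x * normal_pdf 0 s x.
pose g x := dh x * normal_pdf 0 s x - s ^- 2 * (x * h x * normal_pdf 0 s x).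
have DG x : is_derive (x : R) (1 : R) G (g x).
  pose k : R := - (s ^+ 2 *+ 2)^-1.
  have E y : normal_pdf 0 s y = normal_peak s * expR (k * y ^+ 2).
    by rewrite normal_pdf_gt0E//; congr (_ * expR _); rewrite /k; field.
  rewrite /G; under eq_fun do rewrite E.
  have De := is_derive_expRf (is_derive_scale k (is_derive_expn 1 (is_derive_idfun x))).
  apply: (is_derive_eq (is_derive_mul (Dh x) (is_derive_scale (normal_peak s) De))).
  by rewrite /g E /k; field.
have ig : mu.-integrable setT (EFin \o g).
  by apply: integrable_sub => //; exact: integrable_scale.
have cp : continuous (normal_pdf 0 s) by exact: continuous_normal_pdf.
have cg : continuous g.
  move=> x; apply: cvgB; first by apply: cvgM; [exact: cdh|exact: cp].
  apply: cvgM; first exact: cvg_cst.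
  by apply: cvgM; [apply: cvgM; [exact: cvg_id|exact: ch]|exact: cp].
have [K K0 HK] := normal_pdf_poly s0.
have Gb x : `|G x| * `|x| <= 2 * M * K * normal_peak (2 * s).
  rewrite /G normrM mulrAC (ger0_norm (normal_pdf_ge0 _ _ _)).
  apply: (@le_trans _ _ (2 * M * ((1 + x ^+ 8) * normal_pdf 0 s x))).
    rewrite mulrA ler_wpM2r ?normal_pdf_ge0//.
    apply: (le_trans (ler_wpM2r _ (hM x))) => //.
    by rewrite [2 * M]mulrC -!mulrA [_ * `|x|]mulrC ler_wpM2l.
  rewrite -!mulrA ler_wpM2l// ler_wpM2l//.
  apply: (le_trans (HK x)); rewrite ler_wpM2l// normal_pdf_ub// mulf_neq0//.
have : \int[mu]_x g x = 0.
  apply: (integral_derivative_eq0 DG cg ig); apply: cvg_inv_dom => n.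
  - by have := Gb n%:R; rewrite normr_nat; exact.
  - by have := Gb (- n%:R); rewrite normrN normr_nat; exact.
rewrite /g RintegralB//; last exact: integrable_scale.
rewrite RintegralZl//.
move/eqP; rewrite subr_eq0 => /eqP ->.
by rewrite mulrA mulfV ?mul1r// sqrf_eq0.
Qed.
End NormalLaw.

Section NormalMean.
Context (R : realType).
Implicit Types (x s m : R).
Local Notation mu := (@lebesgue_measure R).

Lemma normal_pdf_center m s x : s != 0 ->
  normal_pdf m s x = normal_pdf 0 s (x - m).
Proof. by move=> s0; rewrite !normal_pdfE// /normal_fun subr0. Qed.

(** [(x - m) * p x] is the derivative of [- s ^ 2 * p x], [p] being the density. *)
Lemma normal_mean m s : 0 < s ->
  (normal_prob m s).-integrable setT (EFin \o (fun x : R => x)) /\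
  \int[normal_prob m s]_x x = m.
Proof.
move=> s0; have sn0 : s != 0 by rewrite gt_eqF.
have [K K0 HK] := normal_pdf_poly s0.
have ip : mu.-integrable setT (EFin \o normal_pdf m s).
  exact: integrable_normal_pdf.
have ip2 : mu.-integrable setT (EFin \o (fun x => K * normal_pdf m (2 * s) x)).
  by apply: integrable_scale; exact: integrable_normal_pdf.
have mp : measurable_fun setT (normal_pdf m s) by exact: measurable_normal_pdf.
have mx : measurable_fun setT (fun x : R => x) by exact: measurable_id.
have HK1 x : `|x - m| * normal_pdf m s x <= K * normal_pdf m (2 * s) x.
  rewrite !(@normal_pdf_center m)// ?mulf_neq0//.
  apply: le_trans (HK (x - m)); rewrite ler_wpM2r ?normal_pdf_ge0//.
  rewrite -[_ ^+ 8]ger0_norm ?exprn_even_ge0// normrX.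
  have := normr_ge0 (x - m); move: `|x - m| => t t0.
  have [t1|t1] := leP t 1; first by rewrite (le_trans t1)// lerDl exprn_ge0.
  by rewrite ler_wpDl// -[leLHS]expr1 ler_weXn2l// ltW.
have i1 : mu.-integrable setT (EFin \o (fun x => (x - m) * normal_pdf m s x)).
  apply: (dom_integrable ip2).
    by apply: measurable_funM => //; apply: measurable_funB.
  by move=> x; rewrite normrM [`|normal_pdf _ _ _|]ger0_norm ?normal_pdf_ge0.
have i2 : mu.-integrable setT (EFin \o (fun x => x * normal_pdf m s x)).
  have := integrable_add i1 (integrable_scale m ip).
  by congr (mu.-integrable _ _); apply/funext => x /=; congr EFin; ring.
split; first exact: normal_integrable.
rewrite normal_RintegralE//.
have D x : is_derive (x : R) (1 : R) (fun y => - s ^+ 2 * normal_pdf m s y)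
    ((x - m) * normal_pdf m s x).
  pose k : R := - (s ^+ 2 *+ 2)^-1.
  have E y : normal_pdf m s y = normal_peak s * expR (k * (y - m) ^+ 2).
    by rewrite normal_pdfE//; congr (_ * expR _); rewrite /k; field.
  under eq_fun do rewrite E.
  have De := is_derive_expRf (is_derive_scale k (is_derive_expn 1 (is_derive_sub (is_derive_idfun x) (is_derive_cstfun m x)))).
  apply: (is_derive_eq (is_derive_scale (- s ^+ 2) (is_derive_scale (normal_peak s) De))).
  by rewrite E /k; field.
have cp : continuous (normal_pdf m s) by exact: continuous_normal_pdf.
have cg : continuous (fun x => (x - m) * normal_pdf m s x).
  move=> x; apply: cvgM; last exact: cp.
  by apply: cvgB; [exact: cvg_id|exact: cvg_cst].
pose C := s ^+ 2 * (K * normal_peak (2 * s) + `|m| * normal_peak s).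
have Gb x : `|- s ^+ 2 * normal_pdf m s x| * `|x| <= C.
  rewrite normrM normrN (ger0_norm (normal_pdf_ge0 _ _ _)) ger0_norm ?sqr_ge0//.
  rewrite /C -mulrA ler_wpM2l ?sqr_ge0//.
  apply: (@le_trans _ _ (normal_pdf m s x * (`|x - m| + `|m|))).
    rewrite ler_wpM2l ?normal_pdf_ge0//.
    by apply: le_trans (ler_normD _ _); rewrite subrK.
  rewrite mulrDr [_ * `|x - m|]mulrC [_ * `|m|]mulrC.
  apply: lerD; last by rewrite ler_wpM2l// normal_pdf_ub.
  apply: (le_trans (HK1 x)).
  by rewrite ler_wpM2l// normal_pdf_ub// mulf_neq0.
have : \int[mu]_x ((x - m) * normal_pdf m s x) = 0.
  apply: (integral_derivative_eq0 D cg i1); apply: (@cvg_inv_dom _ _ C) => n.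
  - by have := Gb n%:R; rewrite normr_nat; exact.
  - by have := Gb (- n%:R); rewrite normrN normr_nat; exact.
under eq_Rintegral do rewrite mulrBl.
rewrite RintegralB//; last exact: integrable_scale.
rewrite RintegralZl// => /eqP; rewrite subr_eq0 => /eqP ->.
by rewrite /Rintegral integral_normal_pdf mulr1.
Qed.

End NormalMean.

(** * Moments and characteristic functions of normal variables *)

Section TrigExpect.
Context d (T : measurableType d) (R : realType).
Variable mu : {measure set T -> \bar R}.

Lemma cos_quadratic (a h : R) : `|cos (a + h) - cos a + h * sin a| <= h ^+ 2.
Proof.
have D (x : R) : is_derive (x : R) (1 : R) (fun y => cos y + y * sin a)
    (- sin x + sin a).
  apply: (is_derive_eq (is_derive_add (is_derive_cos x) (is_derive_mul (is_derive_idfun x) (is_derive_cstfun _ x)))).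
  by rewrite mul1r mulr0 addr0.
have [c cab] := mean_value a (a + h) D.
have -> : cos (a + h) + (a + h) * sin a - (cos a + a * sin a) =
  cos (a + h) - cos a + h * sin a by ring.
move=> ->; rewrite [a + h]addrC addrK.
have [e _ he] := mean_value c a (@is_derive_sin R).
rewrite [- sin c + _]addrC he normrM normrM -[h ^+ 2]ger0_norm ?sqr_ge0// normrX.
rewrite expr2 ler_wpM2r//.
apply: (@le_trans _ _ (1 * `|a - c|)); first by rewrite ler_wpM2r// cos_max.
rewrite mul1r; move: cab; rewrite /Num.min /Num.max ler_norml.
have : - `|h| <= h <= `|h| by rewrite -ler_norml.
by case: ltP => _ /andP[h1 h2] /andP[h3 h4]; apply/andP; split; lra.
Qed.

(** The Taylor remainder of [cos] is at most [(h * Z) ^ 2], which is integrable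
against [Y]. *)
Lemma expect_cos_is_derive (Y A Z : T -> R) (t : R) :
  measurable_fun setT Y -> measurable_fun setT A -> measurable_fun setT Z ->
  mu.-integrable setT (EFin \o Y) ->
  mu.-integrable setT (EFin \o (fun w => Y w * Z w)) ->
  mu.-integrable setT (EFin \o (fun w => Y w * Z w ^+ 2)) ->
  is_derive (t : R) (1 : R) (fun t => \int[mu]_w (Y w * cos (A w + t * Z w)))
    (\int[mu]_w (- (Y w * Z w * sin (A w + t * Z w)))).
Proof.
move=> mY mA mZ iY iYZ iYZ2.
have mc (u : R) : measurable_fun setT (fun w => cos (A w + u * Z w)).
  apply: (measurableT_comp (continuous_measurable_fun (@continuous_cos R))).
  by apply: measurable_funD => //; exact: measurable_funM.
have ms (u : R) : measurable_fun setT (fun w => sin (A w + u * Z w)).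
  apply: (measurableT_comp (continuous_measurable_fun (@continuous_sin R))).
  by apply: measurable_funD => //; exact: measurable_funM.
have ic (u : R) : mu.-integrable setT (EFin \o (fun w => Y w * cos (A w + u * Z w))).
  apply: (@dom_integrable _ _ _ mu _ (fun x => `|Y x|)).
  - exact: integrable_norm.
  - exact: measurable_funM.
  - by move=> w; rewrite normrM ler_piMr// cos_max.
have is_ : mu.-integrable setT (EFin \o (fun w => - (Y w * Z w * sin (A w + t * Z w)))).
  apply: (@dom_integrable _ _ _ mu _ (fun x => `|Y x * Z x|)).
  - exact: integrable_norm.
  - apply: measurableT_comp => //.
    by apply: measurable_funM => //; exact: measurable_funM.
  - by move=> w; rewrite normrN normrM ler_piMr// sin_max.
apply: (@quadratic_is_derive _ _ _ _ (\int[mu]_w `|Y w * Z w ^+ 2|)) => h _.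
rewrite -RintegralB// -RintegralZl// -RintegralB//; last 2 first.
- exact: integrable_sub.
- exact: integrable_scale.
have -> : \int[mu]_w `|Y w * Z w ^+ 2| * h ^+ 2 =
    \int[mu]_w (h ^+ 2 * `|Y w * Z w ^+ 2|).
  by rewrite RintegralZl 1?mulrC//; exact: integrable_norm.
apply: le_trans (le_normr_Rintegral measurableT _) _.
  by apply: integrable_sub; [exact: integrable_sub|exact: integrable_scale].
apply: le_Rintegral => //.
- apply: integrable_norm; apply: integrable_sub; first exact: integrable_sub.
  exact: integrable_scale.
- by apply: integrable_scale; exact: integrable_norm.
move=> w _; rewrite [X in `|X|](_ : _ = Y w * (cos (A w + t * Z w + h * Z w) -
   cos (A w + t * Z w) + (h * Z w) * sin (A w + t * Z w))); last first.
  by rewrite [A w + (t + h) * Z w](_ : _ = A w + t * Z w + h * Z w); ring.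
rewrite !normrM mulrCA ler_wpM2l//.
apply: (le_trans (cos_quadratic _ _)).
by rewrite exprMn -normrM -expr2 [`|_|]ger0_norm ?sqr_ge0.
Qed.

End TrigExpect.

Section NormalVariable.
Context d (T : measurableType d) (R : realType) (P : probability T R).

(** The case [s = 0] is a Dirac mass, which has no density. *)
Definition centered_normal (X : T -> R) (s : R) : Prop :=
  [/\ 0 <= s, measurable_fun setT X &
    forall A, measurable A -> P (X @^-1` A) =
      if s == 0 then \d_(0 : R) A else normal_prob 0 s A].

Variables (X : T -> R) (s : R) (HX : centered_normal X s).

Let s_ge0 : 0 <= s. Proof. by case: HX. Qed.
Let mX : measurable_fun setT X. Proof. by case: HX. Qed.

(** Degree eight accommodates [x * h x] for [h] of degree four, as needed for
Stein's identity. *)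
Lemma centered_normal_expect (f : R -> R) (M : R) : measurable_fun setT f ->
  (forall x, `|f x| <= M * (1 + x ^+ 8)) ->
  P.-integrable setT (EFin \o (fun w => f (X w))) /\
  \int[P]_w f (X w) = if s == 0 then f 0 else \int[normal_prob 0 s]_x f x.
Proof.
move=> mf fM.
have mfE : measurable_fun setT (EFin \o f) by exact/measurable_EFinP.
pose GR := measurableTypeR R.
have mX' : measurable_fun setT (X : T -> GR) by exact: mX.
pose Xm := isMeasurableFun.Build _ _ _ _ (X : T -> GR) mX'.
pose X' : {RV P >-> GR} := HB.pack (X : T -> GR) Xm.
have eqI0 (g : R -> \bar R) : s = 0 ->
    (\int[distribution P X']_x g x = \int[\d_(0%R : GR)]_x g x)%E.
  move=> s0; apply: eq_measure_integral => A mA _.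
  by case: HX => _ _ law; have := law A mA; rewrite s0 eqxx.
have eqI1 (g : R -> \bar R) : s <> 0 ->
    (\int[distribution P X']_x g x = \int[normal_prob 0 s]_x g x)%E.
  move=> /eqP/negbTE s0; apply: eq_measure_integral => A mA _.
  by case: HX => _ _ law; have := law A mA; rewrite s0.
have iP : P.-integrable setT (EFin \o (fun w => f (X w))).
  apply/integrableP; split.
    by apply/measurable_EFinP; exact: measurableT_comp.
  rewrite -(@ge0_integral_distribution _ _ _ _ _ P X' (fun x => `|(f x)%:E|%E))//;
    last exact: measurableT_comp.
  have [s0|s0] := pselect (s = 0).
    rewrite eqI0// integral_dirac//; last exact: measurableT_comp.
    by rewrite diracT mul1e /= ltry.
  have sp : 0 < s by rewrite lt_def s_ge0 andbT; apply/eqP.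
  rewrite eqI1//.
  have := normal_integrable mf (normal_poly_integrable sp mf fM).
  by case/integrableP.
split => //.
rewrite /Rintegral -(@integral_distribution _ _ _ _ _ P X' (EFin \o f))//.
case: eqP => s0; last by rewrite eqI1.
by rewrite eqI0// integral_dirac// diracT mul1e.
Qed.

End NormalVariable.

Section NormalVariableMoments.
Context d (T : measurableType d) (R : realType) (P : probability T R).

Lemma Rintegral_prob_cst (c : R) : \int[P]_w c = c.
Proof.
rewrite Rintegral_cst//; transitivity (c * fine (1%E : \bar R)).
  by congr (_ * fine _); exact: probability_setT.
by rewrite mulr1.
Qed.

Lemma norm_expr_le (x : R) k m : ~~ odd m -> (k <= m)%N ->
  `|x ^+ k| <= 1 + x ^+ m.
Proof.
move=> em km; rewrite normrX -[x ^+ m]ger0_norm ?exprn_even_ge0// normrX.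
have := normr_ge0 x; move: `|x| => t t0.
have [t1|t1] := leP t 1; first by rewrite ler_wpDr ?exprn_ge0// exprn_ile1.
by rewrite ler_wpDl// ler_weXn2l// ltW.
Qed.

Variables (X : T -> R) (s : R) (HX : centered_normal P X s).

Let s_ge0 : 0 <= s. Proof. by case: HX. Qed.
Let mX : measurable_fun setT X. Proof. by case: HX. Qed.

Lemma centered_normal_stein (h dh : R -> R) M :
  (forall x, is_derive (x : R) (1 : R) h (dh x)) -> continuous dh ->
  (forall x, `|h x| <= M * (1 + x ^+ 4)) ->
  (forall x, `|dh x| <= M * (1 + x ^+ 4)) ->
  \int[P]_w (X w * h (X w)) = s ^+ 2 * \int[P]_w dh (X w).
Proof.
move=> Dh cdh hM dhM.
have M0 : 0 <= M by have := hM 0; rewrite expr0n addr0 mulr1; exact: le_trans.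
have ch : continuous h by exact: is_derive_continuous Dh.
have b1 (x : R) : 1 + x ^+ 4 <= 2 * (1 + x ^+ 8).
  have : 0 <= x ^+ 4 by rewrite exprn_even_ge0.
  by rewrite (exprM x 4 2) => y0; nra.
have b2 (x : R) : `|x| * (1 + x ^+ 4) <= 2 * (1 + x ^+ 8).
  have h1 := @norm_expr_le x 1 8 isT isT; have h2 := @norm_expr_le x 5 8 isT isT.
  rewrite expr1 in h1; rewrite mulrDr mulr1.
  have -> : `|x| * x ^+ 4 = `|x ^+ 5|.
    by rewrite exprS normrM [`|x ^+ 4|]ger0_norm// exprn_even_ge0.
  lra.
have m1 : measurable_fun setT (fun x : R => x * h x).
  by apply: measurable_funM => //; exact: continuous_measurable_fun.
have m2 : measurable_fun setT dh by exact: continuous_measurable_fun.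
have B1 x : `|x * h x| <= M * 2 * (1 + x ^+ 8).
  rewrite normrM; apply: (le_trans (ler_wpM2l (normr_ge0 _) (hM x))).
  by rewrite mulrCA -mulrA ler_wpM2l.
have B2 x : `|dh x| <= M * 2 * (1 + x ^+ 8).
  by apply: (le_trans (dhM x)); rewrite -mulrA ler_wpM2l.
rewrite (centered_normal_expect HX m1 B1).2 (centered_normal_expect HX m2 B2).2.
case: eqP => [->|/eqP s0]; first by rewrite mul0r expr0n mul0r.
by apply: (@normal_stein _ _ h dh M) => //; rewrite lt_def s0.
Qed.

Lemma centered_normal_expr_integrable k : (k <= 8)%N ->
  P.-integrable setT (EFin \o (fun w => X w ^+ k)).
Proof.
move=> k8; have m1 : measurable_fun setT (fun x : R => x ^+ k).
  by apply: measurable_funX; exact: measurable_id.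
have B1 (x : R) : `|x ^+ k| <= 1 * (1 + x ^+ 8) by rewrite mul1r norm_expr_le.
exact: (centered_normal_expect HX m1 B1).1.
Qed.

Lemma centered_normal_sqr : \int[P]_w (X w ^+ 2) = s ^+ 2.
Proof.
under eq_Rintegral do rewrite expr2.
rewrite (@centered_normal_stein (fun x => x) (fun=> 1) 1).
- by rewrite Rintegral_prob_cst mulr1.
- by move=> x; exact: cvg_cst.
- by move=> x; rewrite mul1r -[X in `|X|]expr1 norm_expr_le.
- by move=> x; rewrite mul1r normr1 lerDl exprn_even_ge0.
Qed.

Lemma centered_normal_fourth : \int[P]_w (X w ^+ 4) = 3 * s ^+ 4.
Proof.
under eq_Rintegral do rewrite exprS.
have D (x : R) : is_derive (x : R) (1 : R) (fun x => x ^+ 3) (3 * x ^+ 2).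
  by apply: (is_derive_eq (is_derive_expn 2 (is_derive_idfun x))); rewrite mulr1.
rewrite (@centered_normal_stein (fun x => x ^+ 3) (fun x => 3 * x ^+ 2) 3 D).
- rewrite RintegralZl//; last exact: centered_normal_expr_integrable.
  by rewrite centered_normal_sqr; ring.
- move=> x; apply: cvgM; [exact: cvg_cst|exact: exprn_continuous].
- move=> x; have := @norm_expr_le x 3 4 isT isT.
  have : 0 <= x ^+ 4 by rewrite exprn_even_ge0.
  by move=> a b; apply: (le_trans b); lra.
- by move=> x; rewrite normrM normr_nat ler_wpM2l// norm_expr_le.
Qed.

(** The characteristic function solves [J' t = - s ^ 2 * t * J t]. *)
Lemma centered_normal_cos (t b : R) :
  \int[P]_w cos (b + t * X w) = cos b * expR (- (s ^+ 2 * t ^+ 2 / 2)) /\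
  \int[P]_w (X w * sin (b + t * X w)) =
    s ^+ 2 * t * (cos b * expR (- (s ^+ 2 * t ^+ 2 / 2))).
Proof.
pose J u := \int[P]_w cos (b + u * X w).
have S u : \int[P]_w (X w * sin (b + u * X w)) = s ^+ 2 * u * J u.
  have D (x : R) : is_derive (x : R) (1 : R) (fun x => b + u * x) u.
    by apply: (is_derive_eq (is_derive_add (is_derive_cstfun b x) (is_derive_scale u (is_derive_idfun x)))); ring.
  have Ds (x : R) : is_derive (x : R) (1 : R) (fun x => sin (b + u * x))
      (cos (b + u * x) * u).
    exact: (is_derive_compf (is_derive_sin _) (D x)).
  rewrite (@centered_normal_stein _ _ (1 + `|u|) Ds).
  - under eq_Rintegral do rewrite mulrC.
    rewrite RintegralZl//; first by rewrite mulrA.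
    have mc : measurable_fun setT (fun w => cos (b + u * X w)).
      apply: (measurableT_comp (continuous_measurable_fun (@continuous_cos R))).
      by apply: measurable_funD => //; exact: measurable_funM.
    apply: (@dom_integrable _ _ _ P _ (fun=> 1)) => //.
      exact: finite_measure_integrable_cst.
    by move=> w; exact: cos_max.
  - move=> x; apply: cvgM; last exact: cvg_cst.
    apply: (@continuous_comp _ _ _ (fun x => b + u * x) (@cos R));
      last exact: continuous_cos.
    exact: (is_derive_continuous D).
  - move=> x; apply: (le_trans (sin_max _)).
    have : 0 <= x ^+ 4 by rewrite exprn_even_ge0.
    have := normr_ge0 u; move: (x ^+ 4) => y *; nra.
  - move=> x; rewrite normrM.
    have c1 := cos_max (b + u * x).
    apply: (le_trans (ler_wpM2r (normr_ge0 _) c1)).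
    have : 0 <= x ^+ 4 by rewrite exprn_even_ge0.
    have := normr_ge0 u; move: (x ^+ 4) => y *; nra.
have DJ (u : R) : is_derive (u : R) (1 : R) J (- (s ^+ 2 * u * J u)).
  have i1 : P.-integrable setT (EFin \o (fun _ : T => (1 : R))).
    exact: finite_measure_integrable_cst.
  have := @expect_cos_is_derive _ _ _ P (fun=> 1) (fun=> b) X u
    (measurable_cst _) (measurable_cst _) mX i1.
  under [X in P.-integrable _ X -> _]eq_fun do rewrite /= mul1r.
  move=> /(_ (@centered_normal_expr_integrable 1 isT)).
  under [X in P.-integrable _ X -> _]eq_fun do rewrite /= mul1r.
  move=> /(_ (@centered_normal_expr_integrable 2 isT)) H.
  have EJ : (fun t => \int[P]_w (1 * cos (b + t * X w))) = J.
    by apply/funext => v; apply: eq_Rintegral => w _; rewrite mul1r.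
  rewrite EJ in H.
  apply: (is_derive_eq H); rewrite -S -mulN1r -RintegralZl//.
    by apply: eq_Rintegral => w _; rewrite mul1r mulN1r.
  apply: (@dom_integrable _ _ _ P _ (fun w => `|X w|)).
  - by apply: integrable_norm; exact: (@centered_normal_expr_integrable 1 isT).
  - apply: measurable_funM => //.
    apply: (measurableT_comp (continuous_measurable_fun (@continuous_sin R))).
    by apply: measurable_funD => //; exact: measurable_funM.
  - by move=> w; rewrite normrM ler_piMr// sin_max.
have JE : J t = cos b * expR (- (s ^+ 2 * t ^+ 2 / 2)).
  have D (x : R) : is_derive (x : R) (1 : R)
      (fun u => J u * expR (s ^+ 2 / 2 * u ^+ 2)) 0.
    apply: (is_derive_eq (is_derive_mul (DJ x)
      (is_derive_expRf (is_derive_scale (s ^+ 2 / 2) (is_derive_expn 1 (is_derive_idfun x)))))).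
    by field.
  have := is_derive_eq0_cst t 0 D.
  rewrite expr0n mulr0 expR0 mulr1 /J.
  under [X in _ = X]eq_Rintegral do rewrite mul0r addr0.
  rewrite Rintegral_prob_cst => <-.
  rewrite -[RHS]mulrA -expRD (_ : _ + _ = 0) ?expR0 ?mulr1//; lra.
by rewrite S JE.
Qed.

End NormalVariableMoments.

(** * Gaussian vectors *)

Section FubiniProduct.
Context d1 d2 (T1 : measurableType d1) (T2 : measurableType d2) (R : realType).
Variables (m1 : probability T1 R) (m2 : probability T2 R).

(** A product of integrable functions that dominates [h] makes it integrable on
the product space. *)
Lemma Rintegral_Fubini (h : T1 * T2 -> R) (u : T1 -> R) (v : T2 -> R) :
  measurable_fun setT h ->
  m1.-integrable setT (EFin \o u) -> m2.-integrable setT (EFin \o v) ->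
  (forall x y, `|h (x, y)| <= u x * v y) ->
  \int[m1]_x \int[m2]_y h (x, y) = \int[m2]_y \int[m1]_x h (x, y).
Proof.
move=> mh iu iv huv.
have mhx x : measurable_fun setT (fun y => h (x, y)).
  by apply: measurableT_comp => //; exact: measurable_pair1.
have mhy y : measurable_fun setT (fun x => h (x, y)).
  by apply: measurableT_comp => //; exact: measurable_pair2.
have ix x : m2.-integrable setT (EFin \o (fun y => h (x, y))).
  by apply: (dom_integrable (integrable_scale (u x) iv)).
have iy y : m1.-integrable setT (EFin \o (fun x => h (x, y))).
  apply: (dom_integrable (integrable_scale (v y) iu)) => // x.
  by rewrite mulrC.
have mhE : measurable_fun setT (EFin \o h) by exact/measurable_EFinP.
pose V := \int[m2]_y `|v y|.
have iu' : m1.-integrable setT (EFin \o (fun x => V * `|u x|)).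
  by apply: integrable_scale; exact: integrable_norm.
have ih : (m1 \x m2)%E.-integrable setT (EFin \o h).
  apply/integrable12ltyP => //.
  apply: (@le_lt_trans _ _ (\int[m1]_x (V * `|u x|)%:E)%E); last first.
    exact: integrable_lty.
  apply: ge0_le_integral => //.
  - by move=> x _; exact: integral_ge0.
  - apply: (@measurable_fun_fubini_tonelli_F _ _ _ _ _ m2 (fun z => `|(h z)%:E|%E)) => //.
    by apply: measurableT_comp => //.
  - exact: (measurable_int m1 iu').
  - move=> x _; have iv' := integrable_scale `|u x| (integrable_norm iv).
    rewrite mulrC /V -RintegralZl//; last exact: integrable_norm.
    rewrite /Rintegral fineK; last exact: integrable_fin_num iv'.
    apply: ge0_le_integral => //.
    + by apply: measurableT_comp => //; apply/measurable_EFinP.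
    + exact: (measurable_int m2 iv').
    + move=> y _; rewrite lee_fin -normrM.
      by apply: (le_trans (huv x y)); rewrite ler_norm.
have E1 : (\int[m1]_x (\int[m2]_y h (x, y))%R%:E =
    \int[m1]_x \int[m2]_y (h (x, y))%:E)%E.
  by apply: eq_integral => x _; rewrite fineK//; exact: integrable_fin_num (ix x).
have E2 : (\int[m2]_y (\int[m1]_x h (x, y))%R%:E =
    \int[m2]_y \int[m1]_x (h (x, y))%:E)%E.
  by apply: eq_integral => y _; rewrite fineK//; exact: integrable_fin_num (iy y).
by rewrite {1}/Rintegral E1 (Fubini ih) -E2.
Qed.

End FubiniProduct.

Section FiniteSums.
Context d (T : measurableType d) (R : realType).
Variable mu : {measure set T -> \bar R}.

Lemma integrable_bigsum (I : Type) (r : seq I) (F : I -> T -> R) :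
  (forall i, mu.-integrable setT (EFin \o F i)) ->
  mu.-integrable setT (EFin \o (fun w => \sum_(i <- r) F i w)).
Proof.
move=> iF; elim: r => [|i r IH].
  by under eq_fun do rewrite big_nil; exact: integrable0.
by under eq_fun do rewrite big_cons; exact: integrable_add.
Qed.

Lemma Rintegral_bigsum (I : Type) (r : seq I) (F : I -> T -> R) :
  (forall i, mu.-integrable setT (EFin \o F i)) ->
  \int[mu]_w (\sum_(i <- r) F i w) = \sum_(i <- r) \int[mu]_w F i w.
Proof.
move=> iF; elim: r => [|i r IH].
  rewrite big_nil; under eq_Rintegral do rewrite big_nil.
  by rewrite /Rintegral integral0.
rewrite big_cons; under eq_Rintegral do rewrite big_cons.
by rewrite RintegralD// ?IH//; exact: integrable_bigsum.
Qed.

Lemma measurable_cos (f : T -> R) : measurable_fun setT f ->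
  measurable_fun setT (fun w => cos (f w)).
Proof.
by move=> mf; apply: (measurableT_comp (continuous_measurable_fun (@continuous_cos R))).
Qed.

Lemma measurable_sin (f : T -> R) : measurable_fun setT f ->
  measurable_fun setT (fun w => sin (f w)).
Proof.
by move=> mf; apply: (measurableT_comp (continuous_measurable_fun (@continuous_sin R))).
Qed.

Lemma measurable_expR (f : T -> R) : measurable_fun setT f ->
  measurable_fun setT (fun w => expR (f w)).
Proof.
by move=> mf; apply: (measurableT_comp (continuous_measurable_fun (@continuous_expR R))).
Qed.

End FiniteSums.

Section GaussianVector.
Context d (T : measurableType d) (R : realType) (P : probability T R) (n : nat).
Variables (Y : 'I_n -> T -> R) (C : 'I_n -> 'I_n -> R).
Implicit Types (a b : 'I_n -> R) (i j : 'I_n) (X Z : T -> R).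

Definition linform a w := \sum_i a i * Y i w.

Definition covform a := \sum_i \sum_j a i * a j * C i j.

(** Only the laws of linear forms enter, as for Gaussian processes: there need
not be a joint density, since [C] may be singular. *)
Definition gaussian_vector : Prop :=
  (forall i j, C i j = C j i) /\
  forall a, exists2 s, s ^+ 2 = covform a & centered_normal P (linform a) s.

Definition sqnorm w := \sum_i Y i w ^+ 2.

(** Reduces questions of integrability to counting degrees. *)
Definition dominated (k : nat) (X : T -> R) : Prop :=
  measurable_fun setT X /\
  exists2 K, 0 <= K & forall w, `|X w| <= K * (1 + sqnorm w) ^+ k.

Hypothesis G : gaussian_vector.

Lemma cov_sym i j : C i j = C j i. Proof. by case: G. Qed.

Lemma sqnorm_ge0 w : 0 <= sqnorm w.
Proof. by rewrite sumr_ge0// => i _; rewrite sqr_ge0. Qed.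

Lemma linform_delta i w : linform (fun j => (j == i)%:R) w = Y i w.
Proof.
rewrite /linform (bigD1 i)//= eqxx mul1r big1 ?addr0// => j /negbTE ->.
by rewrite mul0r.
Qed.

Lemma linform_shift a t i w :
  linform (fun j => a j + t * (j == i)%:R) w = linform a w + t * Y i w.
Proof.
rewrite -(linform_delta i) /linform mulr_sumr -big_split/=.
by apply: eq_bigr => j _; rewrite mulrDl mulrA.
Qed.

Lemma covform_delta i : covform (fun j => (j == i)%:R) = C i i.
Proof.
rewrite /covform (bigD1 i)//= [X in _ + X]big1 ?addr0.
  rewrite (bigD1 i)//= eqxx !mul1r big1 ?addr0// => j /negbTE ->.
  by rewrite mulr0 mul0r.
by move=> j /negbTE ji; rewrite big1// => k _; rewrite ji !mul0r.
Qed.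

Lemma covform_shift a t i :
  covform (fun j => a j + t * (j == i)%:R) =
  covform a + 2 * t * (\sum_j C i j * a j) + t ^+ 2 * C i i.
Proof.
rewrite -(covform_delta i) /covform.
have -> : \sum_j C i j * a j =
    2^-1 * \sum_j \sum_k (a j * (k == i)%:R + (j == i)%:R * a k) * C j k.
  rewrite [in RHS](eq_bigr (fun j => a j * C j i + (j == i)%:R * (\sum_k a k * C j k))).
    rewrite big_split/= [X in _ * (_ + X)](bigD1 i)//= eqxx mul1r.
    rewrite [X in _ * (_ + (_ + X))]big1 ?addr0; last first.
      by move=> j /negbTE ->; rewrite mul0r.
    have -> : \sum_j a j * C j i = \sum_j C i j * a j.
      by apply: eq_bigr => j _; rewrite cov_sym mulrC.
    have -> : \sum_k a k * C i k = \sum_j C i j * a j.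
      by apply: eq_bigr => j _; rewrite mulrC.
    lra.
  move=> j _; under eq_bigr do rewrite mulrDl.
  rewrite big_split/= (bigD1 i)//= eqxx mulr1 [X in _ + X + _]big1 ?addr0.
    by rewrite mulr_sumr; congr (_ + _); apply: eq_bigr => k _; rewrite mulrA.
  by move=> k /negbTE ->; rewrite mulr0 mul0r.
set S := (X in 2^-1 * X); have -> : 2 * t * (2^-1 * S) = t * S by field.
rewrite /S !mulr_sumr -!big_split/=; apply: eq_bigr => j _.
rewrite !mulr_sumr -!big_split/=; apply: eq_bigr => k _.
ring.
Qed.

Lemma measurable_coord i : measurable_fun setT (Y i).
Proof.
have [s _ [_ + _]] := G.2 (fun j => (j == i)%:R).
by congr (measurable_fun _ _); apply/funext => w; rewrite linform_delta.
Qed.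

Lemma coord_centered_normal i : exists2 s, s ^+ 2 = C i i & centered_normal P (Y i) s.
Proof.
have [s e N] := G.2 (fun j => (j == i)%:R).
exists s; first by rewrite e covform_delta.
by move: N; congr (centered_normal _ _ _); apply/funext => w; rewrite linform_delta.
Qed.

Lemma measurable_linform a : measurable_fun setT (linform a).
Proof. by have [s _ []] := G.2 a. Qed.

Lemma measurable_sqnorm : measurable_fun setT sqnorm.
Proof.
apply: measurable_sum => i; apply: measurable_funX; exact: measurable_coord.
Qed.

Lemma dominated_measurable k X : dominated k X -> measurable_fun setT X.
Proof. by case. Qed.

Lemma dominatedW k l X : (k <= l)%N -> dominated k X -> dominated l X.
Proof.
move=> kl [mX [K K0 XK]]; split=> //; exists K => // w.
apply: (le_trans (XK w)); rewrite ler_wpM2l// ler_weXn2l//.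
by rewrite lerDl sqnorm_ge0.
Qed.

Lemma dominatedD k X Z : dominated k X -> dominated k Z ->
  dominated k (fun w => X w + Z w).
Proof.
move=> [mX [K K0 XK]] [mZ [K' K0' ZK]]; split; first exact: measurable_funD.
exists (K + K'); first exact: addr_ge0.
by move=> w; rewrite mulrDl (le_trans (ler_normD _ _))// lerD.
Qed.

Lemma dominatedN k X : dominated k X -> dominated k (fun w => - X w).
Proof.
move=> [mX [K K0 XK]]; split; first exact: measurableT_comp.
by exists K => // w; rewrite normrN.
Qed.

Lemma dominatedB k X Z : dominated k X -> dominated k Z ->
  dominated k (fun w => X w - Z w).
Proof. by move=> hX hZ; apply: dominatedD => //; exact: dominatedN. Qed.

Lemma dominatedM k l X Z : dominated k X -> dominated l Z ->
  dominated (k + l) (fun w => X w * Z w).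
Proof.
move=> [mX [K K0 XK]] [mZ [K' K0' ZK]]; split; first exact: measurable_funM.
exists (K * K'); first exact: mulr_ge0.
by move=> w; rewrite normrM exprD mulrACA ler_pM.
Qed.

Lemma dominated_bounded X (K : R) : measurable_fun setT X ->
  (forall w, `|X w| <= K) -> dominated 0 X.
Proof.
move=> mX XK; split => //; exists `|K| => // w.
by rewrite expr0 mulr1 (le_trans (XK w))// ler_norm.
Qed.

Lemma dominated_cst k (c : R) : dominated k (fun=> c).
Proof.
by apply: (@dominatedW 0) => //; apply: (@dominated_bounded _ `|c|).
Qed.

Lemma dominatedZ k (c : R) X : dominated k X -> dominated k (fun w => c * X w).
Proof. by move=> hX; apply: (@dominatedM 0 k) => //; exact: dominated_cst. Qed.

Lemma dominated_sum (I : Type) (r : seq I) k (F : I -> T -> R) :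
  (forall l, dominated k (F l)) -> dominated k (fun w => \sum_(l <- r) F l w).
Proof.
move=> hF; elim: r => [|i r IH].
  by under eq_fun do rewrite big_nil; exact: dominated_cst.
by under eq_fun do rewrite big_cons; exact: dominatedD.
Qed.

Lemma dominated_sqnorm : dominated 1 sqnorm.
Proof.
split; first exact: measurable_sqnorm.
by exists 1 => // w; rewrite mul1r expr1 ger0_norm ?sqnorm_ge0// lerDr.
Qed.

Lemma coord_sqr_le i w : Y i w ^+ 2 <= sqnorm w.
Proof. by rewrite /sqnorm (bigD1 i)//= lerDl sumr_ge0// => j _; rewrite sqr_ge0. Qed.

Lemma dominated_coord i : dominated 1 (Y i).
Proof.
split; first exact: measurable_coord.
exists 1 => // w; rewrite mul1r expr1.
have := coord_sqr_le i w; rewrite -real_normK ?num_real//.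
have := normr_ge0 (Y i w); move: `|Y i w| (sqnorm w) => t q; nra.
Qed.

Lemma dominated_coord2 i j : dominated 1 (fun w => Y i w * Y j w).
Proof.
split; first by apply: measurable_funM; exact: measurable_coord.
exists 1 => // w; rewrite mul1r expr1.
have := coord_sqr_le i w; have := coord_sqr_le j w; rewrite normrM.
rewrite -[Y i w ^+ 2]real_normK ?num_real// -[Y j w ^+ 2]real_normK ?num_real//.
move: `|Y i w| `|Y j w| (sqnorm w) => t u q h1 h2.
have := sqr_ge0 (t - u); nra.
Qed.

(** [sqnorm ^ 2] is bounded by fourth powers of the coordinates, and these are
normal variables. *)
Lemma dominated_integrable k X : (k <= 2)%N -> dominated k X ->
  P.-integrable setT (EFin \o X).
Proof.
move=> k2 /(dominatedW k2) [mX [K K0 XK]].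
pose Z w := 2 * K * (1 + \sum_i \sum_j (Y i w ^+ 4 + Y j w ^+ 4)).
apply: (@dom_integrable _ _ _ P _ Z) => //.
  apply: integrable_scale; apply: integrable_add.
    exact: finite_measure_integrable_cst.
  apply: integrable_bigsum => i; apply: integrable_bigsum => j.
  have [s _ Ni] := coord_centered_normal i.
  have [s' _ Nj] := coord_centered_normal j.
  by apply: integrable_add; [exact: (centered_normal_expr_integrable Ni)|
    exact: (centered_normal_expr_integrable Nj)].
move=> w; apply: (le_trans (XK w)); rewrite /Z [2 * K]mulrC -mulrA ler_wpM2l//.
have : sqnorm w ^+ 2 <= \sum_i \sum_j (Y i w ^+ 4 + Y j w ^+ 4).
  rewrite /sqnorm expr2 mulr_suml; apply: ler_sum => i _.
  rewrite mulr_sumr; apply: ler_sum => j _.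
  rewrite (exprM _ 2 2) (exprM (Y j w) 2 2).
  have := sqr_ge0 (Y i w); have := sqr_ge0 (Y j w).
  move: (Y i w ^+ 2) (Y j w ^+ 2) => t u *; have := sqr_ge0 (t - u); nra.
have := sqnorm_ge0 w; move: (sqnorm w) (\sum_i _) => q z *.
have := sqr_ge0 (q - 1); nra.
Qed.

End GaussianVector.

(** * Gaussian integration by parts for trigonometric functions *)

Lemma sin_cos_shift (R : realType) (x : R) : sin x = cos (- (pi / 2) + x).
Proof. by rewrite cosD cosN sinN cos_pihalf sin_pihalf; ring. Qed.

Lemma cos_sin_shift (R : realType) (x : R) : cos x = - sin (- (pi / 2) + x).
Proof. by rewrite sinD cosN sinN cos_pihalf sin_pihalf; ring. Qed.

Section StandardNormal.
Context (R : realType).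
Local Notation GR := (measurableTypeR R).
Local Notation gam := (normal_prob (0 : R) 1).

Lemma measurable_TypeR_id : measurable_fun setT (fun x : GR => x : R).
Proof. by have := @measurable_id _ GR setT; exact. Qed.

Lemma std_normal_id : @centered_normal _ GR R gam (fun x : GR => x : R) 1.
Proof.
split=> //.
by move=> A mA; rewrite oner_eq0 preimage_id.
Qed.

Lemma std_normal_id_integrable :
  gam.-integrable setT (EFin \o (fun x : GR => x : R)).
Proof. exact: (centered_normal_expr_integrable (k := 1) std_normal_id isT). Qed.

Lemma std_normal_cos (b t : R) :
  \int[gam]_x cos (b + (x : GR) * t) = cos b * expR (- (t ^+ 2 / 2)).
Proof.
have [+ _] := centered_normal_cos std_normal_id t b.
rewrite expr1n mul1r => <-.
by apply: eq_Rintegral => w _; rewrite mulrC.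
Qed.

Lemma std_normal_sin (b t : R) :
  \int[gam]_x sin (b + (x : GR) * t) = sin b * expR (- (t ^+ 2 / 2)).
Proof.
rewrite (sin_cos_shift b) -std_normal_cos.
by apply: eq_Rintegral => w _; rewrite sin_cos_shift addrA.
Qed.

Lemma std_normal_idsin (b t : R) :
  \int[gam]_x ((x : GR) * sin (b + (x : GR) * t)) =
    t * (cos b * expR (- (t ^+ 2 / 2))).
Proof.
have [_] := centered_normal_cos std_normal_id t b.
rewrite expr1n !mul1r => <-.
by apply: eq_Rintegral => w _; rewrite [t * _]mulrC.
Qed.

End StandardNormal.

Section GaussianIntegrationByParts.
Context d (T : measurableType d) (R : realType) (P : probability T R) (n : nat).
Variables (Y : 'I_n -> T -> R) (C : 'I_n -> 'I_n -> R).
Hypothesis G : gaussian_vector P Y C.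
Implicit Types (a : 'I_n -> R) (i j : 'I_n).
Local Notation L := (linform Y).
Local Notation dom := (dominated Y).
Local Notation GR := (measurableTypeR R).

Lemma is_derive_unique (f : R -> R) (x l l' : R) :
  is_derive (x : R) (1 : R) f l -> is_derive (x : R) (1 : R) f l' -> l = l'.
Proof.
by move=> h h'; rewrite -(@derive_val _ _ _ _ _ _ _ h) (@derive_val _ _ _ _ _ _ _ h').
Qed.

Lemma expect_cos_linform a b :
  \int[P]_w cos (b + L a w) = cos b * expR (- (covform C a / 2)).
Proof.
have [s e N] := G.2 a; have [+ _] := centered_normal_cos N 1 b.
under eq_Rintegral do rewrite mul1r.
by rewrite e expr1n mulr1.
Qed.

Let dom_int k X : (k <= 2)%N -> dom k X -> P.-integrable setT (EFin \o X).
Proof. exact: (dominated_integrable G). Qed.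

Let mcos b a : measurable_fun setT (fun w => cos (b + L a w)).
Proof.
by apply: measurable_cos; apply: measurable_funD => //; exact: (measurable_linform G a).
Qed.

Let msin b a : measurable_fun setT (fun w => sin (b + L a w)).
Proof.
by apply: measurable_sin; apply: measurable_funD => //; exact: (measurable_linform G a).
Qed.

Let dcos b a : dom 0 (fun w => cos (b + L a w)).
Proof. by apply: (@dominated_bounded _ _ _ _ Y _ 1) => // w; exact: cos_max. Qed.

Let dsin b a : dom 0 (fun w => sin (b + L a w)).
Proof. by apply: (@dominated_bounded _ _ _ _ Y _ 1) => // w; exact: sin_max. Qed.

Lemma expect_cos_shift_is_derive X b a j : dom 1 X ->
  is_derive (0 : R) (1 : R) (fun t => \int[P]_w (X w * cos (b + L a w + t * Y j w)))
    (\int[P]_w (- (X w * Y j w * sin (b + L a w)))).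
Proof.
move=> dX; have dY := dominated_coord G j.
have mA : measurable_fun setT (fun w => b + L a w).
  by apply: measurable_funD => //; exact: (measurable_linform G a).
apply: (is_derive_eq (@expect_cos_is_derive _ _ _ P X (fun w => b + L a w) (Y j) 0 _ mA _ _ _ _)).
- exact: dominated_measurable dX.
- exact: measurable_coord G j.
- exact: (dom_int (k := 1) isT dX).
- exact: (dom_int (k := 2) isT (dominatedM dX dY)).
- exact: (dom_int (k := 2) isT (dominatedM dX (dominated_coord2 G j j))).
by apply: eq_Rintegral => w _; rewrite mul0r addr0.
Qed.

(** The derivative at [t = 0] of the characteristic function along [a + t * e_j]. *)
Lemma expect_coord_sin a b j :
  \int[P]_w (Y j w * sin (b + L a w)) =
  (\sum_k C j k * a k) * \int[P]_w cos (b + L a w).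
Proof.
set c := \sum_k _.
have H1 := expect_cos_shift_is_derive b a j (dominated_cst Y 1 1).
have EJ : (fun t => \int[P]_w (1 * cos (b + L a w + t * Y j w))) =
    (fun t => cos b * expR (- (covform C a / 2) + (- (t * c) - t ^+ 2 * (C j j / 2)))).
  apply/funext => t.
  under eq_Rintegral do rewrite mul1r -addrA -linform_shift.
  rewrite expect_cos_linform (covform_shift G) -/c; congr (_ * expR _); lra.
rewrite EJ in H1.
have dY := dominated_coord G j.
have D : is_derive (0 : R) (1 : R)
    (fun t => cos b * expR (- (covform C a / 2) + (- (t * c) - t ^+ 2 * (C j j / 2))))
    (- (c * \int[P]_w cos (b + L a w))).
  have D1 := is_derive_sub (is_derive_opp (is_derive_mul (is_derive_idfun (0:R)) (is_derive_cstfun c 0)))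
    (is_derive_mul (is_derive_expn 1 (is_derive_idfun (0:R))) (is_derive_cstfun (C j j / 2) 0)).
  have D2 := is_derive_add (is_derive_cstfun (- (covform C a / 2)) (0:R)) D1.
  apply: (is_derive_eq (is_derive_scale (cos b) (is_derive_expRf D2))).
  rewrite expect_cos_linform expr0n /= !mul0r subr0 oppr0 addr0; ring.
have /eqP := is_derive_unique H1 D.
under eq_Rintegral do rewrite mul1r -mulN1r.
rewrite RintegralZl//; last exact: (dom_int (k := 1) isT (dominatedM dY (dsin _ _))).
by rewrite mulN1r eqr_opp => /eqP.
Qed.

(** The derivative at [t = 0] of [expect_coord_sin] along [a + t * e_j]; a phase
[pi / 2] exchanges sine and cosine. *)
Lemma expect_coord2_cos a b i j :
  \int[P]_w ((Y i w * Y j w - C i j) * cos (b + L a w)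
             + (\sum_k C i k * a k) * (Y j w * sin (b + L a w))) = 0.
Proof.
set c := \sum_k _.
have dYi := dominated_coord G i; have dYj := dominated_coord G j.
have H1 := expect_cos_shift_is_derive (- (pi / 2) + b) a j dYi.
have H2 := expect_cos_shift_is_derive b a j (dominated_cst Y 1 1).
have EJ : (fun t => \int[P]_w (Y i w * cos (- (pi / 2) + b + L a w + t * Y j w))) =
    (fun t => (c + t * C i j) * \int[P]_w (1 * cos (b + L a w + t * Y j w))).
  apply/funext => t.
  under eq_Rintegral do rewrite -!addrA -sin_cos_shift -linform_shift.
  rewrite expect_coord_sin; congr (_ * _).
    rewrite /c; under eq_bigr do rewrite mulrDr.
    rewrite big_split/=; congr (_ + _); rewrite (bigD1 j)//= eqxx mulr1 mulrC.
    by rewrite big1 ?addr0// => k /negbTE ->; rewrite !mulr0.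
  by apply: eq_Rintegral => w _; rewrite mul1r -addrA -linform_shift.
rewrite EJ in H1.
have D := is_derive_mul (is_derive_add (is_derive_cstfun c (0 : R)) (is_derive_mul (is_derive_idfun (0 : R)) (is_derive_cstfun (C i j) 0))) H2.
have E := is_derive_unique H1 D.
have iYYc : P.-integrable setT (EFin \o (fun w => Y i w * Y j w * cos (b + L a w))).
  exact: (dom_int (k := 2) isT (dominatedM (dominatedM dYi dYj) (dcos _ _))).
have iYs : P.-integrable setT (EFin \o (fun w => Y j w * sin (b + L a w))).
  exact: (dom_int (k := 1) isT (dominatedM dYj (dsin _ _))).
have ic : P.-integrable setT (EFin \o (fun w => cos (b + L a w))).
  exact: (dom_int (k := 0) isT (dcos _ _)).
rewrite RintegralD//; last 2 first.
- exact: (dom_int (k := 2) isT (dominatedM (dominatedB (dominatedM dYi dYj)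
    (dominated_cst Y 2 (C i j))) (dcos _ _))).
- exact: integrable_scale.
under eq_Rintegral do rewrite mulrBl.
rewrite RintegralB//; last exact: integrable_scale.
rewrite !RintegralZl//.
have -> : \int[P]_w (Y i w * Y j w * cos (b + L a w)) =
    \int[P]_w (- (Y i w * Y j w * sin (- (pi / 2) + b + L a w))).
  by apply: eq_Rintegral => w _; rewrite cos_sin_shift mulrN addrA.
rewrite E mul0r addr0.
have -> : \int[P]_w (1 * cos (b + L a w + 0 * Y j w)) = \int[P]_w cos (b + L a w).
  by apply: eq_Rintegral => w _; rewrite mul1r mul0r addr0.
have -> : \int[P]_w (- (1 * Y j w * sin (b + L a w))) =
    - \int[P]_w (Y j w * sin (b + L a w)).
  rewrite -mulN1r -RintegralZl//.
  by apply: eq_Rintegral => w _; rewrite mul1r mulN1r.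
ring.
Qed.

(** Hubbard-Stratonovich: integrating [cos (A + c * xi * Y k)] against a
standard normal [xi] produces the factor [expR (- c ^ 2 / 2 * Y k ^ 2)], so the
identity for trigonometric functions propagates to Gaussian weights one
coordinate at a time. *)
Lemma expect_coord2_gauss_cos (s : R) (s_ge0 : 0 <= s) (r : seq 'I_n) a b i j :
  \int[P]_w (expR (- (s * \sum_(k <- r) Y k w ^+ 2)) *
    ((Y i w * Y j w - C i j + 2 * s * \sum_(k <- r) C i k * (Y k w * Y j w))
       * cos (b + L a w)
     + (\sum_k C i k * a k) * (Y j w * sin (b + L a w)))) = 0.
Proof.
elim: r a => [|k r IH] a.
  under eq_Rintegral do rewrite !big_nil !mulr0 oppr0 expR0 mul1r addr0.
  exact: expect_coord2_cos.
pose c := Num.sqrt (2 * s); pose ci := \sum_k C i k * a k.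
pose W w := expR (- (s * \sum_(k <- r) Y k w ^+ 2)).
pose U w := Y i w * Y j w - C i j + 2 * s * \sum_(k <- r) C i k * (Y k w * Y j w).
pose h (z : T * GR) := W z.1 * (U z.1 * cos (b + L a z.1 + z.2 * (c * Y k z.1)) +
  (ci + c * z.2 * C i k) * (Y j z.1 * sin (b + L a z.1 + z.2 * (c * Y k z.1)))).
have H0 (x : R) : \int[P]_w h (w, x : GR) = 0.
  rewrite -[RHS](IH (fun l => a l + c * x * (l == k)%:R)).
  apply: eq_Rintegral => w _; rewrite /h /= -/(W w) -/(U w) linform_shift.
  have -> : \sum_l C i l * (a l + c * x * (l == k)%:R) = ci + c * x * C i k.
    under eq_bigr do rewrite mulrDr.
    rewrite big_split/=; congr (_ + _); rewrite (bigD1 k)//= eqxx mulr1 mulrC.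
    by rewrite big1 ?addr0// => l /negbTE ->; rewrite !mulr0.
  have -> : b + (L a w + c * x * Y k w) = b + L a w + x * (c * Y k w) by ring.
  by [].
have mY k0 : measurable_fun setT (Y k0) by exact: measurable_coord G k0.
have mU : measurable_fun setT U.
  apply: measurable_funD; first by apply: measurable_funB => //; exact: measurable_funM.
  apply: measurable_funM => //; apply: measurable_sum => l.
  by apply: measurable_funM => //; exact: measurable_funM.
have mW : measurable_fun setT W.
  apply: measurable_expR; apply: measurableT_comp => //; apply: measurable_funM => //.
  by apply: measurable_sum => l; exact: measurable_funX.
have W01 w : 0 <= W w <= 1.
  rewrite expR_ge0 -[leRHS]expR0 ler_expR oppr_le0 mulr_ge0//.
  by apply: sumr_ge0 => l _; rewrite sqr_ge0.
have m2 : measurable_fun setT (fun z : T * GR => z.2 : R) by exact: measurable_snd.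
have mfst (f : T -> R) : measurable_fun setT f ->
    measurable_fun setT (fun z : T * GR => f z.1).
  by move=> mf; apply: measurableT_comp => //; exact: measurable_fst.
have marg : measurable_fun setT
    (fun z : T * GR => b + L a z.1 + z.2 * (c * Y k z.1)).
  apply: measurable_funD.
    by apply: (mfst (fun w => b + L a w)); apply: measurable_funD => //; exact: (measurable_linform G a).
  by apply: measurable_funM => //; apply: (mfst (fun w => c * Y k w)); exact: measurable_funM.
have mh : measurable_fun setT h.
  apply: measurable_funM; first exact: (mfst W).
  apply: measurable_funD.
    by apply: measurable_funM; [exact: (mfst U)|exact: measurable_cos].
  apply: measurable_funM.
    apply: measurable_funD => //; apply: measurable_funM => //.
    exact: measurable_funM.
  by apply: measurable_funM; [exact: (mfst (Y j))|exact: measurable_sin].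
have dYj := dominated_coord G j.
have dU : dom 1 U.
  apply: dominatedD; last first.
    apply: dominatedZ; apply: dominated_sum => l; apply: dominatedZ.
    exact: dominated_coord2 G l j.
  by apply: dominatedB; [exact: dominated_coord2 G i j|exact: dominated_cst].
have F := @Rintegral_Fubini _ _ T GR R P (normal_prob 0 1) h
  (fun w => `|U w| + (`|ci| + `|c * C i k|) * `|Y j w|) (fun x : R => 1 + `|x|).
have {}F := F mh.
have Z : \int[normal_prob 0 1]_y \int[P]_x h (x, y) = 0.
  transitivity (\int[normal_prob 0 1]_y (cst 0 : GR -> R) y).
    by apply: eq_Rintegral => x _; exact: H0.
  by rewrite /Rintegral integral0.
suff E : forall w, expR (- (s * \sum_(j0 <- k :: r) Y j0 w ^+ 2)) *
   ((Y i w * Y j w - C i j + 2 * s * \sum_(k0 <- k :: r) C i k0 * (Y k0 w * Y j w)) *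
    cos (b + L a w) + ci * (Y j w * sin (b + L a w))) = \int[normal_prob 0 1]_y h (w, y).
  rewrite -[RHS]Z -F; first by apply: eq_Rintegral => w _; exact: E.
  - apply: integrable_add.
      by apply: integrable_norm; exact: (dom_int (k := 1) isT dU).
    apply: integrable_scale; apply: integrable_norm.
    exact: (dom_int (k := 1) isT dYj).
  - apply: integrable_add; first exact: finite_measure_integrable_cst.
    exact: integrable_norm (std_normal_id_integrable R).
  - move=> w x; rewrite /h /= normrM.
    have /andP[W0 W1] := W01 w; rewrite (ger0_norm W0).
    have X0 := normr_ge0 (x : R).
    apply: (@le_trans _ _ (1 * (`|U w| + (`|ci| + `|c * C i k| * `|x : R|) * `|Y j w|))).
      apply: ler_pM => //; apply: (le_trans (ler_normD _ _)); apply: lerD.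
        by rewrite normrM ler_piMr// cos_max.
      rewrite normrM; apply: ler_pM => //.
        by apply: (le_trans (ler_normD _ _)); rewrite lerD2l -normrM mulrAC.
      by rewrite normrM ler_piMr// sin_max.
    rewrite mul1r -subr_ge0.
    rewrite [X in 0 <= X](_ : _ = `|c * C i k| * `|Y j w| + `|U w| * `|x : R| +
      `|ci| * `|Y j w| * `|x : R|); last by ring.
    by rewrite !addr_ge0// !mulr_ge0.
move=> w.
have c2 : c ^+ 2 = 2 * s by rewrite sqr_sqrtr// mulr_ge0.
have EW : expR (- (s * \sum_(j0 <- k :: r) Y j0 w ^+ 2)) =
    W w * expR (- ((c * Y k w) ^+ 2 / 2)).
  rewrite /W -expRD big_cons exprMn c2; congr expR; lra.
rewrite EW big_cons.
set t := c * Y k w; set A := b + L a w.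
have ib (f : GR -> R) : measurable_fun setT f -> (forall x, `|f x| <= 1) ->
    (normal_prob (0 : R) 1).-integrable setT (EFin \o f).
  move=> mf f1; apply: (@dom_integrable _ GR R (normal_prob 0 1) _ (fun=> 1)) => //.
  exact: finite_measure_integrable_cst.
have mx : measurable_fun setT (fun x : GR => A + x * t : R).
  by apply: measurable_funD => //; apply: measurable_funM => //; exact: measurable_TypeR_id.
have icos : (normal_prob (0 : R) 1).-integrable setT (EFin \o (fun x : GR => cos (A + x * t))).
  by apply: ib => [|x]; [exact: measurable_cos|exact: cos_max].
have isin : (normal_prob (0 : R) 1).-integrable setT (EFin \o (fun x : GR => sin (A + x * t))).
  by apply: ib => [|x]; [exact: measurable_sin|exact: sin_max].
have ixsin : (normal_prob (0 : R) 1).-integrable setT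
    (EFin \o (fun x : GR => x * sin (A + x * t))).
  apply: (dom_integrable (integrable_norm (std_normal_id_integrable R))).
    by apply: measurable_funM; [exact: measurable_TypeR_id|exact: measurable_sin].
  by move=> x; rewrite normrM ler_piMr// sin_max.
have -> : \int[normal_prob 0 1]_y h (w, y) =
    \int[normal_prob 0 1]_y (W w * U w * cos (A + (y : GR) * t) +
      (W w * ci * Y j w * sin (A + (y : GR) * t) +
       W w * c * C i k * Y j w * ((y : GR) * sin (A + (y : GR) * t)))).
  by apply: eq_Rintegral => x _; rewrite /h /= -/A -/t; ring.
rewrite RintegralD//; [|exact: integrable_scale|]; last first.
  by apply: integrable_add; exact: integrable_scale.
rewrite RintegralD//; [|exact: integrable_scale|exact: integrable_scale].
rewrite !RintegralZl// std_normal_cos std_normal_sin std_normal_idsin.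
rewrite /U /t -/(W w); have -> : 2 * s = c * c by rewrite -c2 expr2.
ring.
Qed.

End GaussianIntegrationByParts.

(** * Bernstein polynomials *)

Section Bernstein.
Context (R : realType).
Implicit Types (h : nat -> R) (u c : R).

(** The Bernstein operator, by conditioning on the last of [N] coin tosses:
[(bernstein N h).[u]] is the mean of [h] at a binomial [(N, u)] variable. *)
Fixpoint bernstein (N : nat) (h : nat -> R) : {poly R} :=
  if N is N'.+1 then 'X * bernstein N' (h \o S) + (1 - 'X) * bernstein N' h
  else (h 0%N)%:P.

Lemma bernsteinS N h u : (bernstein N.+1 h).[u] =
  u * (bernstein N (h \o S)).[u] + (1 - u) * (bernstein N h).[u].
Proof. by rewrite /= !hornerE. Qed.

Lemma bernstein_le N h h' u : 0 <= u <= 1 ->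
  (forall k, (k <= N)%N -> h k <= h' k) -> (bernstein N h).[u] <= (bernstein N h').[u].
Proof.
move=> /andP[u0 u1]; elim: N h h' => [|N IH] h h' hh.
  by rewrite /= !hornerE hh.
rewrite !bernsteinS; apply: lerD; apply: ler_wpM2l => //; rewrite ?subr_ge0//.
  by apply: IH => k kN; exact: hh.
by apply: IH => k kN; apply: hh; exact: leqW.
Qed.

(** The mean and the variance of the binomial law, together. *)
Lemma bernstein_sqr N (e a c : R) u :
  (bernstein N (fun k => e + a * (k%:R - c) ^+ 2)).[u] =
  e + a * (N%:R * u * (1 - u) + (N%:R * u - c) ^+ 2).
Proof.
elim: N c => [|N IH] c; first by rewrite /= !hornerE; ring.
rewrite bernsteinS (_ : _ \o S = fun k => e + a * (k%:R - (c - 1)) ^+ 2).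
  by rewrite !IH -natr1; ring.
by apply/funext => k /=; rewrite -natr1; congr (_ + _ * _ ^+ 2); ring.
Qed.

Lemma bernsteinN N h u : (bernstein N (fun k => - h k)).[u] = - (bernstein N h).[u].
Proof.
elim: N h => [|N IH] h; first by rewrite /= !hornerE.
by rewrite !bernsteinS (_ : _ \o S = fun k => - (h \o S) k)// !IH; ring.
Qed.

Lemma bernstein_bound N h u (S : R) : 0 <= u <= 1 ->
  (forall k, (k <= N)%N -> `|h k| <= S) -> `|(bernstein N h).[u]| <= S.
Proof.
move=> u01 hS.
have E (a : R) : (bernstein N (fun=> a)).[u] = a.
  rewrite (_ : (fun=> a) = fun k : nat => a + 0 * (k%:R - 0) ^+ 2).
    by rewrite bernstein_sqr mul0r addr0.
  by apply/funext => k; rewrite mul0r addr0.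
rewrite ler_norml -{1}[S]E -bernsteinN -{2}[S]E.
by apply/andP; split; apply: bernstein_le => // k /hS; rewrite ler_norml => /andP[].
Qed.

(** Chebyshev's argument: [F v] is within [e / 2 + a * (v - u) ^ 2] of [F u], and
the variance of a binomial proportion is [O(1 / N)]. *)
Lemma bernstein_cvg (F : R -> R) (S u : R) : 0 <= u <= 1 ->
  (forall v, 0 <= v <= 1 -> `|F v| <= S) -> {for u, continuous F} ->
  (bernstein N.+1 (fun k => F (k%:R / N.+1%:R))).[u] @[N --> \oo] --> F u.
Proof.
move=> u01 FS cF; apply/cvgrPdist_le => e e0.
have e20 : 0 < e / 2 by rewrite divr_gt0.
have /cvgrPdist_le/(_ _ e20)/nbhs_ballP[dl dl0 Hd] : F v @[v --> u] --> F u by [].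
have S0 : 0 <= S by apply: le_trans (FS _ u01).
pose a := 2 * S / dl ^+ 2.
have a0 : 0 <= a by apply: divr_ge0; [exact: mulr_ge0|exact: sqr_ge0].
near=> N; pose n1 := (N.+1%:R : R); have n10 : 0 < n1 by rewrite ltr0n.
have pt k : (k <= N.+1)%N ->
    `|F (k%:R / n1) - F u| <= e / 2 + a / n1 ^+ 2 * (k%:R - n1 * u) ^+ 2.
  move=> kN; set v := k%:R / n1.
  have v01 : 0 <= v <= 1.
    apply/andP; split; first by rewrite divr_ge0// ltW.
    by rewrite /v ler_pdivrMr// mul1r ler_nat.
  have -> : a / n1 ^+ 2 * (k%:R - n1 * u) ^+ 2 = a * (v - u) ^+ 2.
    by rewrite /v; field; rewrite gt_eqF.
  have [vu|vu] := ltP `|u - v| dl.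
    by rewrite distrC (le_trans (Hd v vu))// lerDl mulr_ge0// sqr_ge0.
  apply: (@le_trans _ _ (2 * S)).
    apply: (le_trans (ler_normB _ _)); have := FS _ v01; have := FS _ u01; lra.
  apply: ler_wpDl; first exact: ltW.
  have dln0 : dl != 0 by rewrite gt_eqF.
  have -> : a * (v - u) ^+ 2 = 2 * S * ((v - u) ^+ 2 / dl ^+ 2) by rewrite /a; field.
  apply: ler_peMr; first exact: mulr_ge0.
  rewrite ler_pdivlMr ?mul1r ?exprn_gt0//.
  rewrite -[(v - u) ^+ 2]real_normK ?num_real// distrC.
  by rewrite ler_pXn2r ?nnegrE ?normr_ge0 ?(ltW dl0).
rewrite distrC.
have H2 : `|(bernstein N.+1 (fun k => F (k%:R / n1))).[u] - F u| <=
    e / 2 + a / n1 ^+ 2 * (n1 * u * (1 - u)).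
  have := bernstein_sqr N.+1 (F u + e / 2) (a / n1 ^+ 2) (n1 * u) u.
  rewrite -/n1 subrr expr0n addr0 => E1.
  have := bernstein_sqr N.+1 (F u - e / 2) (- (a / n1 ^+ 2)) (n1 * u) u.
  rewrite -/n1 subrr expr0n addr0 => E2.
  rewrite ler_distl; apply/andP; split.
  - rewrite (_ : _ - _ = F u - e / 2 + - (a / n1 ^+ 2) * (n1 * u * (1 - u))); last ring.
    rewrite -E2; apply: bernstein_le => // k /pt; rewrite ler_distl => /andP[+ _].
    by apply: le_trans; rewrite le_eqVlt; apply/orP; left; apply/eqP; ring.
  - rewrite addrA -E1; apply: bernstein_le => // k /pt; rewrite ler_distl => /andP[_].
    by rewrite addrA.
apply: (le_trans H2); rewrite [leRHS](splitr e) lerD2l.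
have -> : a / n1 ^+ 2 * (n1 * u * (1 - u)) = a * (u * (1 - u)) / n1.
  by field; rewrite gt_eqF.
apply: (@le_trans _ _ (a / n1)).
  rewrite ler_pM2r ?invr_gt0// ler_piMr//.
  by have /andP[] := u01; move=> *; nra.
rewrite ler_pdivrMr// -ler_pdivrMl//.
apply: (@le_trans _ _ N%:R); last by rewrite ler_nat.
by near: N; exact: nbhs_infty_ger.
Unshelve. all: by end_near. Qed.

Lemma poly_antiderivative (p : {poly R}) : exists q : {poly R}, q^`() = p.
Proof.
exists (\poly_(i < (size p).+1) (p`_i.-1 / i%:R)).
apply/polyP => i; rewrite coef_deriv coef_poly ltnS.
case: ltnP => ip; last by rewrite mul0rn nth_default.
by rewrite /= -[LHS]mulr_natr divfK// pnatr_eq0.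
Qed.

End Bernstein.

(** * Integration by parts for functions of the squared norm *)

Section SquaredNormIBP.
Context d (T : measurableType d) (R : realType) (P : probability T R) (n : nat).
Variables (Y : 'I_n -> T -> R) (C : 'I_n -> 'I_n -> R).
Hypothesis G : gaussian_vector P Y C.
Implicit Types (f g : R -> R) (i j : 'I_n).
Local Notation Q := (sqnorm Y).
Local Notation dom := (dominated Y).

Lemma norm_cvg_le (u : nat -> R) (l K : R) :
  (forall N, `|u N| <= K) -> u N @[N --> \oo] --> l -> `|l| <= K.
Proof.
move=> uK ul; rewrite leNgt; apply/negP => Kl.
have e0 : 0 < `|l| - K by rewrite subr_gt0.
have /cvgrPdist_lt/(_ _ e0)[N _ /(_ N (leqnn N))] := ul.
rewrite ltNge => /negP; apply; rewrite lerBlDr.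
apply: (@le_trans _ _ (`|l - u N| + `|u N|)); last by rewrite lerD2l.
by apply: le_trans (ler_normD _ _); rewrite subrK.
Qed.

(** The integrand of [E[(Y_i Y_j - C_ij) f(Q)] - 2 E[f'(Q) (C Y)_i Y_j]], where
[Q] is the squared norm. *)
Definition ibp_defect i j f g w :=
  (Y i w * Y j w - C i j) * f (Q w)
  - 2 * (g (Q w) * \sum_k C i k * (Y k w * Y j w)).

(** [g] stands for the derivative of [f]; the growth bound makes the identity
meaningful. *)
Definition ibp_pair f g : Prop :=
  [/\ measurable_fun setT f, measurable_fun setT g,
      exists2 K, 0 <= K & forall q, 0 <= q -> `|f q| <= K * (1 + q) /\ `|g q| <= K
    & forall i j, \int[P]_w ibp_defect i j f g w = 0].

Let dYY i j : dom 1 (fun w => Y i w * Y j w - C i j).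
Proof. by apply: dominatedB; [exact: dominated_coord2 G i j|exact: dominated_cst]. Qed.

Let dCYY i j : dom 1 (fun w => \sum_k C i k * (Y k w * Y j w)).
Proof.
by apply: dominated_sum => l; apply: dominatedZ; exact: dominated_coord2 G l j.
Qed.

Lemma dominated_comp_linear f K : measurable_fun setT f -> 0 <= K ->
  (forall q, 0 <= q -> `|f q| <= K * (1 + q)) -> dom 1 (fun w => f (Q w)).
Proof.
move=> mf K0 fK; split; first by apply: measurableT_comp => //; exact: measurable_sqnorm G.
by exists K => // w; rewrite expr1 fK// sqnorm_ge0.
Qed.

Lemma dominated_comp_bounded g K : measurable_fun setT g ->
  (forall q, 0 <= q -> `|g q| <= K) -> dom 0 (fun w => g (Q w)).
Proof.
move=> mg gK; apply: (@dominated_bounded _ _ _ _ _ _ K).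
  by apply: measurableT_comp => //; exact: measurable_sqnorm G.
by move=> w; rewrite gK// sqnorm_ge0.
Qed.

Lemma dominated_ibp_defect i j f g K : measurable_fun setT f -> measurable_fun setT g ->
  0 <= K -> (forall q, 0 <= q -> `|f q| <= K * (1 + q) /\ `|g q| <= K) ->
  dom 2 (ibp_defect i j f g).
Proof.
move=> mf mg K0 fgK.
have df : dom 1 (fun w => f (Q w)).
  by apply: (@dominated_comp_linear _ K) => // q /fgK[].
have dg : dom 0 (fun w => g (Q w)).
  by apply: (@dominated_comp_bounded _ K) => // q /fgK[].
apply: dominatedB; first exact: (dominatedM (dYY i j) df).
apply: dominatedZ; apply: (@dominatedW _ _ _ _ _ (0 + 1)) => //.
exact: (dominatedM dg (dCYY i j)).
Qed.

(** The identity for Gaussian weights, at frequency zero. *)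
Lemma ibp_pair_exp (s : R) : 0 <= s ->
  ibp_pair (fun q => expR (- (s * q))) (fun q => - s * expR (- (s * q))).
Proof.
move=> s0; have me : measurable_fun setT (fun q : R => expR (- (s * q))).
  by apply: measurable_expR; apply: measurableT_comp => //; exact: measurable_funM.
split=> //; first exact: measurable_funM.
  exists (1 + s); first exact: addr_ge0.
  move=> q q0; have e1 : expR (- (s * q)) <= 1.
    by rewrite -[leRHS]expR0 ler_expR oppr_le0 mulr_ge0.
  rewrite normrM normrN (ger0_norm s0) ger0_norm ?expR_ge0//; split.
    by apply: (le_trans e1); nra.
  by have := expR_ge0 (- (s * q)); nra.
move=> i j; rewrite -[RHS](expect_coord2_gauss_cos G s0 (index_enum 'I_n) (fun=> 0) 0 i j).
apply: eq_Rintegral => w _; rewrite /ibp_defect -/(sqnorm Y w).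
have -> : linform Y (fun=> 0) w = 0 by rewrite /linform big1// => k _; rewrite mul0r.
by rewrite addr0 cos0 sin0; ring.
Qed.

Lemma ibp_pair_lin (c : R) f1 g1 f2 g2 : ibp_pair f1 g1 -> ibp_pair f2 g2 ->
  ibp_pair (fun q => f1 q + c * f2 q) (fun q => g1 q + c * g2 q).
Proof.
move=> [mf1 mg1 [K1 K10 b1] e1] [mf2 mg2 [K2 K20 b2] e2].
split.
- by apply: measurable_funD => //; exact: measurable_funM.
- by apply: measurable_funD => //; exact: measurable_funM.
- exists (K1 + `|c| * K2); first by rewrite addr_ge0// mulr_ge0.
  move=> q q0; have [f1q g1q] := b1 q q0; have [f2q g2q] := b2 q q0; split.
    apply: (le_trans (ler_normD _ _)); rewrite mulrDl lerD// normrM -mulrA.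
    by rewrite ler_wpM2l.
  by apply: (le_trans (ler_normD _ _)); rewrite lerD// normrM ler_wpM2l.
- move=> i j.
  have I1 := dominated_integrable G (k := 2) isT (dominated_ibp_defect i j mf1 mg1 K10 b1).
  have I2 := dominated_integrable G (k := 2) isT (dominated_ibp_defect i j mf2 mg2 K20 b2).
  transitivity (\int[P]_w (ibp_defect i j f1 g1 w + c * ibp_defect i j f2 g2 w)).
    by apply: eq_Rintegral => w _; rewrite /ibp_defect; ring.
  rewrite RintegralD//; last exact: integrable_scale.
  by rewrite RintegralZl// e1 e2 mulr0 addr0.
Qed.

Lemma ibp_pair_cvg (f_ g_ : nat -> R -> R) f g K :
  measurable_fun setT f -> measurable_fun setT g -> 0 <= K ->
  (forall N, ibp_pair (f_ N) (g_ N)) ->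
  (forall N q, 0 <= q -> `|f_ N q| <= K * (1 + q) /\ `|g_ N q| <= K) ->
  (forall q, 0 <= q -> f_ N q @[N --> \oo] --> f q) ->
  (forall q, 0 <= q -> g_ N q @[N --> \oo] --> g q) ->
  ibp_pair f g.
Proof.
move=> mf mg K0 ib bnd cf cg.
have bfg q : 0 <= q -> `|f q| <= K * (1 + q) /\ `|g q| <= K.
  move=> q0; split.
    by apply: norm_cvg_le (cf q q0) => N; have [] := bnd N q q0.
  by apply: norm_cvg_le (cg q q0) => N; have [] := bnd N q q0.
split=> //; first by exists K.
move=> i j.
have [_ [K1 K10 b1]] := dYY i j; have [_ [K2 K20 b2]] := dCYY i j.
pose D w := (K1 * K + 2 * K * K2) * (1 + Q w) ^+ 2.
have iD : P.-integrable setT (EFin \o D).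
  apply: (dominated_integrable G (k := 2)) => //; apply: dominatedZ.
  by apply: (@dominatedM _ _ _ _ _ 1 1); apply: dominatedD;
    [exact: dominated_cst|exact: dominated_sqnorm G|exact: dominated_cst|
     exact: dominated_sqnorm G].
have H : \int[P]_w ibp_defect i j (f_ N) (g_ N) w @[N --> \oo] -->
    \int[P]_w ibp_defect i j f g w.
  apply: (@Rintegral_cvg _ _ _ P _ _ D) => //.
  - move=> N; have [m1 m2 [K' K0' b'] _] := ib N.
    exact: dominated_measurable (dominated_ibp_defect i j m1 m2 K0' b').
  - exact: dominated_measurable (dominated_ibp_defect i j mf mg K0 bfg).
  - move=> w; have Qw := sqnorm_ge0 Y w.
    apply: cvgB; first by apply: cvgM; [exact: cvg_cst|exact: cf].
    apply: cvgM; first exact: cvg_cst.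
    by apply: cvgM; [exact: cg|exact: cvg_cst].
  - move=> N w; have Qw := sqnorm_ge0 Y w; have [fN gN] := bnd N _ Qw.
    have q1 : 1 <= 1 + Q w by rewrite lerDl.
    apply: (le_trans (ler_normB _ _)); rewrite /D [leRHS]mulrDl lerD//.
      by rewrite normrM expr2 mulrACA ler_pM.
    rewrite normrM normr_nat -!mulrA ler_wpM2l// normrM ler_pM//.
    have := b2 w; rewrite expr1 => h; apply: (le_trans h).
    by rewrite ler_wpM2l// expr2 ler_peMr// (le_trans _ q1).
have E : (fun N => \int[P]_w ibp_defect i j (f_ N) (g_ N) w) = (fun=> 0).
  by apply/funext => N; have [_ _ _ ->] := ib N.
rewrite E in H.
by apply/esym; apply: (cvg_unique _ (cvg_cst (0 : R)) H).
Qed.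

(** Powers of [expR (- q)] are again exponentials, and the identity is linear. *)
Lemma ibp_pair_poly (p : {poly R}) :
  ibp_pair (fun q => p.[expR (- q)]) (fun q => - (expR (- q) * p^`().[expR (- q)])).
Proof.
have X k : ibp_pair (fun q => 'X^k.[expR (- q)])
    (fun q => - (expR (- q) * ('X^k)^`().[expR (- q)])).
  have := ibp_pair_exp (ler0n R k).
  congr ibp_pair; apply/funext => q.
    by rewrite hornerXn -expRM_natl mulrN.
  rewrite derivXn hornerMn hornerXn; case: k => [|k]; first by rewrite !mulr0n oppr0 mul0r mulr0 oppr0.
  by rewrite /= -[expR _ ^+ k *+ _]mulr_natl mulrCA -exprS -expRM_natl mulrN mulNr.
have [m1 m2 b e] := X 0%N.
have Z : ibp_pair (fun q => (0 : {poly R}).[expR (- q)])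
    (fun q => - (expR (- q) * (0 : {poly R})^`().[expR (- q)])).
  have := ibp_pair_lin (- 1) (X 0%N) (X 0%N); congr ibp_pair; apply/funext => q.
    by rewrite horner0; ring.
  by rewrite deriv0 horner0; ring.
rewrite -[p]coefK poly_def; elim/big_ind: _ => //.
- move=> p1 p2 h1 h2; have := ibp_pair_lin 1 h1 h2; congr ibp_pair; apply/funext => q.
    by rewrite hornerD mul1r.
  by rewrite derivD hornerD; ring.
- move=> k _; have := ibp_pair_lin p`_k Z (X k); congr ibp_pair; apply/funext => q.
    by rewrite hornerZ horner0 add0r.
  by rewrite deriv0 horner0 derivZ hornerZ; ring.
Qed.

End SquaredNormIBP.

Section LocalCalculus.
Context (R : realType).
Implicit Types (f df : R -> R) (a b x : R).
Local Notation mu := (@lebesgue_measure R).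

Lemma is_derive_continuous_at f (l : R) x :
  is_derive (x : R) (1 : R) f l -> {for x, continuous f}.
Proof.
move=> h; apply: differentiable_continuous; apply/derivable1_diffP.
exact: (@ex_derive _ _ _ _ _ _ _ h).
Qed.

Lemma is_derive_within_continuous f df a b :
  (forall x, a <= x <= b -> is_derive (x : R) (1 : R) f (df x)) ->
  {within `[a, b], continuous f}.
Proof.
move=> h; apply: continuous_in_subspaceT => x; rewrite inE/= in_itv/= => xab.
exact: is_derive_continuous_at (h x xab).
Qed.

Lemma mean_value_on f df a b : a <= b ->
  (forall x, a <= x <= b -> is_derive (x : R) (1 : R) f (df x)) ->
  exists2 c, a <= c <= b & f b - f a = df c * (b - a).
Proof.
move=> ab h; have cf := is_derive_within_continuous h.
have h' x : x \in `]a, b[ -> is_derive (x : R) (1 : R) f (df x).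
  by rewrite in_itv/= => /andP[ax xb]; apply: h; rewrite !ltW.
have [c cab ->] := @MVT_segment R f df a b ab h' cf.
by exists c => //; rewrite in_itv/= in cab.
Qed.

Lemma Rintegral_derivative f df a b : a <= b ->
  (forall x, a <= x <= b -> is_derive (x : R) (1 : R) f (df x)) -> continuous df ->
  \int[mu]_(x in `[a, b]) df x = f b - f a.
Proof.
move=> ab h cdf; move: ab; rewrite le_eqVlt => /predU1P[e|ab].
  by rewrite -e set_itv1 Rintegral_set1 subrr.
rewrite /Rintegral (@continuous_FTC2 _ df f)//.
- exact: continuous_subspaceT.
- split.
  + move=> x; rewrite in_itv/= => /andP[ax xb].
    by apply: (@ex_derive _ _ _ _ _ _ _ (h x _)); rewrite !ltW.
  + apply: cvg_at_right_filter; apply: is_derive_continuous_at (h a _).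
    by rewrite lexx ltW.
  + apply: cvg_at_left_filter; apply: is_derive_continuous_at (h b _).
    by rewrite lexx ltW.
- move=> x; rewrite in_itv/= => /andP[ax xb]; rewrite derive1E.
  by apply: (@derive_val _ _ _ _ _ _ _ (h x _)); rewrite !ltW.
Qed.

End LocalCalculus.

Lemma min_dist_le (R : realType) (x y m : R) :
  `|Num.min x m - Num.min y m| <= `|x - y|.
Proof.
have h1 := ler_norm (x - y); have h2 := ler_norm (- (x - y)).
rewrite normrN in h2; rewrite ler_norml.
move: h1 h2; move: `|x - y| => t h1 h2.
by case: (ltP x m) => hx; case: (ltP y m) => hy; apply/andP; split; lra.
Qed.

Section LipschitzIBP.
Context d (T : measurableType d) (R : realType) (P : probability T R) (n : nat).
Variables (Y : 'I_n -> T -> R) (C : 'I_n -> 'I_n -> R).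
Hypothesis G : gaussian_vector P Y C.
Implicit Types (f g : R -> R).
Local Notation mu := (@lebesgue_measure R).
Local Notation ibp := (ibp_pair P Y C).

(** In the variable [u = expR (- q)], which lies in [[0, 1]], the function [g]
becomes [u * F u] with [F] continuous and zero near [0]. The Bernstein
polynomials of [F] and their antiderivatives approximate [g] and [f] at once. *)
Lemma ibp_pair_compact_support f g (M B : R) : 0 <= M ->
  (forall x, -1 < x -> is_derive (x : R) (1 : R) f (g x)) -> continuous g ->
  (forall x, M <= x -> g x = 0) -> (forall x, `|g x| <= B) ->
  ibp (fun q => f (Num.max q 0)) g.
Proof.
move=> M0 Df cg gM gB.
have mf : measurable_fun setT (fun q : R => f (Num.max q 0)).
  apply: continuous_measurable_fun => x.
  apply: (@continuous_comp _ _ _ (fun q : R => Num.max q 0) f).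
    by apply: (@continuous_max _ R (fun q : R => q) (fun=> 0)) => //; exact: cvg_cst.
  apply: is_derive_continuous_at (Df _ _).
  by rewrite lt_max ltrN10 orbT.
have mg : measurable_fun setT g by exact: continuous_measurable_fun.
have B0 : 0 <= B by apply: le_trans (gB 0).
pose F u := g (- ln u) / u; pose S := B * expR M.
have S0 : 0 <= S by rewrite mulr_ge0// expR_ge0.
have FS v : 0 <= v <= 1 -> `|F v| <= S.
  move=> /andP[]; rewrite le_eqVlt => /predU1P[<- _|v0 v1].
    by rewrite /F invr0 mulr0 normr0.
  have [vM|vM] := leP M (- ln v); first by rewrite /F gM// mul0r normr0.
  rewrite /F normrM /S ler_pM// gtr0_norm ?invr_gt0//.
  rewrite -[leRHS]invrK lef_pV2 ?posrE ?invr_gt0 ?expR_gt0// -expRN.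
  by rewrite -[leRHS]lnK ?posrE// ler_expR lerNl ltW.
have e01 (q : R) : 0 <= q -> 0 <= expR (- q) <= 1.
  by move=> q0; rewrite expR_ge0 -[leRHS]expR0 ler_expR oppr_le0.
have cF (q : R) : {for expR (- q), continuous F}.
  have e0 := expR_gt0 (- q).
  apply: cvgM; last by apply: cvgV; [rewrite gt_eqF|exact: cvg_id].
  apply: (@continuous_comp _ _ _ (fun u => - ln u) g); last exact: cg.
  by apply: cvgN; exact: continuous_ln.
pose p N : {poly R} := bernstein N.+1 (fun k => F (k%:R / N.+1%:R)).
pose A N : {poly R} := sval (cid (poly_antiderivative (p N))).
have AE N : (A N)^`() = p N by rewrite /A; case: cid.
pose f_ N q := f 0 + (A N).[1] - (A N).[expR (- q)].
pose g_ N q := expR (- q) * (p N).[expR (- q)].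
have ib N : ibp (f_ N) (g_ N).
  have := ibp_pair_poly G ((f 0 + (A N).[1])%:P - A N); congr ibp_pair; apply/funext => q.
    by rewrite hornerD hornerN hornerC.
  by rewrite derivB derivC AE sub0r hornerN mulrN opprK.
have Df_ N (x : R) : is_derive (x : R) (1 : R) (f_ N) (g_ N x).
  have D1 := is_derive_expRf (is_derive_opp (is_derive_idfun x)).
  have D2 := @is_derive_compf R (horner (A N)) (fun y => expR (- y)) x _ _
    (is_derive_poly (A N) (expR (- x))) D1.
  apply: (is_derive_eq (is_derive_sub (is_derive_cstfun _ x) D2)).
  by rewrite AE /g_; ring.
have gS N (q : R) : 0 <= q -> `|g_ N q| <= S.
  move=> q0; have /andP[h0 h1] := e01 q q0; rewrite normrM ger0_norm//.
  rewrite -[S]mul1r ler_pM//; apply: bernstein_bound; first by rewrite h0 h1.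
  move=> k kN; apply: FS; rewrite divr_ge0//= ler_pdivrMr ?ltr0n// mul1r.
  by rewrite ler_nat.
have f0 N : f_ N 0 = f 0 by rewrite /f_ oppr0 expR0 addrK.
have cg_ (q : R) : 0 <= q -> g_ N q @[N --> \oo] --> g q.
  move=> q0; have -> : g q = expR (- q) * F (expR (- q)).
    by rewrite /F expRK opprK mulrCA mulfV ?mulr1// gt_eqF// expR_gt0.
  apply: cvgM; first exact: cvg_cst.
  exact: (bernstein_cvg (e01 q q0) FS (cF q)).
apply: (@ibp_pair_cvg _ _ _ _ _ _ _ G f_ g_ _ g (`|f 0| + S)) => //.
- exact: addr_ge0.
- move=> N q q0; split; last by apply: (le_trans (gS N q q0)); rewrite lerDr.
  have [c /andP[c0 _] e] := mean_value_on q0 (fun x _ => Df_ N x).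
  rewrite -[f_ N q](subrK (f_ N 0)) e f0 subr0.
  apply: (le_trans (ler_normD _ _)); rewrite normrM (ger0_norm q0).
  have := gS N c c0; have := normr_ge0 (f 0); have := normr_ge0 (g_ N c).
  by move: `|f 0| `|g_ N c| => *; nra.
- move=> q q0; rewrite (max_idPl q0).
  have I N : f_ N q = f 0 + \int[mu]_(x in `[0, q]) g_ N x.
    rewrite (Rintegral_derivative q0 (fun x _ => Df_ N x)); first by rewrite f0; ring.
    move=> x; apply: cvgM; first by apply: continuous_comp; [exact: cvgN|exact: continuous_expR].
    apply: (@continuous_comp _ _ _ (fun x => expR (- x)) (horner (p N))).
      by apply: continuous_comp; [exact: cvgN|exact: continuous_expR].
    exact: is_derive_continuous_at (is_derive_poly _ _).
  have -> : f q = f 0 + \int[mu]_(x in `[0, q]) g x.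
    have Dq (x : R) : 0 <= x <= q -> is_derive (x : R) (1 : R) f (g x).
      by move=> /andP[x0 _]; apply: Df; rewrite (lt_le_trans _ x0)// ltrN10.
    by rewrite (Rintegral_derivative q0 Dq cg); ring.
  under eq_fun do rewrite I.
  apply: cvgD; first exact: cvg_cst.
  under eq_fun do rewrite Rintegral_mkcond.
  rewrite Rintegral_mkcond.
  have mI : measurable (`[0, q]%classic : set R) by exact: measurable_itv.
  apply: (@Rintegral_cvg _ _ _ mu _ _ (fun x => S * \1_(`[0, q]%classic) x)).
  + move=> N; apply/(measurable_restrictT _ mI); apply: measurable_funTS.
    have [_ + _ _] := ib N; exact.
  + by apply/(measurable_restrictT _ mI); exact: measurable_funTS.
  + move=> x; rewrite /patch; case: ifPn => xq; last exact: cvg_cst.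
    by apply: cg_; move: xq; rewrite inE/= in_itv/= => /andP[].
  + by apply: integrable_scale; exact: integrable_indic_itv.
  + move=> N x; rewrite /patch indicE; case: ifPn => xq; last by rewrite normr0 mulr0.
    by rewrite mulr1 gS//; move: xq; rewrite inE/= in_itv/= => /andP[].
Qed.

(** The average of a truncation of [f] over [[x - 1 / m, x]] is of class C1, and
its derivative is a difference quotient that vanishes for large [x]. Left
quotients are the natural choice: the functions of interest have a kink, where
only a one-sided derivative is prescribed. *)
Lemma ibp_pair_lipschitz f g (L : R) : 0 <= L ->
  (forall x y, `|f x - f y| <= L * `|x - y|) ->
  (forall x, N.+1%:R * (f x - f (x - N.+1%:R^-1)) @[N --> \oo] --> g x) ->
  ibp f g.
Proof.
move=> L0 fL fg.
have cf : continuous f.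
  move=> x; apply/cvgrPdist_le => e e0; near=> y.
  apply: (le_trans (fL x y)).
  have h : `|x - y| <= e / (L + 1).
    by near: y; apply: cvgr_dist_le; rewrite ?divr_gt0 ?ltr_wpDl//; exact: cvg_id.
  apply: (le_trans (ler_wpM2l L0 h)).
  by rewrite mulrCA ger_pMr// ler_pdivrMr ?ltr_wpDl// mul1r lerDl.
have mf : measurable_fun setT f by exact: continuous_measurable_fun.
have [m mE] : exists m : nat -> R, m = fun N => N.+1%:R by eexists.
have m0 N : 0 < m N by rewrite mE ltr0n.
have m1 N : 1 <= m N by rewrite mE ler1n.
have [v vE] : exists v : nat -> R, v = fun N => (m N)^-1 by eexists.
have mvE N : m N * v N = 1 by rewrite vE mulfV// gt_eqF.
have mV N : 0 < v N <= 1 by rewrite vE invr_gt0 m0 invf_le1 ?m0 ?m1.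
pose fN N x := f (Num.min x (m N)).
have fNL N (x y : R) : `|fN N x - fN N y| <= L * `|x - y|.
  by apply: (le_trans (fL _ _)); rewrite ler_wpM2l// min_dist_le.
have cfN N : continuous (fN N).
  move=> x; apply: (@continuous_comp _ _ _ (fun q : R => Num.min q (m N)) f).
    by apply: (@continuous_min _ R (fun q : R => q) (fun=> m N)) => //; exact: cvg_cst.
  exact: cf.
(* the endpoint [-3] leaves room for the shift by [v N <= 1] when [-1 < x] *)
pose F N x := \int[mu]_(t in `[-3, x]) fN N t.
have DF N (x : R) : -3 < x -> is_derive (x : R) (1 : R) (F N) (fN N x).
  move=> x3; have [||||d1 d2] := @continuous_FTC1_closed R (fN N) (-3) x (x + 1).
  - by rewrite ltrDl.
  - apply: continuous_compact_integrable; first exact: segment_compact.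
    exact: continuous_subspaceT.
  - exact: x3.
  - exact: cfN.
  by apply: DeriveDef; [exact: d1|rewrite -derive1E; exact: d2].
pose f_ N x := m N * (F N x - F N (x - v N)).
pose g_ N x := m N * (fN N x - fN N (x - v N)).
have Df_ N (x : R) : -1 < x -> is_derive (x : R) (1 : R) (f_ N) (g_ N x).
  move=> x1; have /andP[v0 v1] := mV N.
  have x3 : -3 < x by lra.
  have x4 : -3 < x - v N by lra.
  have D1 := DF N _ x3; have D2 := DF N _ x4.
  have D3 := is_derive_sub (is_derive_idfun x) (is_derive_cstfun (v N) x).
  have D4 := @is_derive_compf R (F N) (fun y => y - v N) x _ _ D2 D3.
  apply: (is_derive_eq (is_derive_scale (m N) (is_derive_sub D1 D4))).
  by rewrite /g_ subr0 mulr1.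
have cg_ N : continuous (g_ N).
  move=> x; apply: cvgM; first exact: cvg_cst.
  apply: cvgB; first exact: cfN.
  apply: (@continuous_comp _ _ _ (fun y => y - v N) (fN N)); last exact: cfN.
  by apply: cvgB; [exact: cvg_id|exact: cvg_cst].
have gL N (x : R) : `|g_ N x| <= L.
  have /andP[v0 v1] := mV N; rewrite /g_ normrM gtr0_norm//.
  apply: (le_trans (ler_wpM2l (ltW (m0 N)) (fNL _ _ _))).
  by rewrite opprB addrC subrK gtr0_norm// mulrCA mvE mulr1.
have ib N : ibp (fun q => f_ N (Num.max q 0)) (g_ N).
  have /andP[v0 v1] := mV N.
  apply: (@ibp_pair_compact_support (f_ N) (g_ N) (m N + 1) L) => //.
  - by rewrite addr_ge0// ltW.
  - move=> x xm; rewrite /g_ /fN !min_r ?subrr ?mulr0//; lra.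
(* by the mean value theorem, averaging moves the argument by at most [v N] *)
have f_mean N (x : R) : 0 <= x -> exists2 c, x - v N <= c <= x & f_ N x = fN N c.
  move=> x0; have /andP[v0 v1] := mV N.
  have [|y /andP[y1 _]|c cab e] := @mean_value_on R (F N) (fN N) (x - v N) x.
  - lra.
  - apply: DF; lra.
  by exists c => //; rewrite /f_ e opprB addrC subrK mulrCA mvE mulr1.
have mg : measurable_fun setT g.
  apply: (measurable_fun_cvg (h := fun N x => m N * (f x - f (x - v N)))) => //.
  - move=> N; apply: measurable_funM => //; apply: measurable_funB => //.
    by apply: measurableT_comp => //; apply: measurable_funB => //; exact: measurable_id.
  - by move=> x _; rewrite vE mE; exact: fg.
apply: (@ibp_pair_cvg _ _ _ _ _ _ _ G (fun N q => f_ N (Num.max q 0)) g_ f g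
  (`|f 0| + 2 * L)) => //.
- by rewrite addr_ge0// mulr_ge0.
- move=> N q q0; rewrite (max_idPl q0); split; last first.
    by apply: (le_trans (gL N q)); have := normr_ge0 (f 0); lra.
  have [c /andP[c1 c2] ->] := f_mean N q q0.
  have /andP[v0 v1] := mV N.
  have h : `|Num.min c (m N)| <= q + 1.
    rewrite /Num.min; case: ltP => cm; rewrite ler_norml; apply/andP; split; have := m1 N; lra.
  rewrite /fN -[f _](subrK (f 0)); apply: (le_trans (ler_normD _ _)).
  have := fL (Num.min c (m N)) 0; rewrite subr0 => h2.
  have h3 := ler_wpM2l L0 h; have := normr_ge0 (f 0); nra.
- move=> q q0; rewrite (max_idPl q0); apply/cvgrPdist_le => e e0; near=> N.
  have [c /andP[c1 c2] ->] := f_mean N q q0.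
  have qm : q <= m N.
    rewrite mE; apply: (@le_trans _ _ N%:R); last by rewrite ler_nat.
    by near: N; exact: nbhs_infty_ger.
  have cm : c <= m N by exact: le_trans qm.
  rewrite /fN (min_idPl cm); apply: (le_trans (fL _ _)).
  have /andP[v0 v1] := mV N.
  rewrite ger0_norm ?subr_ge0//.
  apply: (@le_trans _ _ (L / m N)); first by rewrite ler_wpM2l// -[_^-1]/((fun k => (m k)^-1) N) -vE; lra.
  rewrite ler_pdivrMr// -ler_pdivrMl//.
  rewrite mE; apply: (@le_trans _ _ N%:R); last by rewrite ler_nat.
  by near: N; exact: nbhs_infty_ger.
- move=> q q0; apply: cvg_trans (fg q); apply: near_eq_cvg; near=> N.
  have -> : N.+1%:R = m N by rewrite mE.
  have -> : (m N)^-1 = v N by rewrite vE.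
  have qm : q <= m N.
    rewrite mE; apply: (@le_trans _ _ N%:R); last by rewrite ler_nat.
    by near: N; exact: nbhs_infty_ger.
  have /andP[v0 v1] := mV N.
  by rewrite /g_ /fN (min_idPl qm) min_l//; lra.
Unshelve. all: by end_near. Qed.

End LipschitzIBP.

(** * Quadratic forms in Gaussian variables *)

Section QuadraticForms.
Context (R : realType).

Lemma quadratic_discriminant (a b c : R) : 0 <= c ->
  (forall t, 0 <= a + 2 * t * b + t ^+ 2 * c) -> b ^+ 2 <= a * c.
Proof.
rewrite le_eqVlt => /predU1P[<-|c0] h.
  have [->|b0] := eqVneq b 0; first by rewrite mulr0 expr0n.
  have := h (- (a + 1) / (2 * b)); rewrite mulr0 addr0.
  rewrite (_ : 2 * _ * b = - (a + 1)); last by field.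
  lra.
have := h (- b / c); have cn0 : c != 0 by rewrite gt_eqF.
have -> : a + 2 * (- b / c) * b + (- b / c) ^+ 2 * c = (a * c - b ^+ 2) / c by field.
by rewrite pmulr_lge0 ?invr_gt0// subr_ge0.
Qed.

Lemma sqr_le_sqr (x y : R) : 0 <= y -> x ^+ 2 <= y ^+ 2 -> x <= y.
Proof.
move=> y0; have [x0|x0] := leP 0 x; last by move=> _; rewrite (le_trans (ltW x0)).
by rewrite ler_pXn2r ?nnegrE.
Qed.

Variable n : nat.
Variable C : 'I_n -> 'I_n -> R.
Hypothesis Csym : forall i j, C i j = C j i.
Hypothesis Cpsd : forall a, 0 <= covform C a.
Implicit Types (x y : 'I_n -> R).

Definition dot x y := \sum_i x i * y i.
Definition covmul x i := \sum_j C i j * x j.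

(** The squared Hilbert-Schmidt norms of the covariance and of its square. *)
Definition hs2 := \sum_i \sum_j C i j ^+ 2.
Definition hs4 := \sum_i \sum_l (\sum_j C i j * C j l) ^+ 2.

Lemma dotC x y : dot x y = dot y x.
Proof. by apply: eq_bigr => i _; rewrite mulrC. Qed.

Lemma dot_ge0 x : 0 <= dot x x.
Proof. by apply: sumr_ge0 => i _; rewrite -expr2 sqr_ge0. Qed.

Lemma hs4_ge0 : 0 <= hs4.
Proof. by apply: sumr_ge0 => i _; apply: sumr_ge0 => j _; rewrite sqr_ge0. Qed.

Lemma covformE x : covform C x = dot x (covmul x).
Proof.
apply: eq_bigr => i _; rewrite /covmul mulr_sumr; apply: eq_bigr => j _; ring.
Qed.

Lemma dot_covmul x y : dot (covmul x) y = dot x (covmul y).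
Proof.
rewrite /dot /covmul; under eq_bigr do rewrite mulr_suml.
rewrite exchange_big /=; apply: eq_bigr => i _; rewrite mulr_sumr.
by apply: eq_bigr => j _; rewrite Csym; ring.
Qed.

Lemma dot_shift x y t : dot (fun i => x i + t * y i) (fun i => x i + t * y i) =
  dot x x + 2 * t * dot x y + t ^+ 2 * dot y y.
Proof.
rewrite /dot !mulr_sumr -!big_split/=; apply: eq_bigr => i _; ring.
Qed.

Lemma dot_cauchy_schwarz x y : dot x y ^+ 2 <= dot x x * dot y y.
Proof.
apply: quadratic_discriminant => [|t]; first exact: dot_ge0.
by rewrite -dot_shift dot_ge0.
Qed.

Lemma covform_dot_shift x y t : covform C (fun i => x i + t * y i) =
  covform C x + 2 * t * dot x (covmul y) + t ^+ 2 * covform C y.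
Proof.
have E : covmul (fun i => x i + t * y i) = fun i => covmul x i + t * covmul y i.
  apply/funext => i; rewrite /covmul mulr_sumr -big_split/=.
  by apply: eq_bigr => j _; ring.
rewrite !covformE E; have := dot_covmul x y.
have -> : dot (covmul x) y = dot y (covmul x) by exact: dotC.
have -> : dot (fun i => x i + t * y i) (fun i => covmul x i + t * covmul y i) =
  dot x (covmul x) + t * dot x (covmul y) + t * dot y (covmul x) +
    t ^+ 2 * dot y (covmul y).
  by rewrite /dot !mulr_sumr -!big_split/=; apply: eq_bigr => i _; ring.
by move=> ->; ring.
Qed.

Lemma covform_cauchy_schwarz x y :
  dot x (covmul y) ^+ 2 <= covform C x * covform C y.
Proof.
by apply: quadratic_discriminant => // t; rewrite -covform_dot_shift.
Qed.

Lemma covmul2_le x : dot (covmul (covmul x)) (covmul (covmul x)) <= hs4 * dot x x.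
Proof.
have E i : covmul (covmul x) i = dot (fun l => \sum_j C i j * C j l) x.
  rewrite /covmul /dot; under eq_bigr do rewrite mulr_sumr.
  rewrite exchange_big/=; apply: eq_bigr => l _; rewrite mulr_suml.
  by apply: eq_bigr => j _; ring.
rewrite /hs4 mulr_suml; apply: ler_sum => i _.
rewrite -expr2 E; apply: (le_trans (dot_cauchy_schwarz _ _)).
by rewrite /dot; under eq_bigr do rewrite -expr2.
Qed.

(** [C * C <= lam * C] as forms: Cauchy-Schwarz for the semi-inner product of
the covariance and [lam] a bound on its operator norm. *)
Lemma covmul_sqr_le (lam : R) x : 0 <= lam -> hs4 <= lam ^+ 4 ->
  dot (covmul x) (covmul x) <= lam * covform C x.
Proof.
move=> lam0 hl.
have op y : covform C y <= lam * dot y y.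
  have N0 := dot_ge0 y; have M0 := dot_ge0 (covmul y).
  have M1 : dot (covmul y) (covmul y) <= lam ^+ 2 * dot y y.
    apply: sqr_le_sqr; first by rewrite mulr_ge0// sqr_ge0.
    rewrite {1}dot_covmul; apply: (le_trans (dot_cauchy_schwarz _ _)).
    apply: (le_trans (ler_wpM2l N0 (covmul2_le y))).
    rewrite (_ : (lam ^+ 2 * _) ^+ 2 = dot y y * (lam ^+ 4 * dot y y)); last by ring.
    by rewrite ler_wpM2l// ler_wpM2r.
  apply: sqr_le_sqr; first by rewrite mulr_ge0.
  rewrite covformE; apply: (le_trans (dot_cauchy_schwarz _ _)).
  apply: (le_trans (ler_wpM2l N0 M1)).
  by rewrite exprMn mulrCA -expr2.
have M0 := dot_ge0 (covmul x); set M := dot _ _ in M0 *.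
have MM : M ^+ 2 <= lam * covform C x * M.
  rewrite {1}/M dot_covmul; apply: (le_trans (covform_cauchy_schwarz _ _)).
  apply: (le_trans (ler_wpM2l (Cpsd x) (op (covmul x)))).
  by rewrite -/M mulrCA mulrA.
move: M0; rewrite le_eqVlt => /predU1P[<-|M0]; first by rewrite mulr_ge0.
by rewrite -(ler_pM2r M0) -expr2.
Qed.

End QuadraticForms.

Section GaussianQuadraticForm.
Context d (T : measurableType d) (R : realType) (P : probability T R) (n : nat).
Variables (Y : 'I_n -> T -> R) (C : 'I_n -> 'I_n -> R).
Hypothesis G : gaussian_vector P Y C.
Implicit Types (f g : R -> R) (i j k l : 'I_n).
Local Notation Q := (sqnorm Y).
Local Notation dom := (dominated Y).
Local Notation ibp := (ibp_pair P Y C).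

Lemma covform_ge0 a : 0 <= covform C a.
Proof. by have [s <- _] := G.2 a; rewrite sqr_ge0. Qed.

Definition covtrace := \sum_i C i i.
(** A quarter of the squared norm of the Malliavin derivative of the squared
norm [Q]. *)
Definition covquad w := covform C (fun i => Y i w).
Definition covquad2 w := dot (covmul C (fun i => Y i w)) (covmul C (fun i => Y i w)).

Lemma covquad_ge0 w : 0 <= covquad w. Proof. exact: covform_ge0. Qed.

Lemma dominated_covquad : dom 1 covquad.
Proof.
apply: dominated_sum => i; apply: dominated_sum => j.
have := dominatedZ (C i j) (dominated_coord2 G i j).
by congr (dominated _ _ _); apply/funext => w; rewrite mulrC.
Qed.

Lemma dominated_covquad2 : dom 1 covquad2.
Proof.
apply: dominated_sum => i.
have E : (fun w => covmul C (fun i => Y i w) i * covmul C (fun i => Y i w) i) =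
  (fun w => \sum_k \sum_l C i k * C i l * (Y k w * Y l w)).
  apply/funext => w; rewrite /covmul mulr_suml; apply: eq_bigr => k _.
  by rewrite mulr_sumr; apply: eq_bigr => l _; ring.
rewrite E; apply: dominated_sum => k; apply: dominated_sum => l.
exact/dominatedZ/dominated_coord2/G.
Qed.

Let defect_int f g i j : ibp f g -> P.-integrable setT (EFin \o ibp_defect Y C i j f g).
Proof.
move=> [m1 m2 [K K0 b] _].
exact: (dominated_integrable G (k := 2)) (dominated_ibp_defect G i j m1 m2 K0 b).
Qed.

Lemma covsum_mul (y : 'I_n -> R) i : \sum_k C i k * (y k * y i) = y i * covmul C y i.
Proof. by rewrite /covmul mulr_sumr; apply: eq_bigr => k _; ring. Qed.

(** The diagonal coordinate identities add up to [E[F f(Q)] = E[2 V f'(Q)]] for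
[F = Q - covtrace] and [V = covquad]: the random variable [2 * V] replaces the
variance of Stein's identity for a normal law. *)
Lemma quadratic_stein f g : ibp f g ->
  \int[P]_w ((Q w - covtrace) * f (Q w) - 2 * (g (Q w) * covquad w)) = 0.
Proof.
move=> fg; transitivity (\sum_i \int[P]_w ibp_defect Y C i i f g w); last first.
  by rewrite big1// => i _; case: fg.
rewrite -Rintegral_bigsum; last by move=> i; exact: defect_int.
apply: eq_Rintegral => w _; rewrite /ibp_defect /covquad covformE.
rewrite [RHS]sumrB -mulr_suml sumrB -mulr_sumr -mulr_sumr.
congr ((_ - _) * _ - _ * (_ * _)).
by apply: eq_bigr => i _; rewrite covsum_mul.
Qed.

(** The coordinate identities with weights [C i j]. *)
Lemma covquad_stein f g : ibp f g ->
  \int[P]_w ((covquad w - hs2 C) * f (Q w) - 2 * (g (Q w) * covquad2 w)) = 0.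
Proof.
move=> fg.
transitivity (\sum_i \sum_j C i j * \int[P]_w ibp_defect Y C i j f g w); last first.
  by rewrite big1// => i _; rewrite big1// => j _; case: fg => _ _ _ ->; rewrite mulr0.
rewrite (eq_bigr (fun i => \int[P]_w \sum_j C i j * ibp_defect Y C i j f g w)); last first.
  move=> i _; rewrite Rintegral_bigsum; last first.
    by move=> j; apply: integrable_scale; exact: defect_int.
  by apply: eq_bigr => j _; rewrite RintegralZl// defect_int.
rewrite -Rintegral_bigsum; last first.
  move=> i; apply: integrable_bigsum => j; apply: integrable_scale; exact: defect_int.
apply: eq_Rintegral => w _; rewrite /ibp_defect /covquad covformE /hs2 /covquad2.
set y := fun i => Y i w; set fw := f _; set gw := g _.
have E i : \sum_j C i j * ((y i * y j - C i j) * fw - 2 * (gw * \sum_k C i k * (y k * y j))) =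
    (y i * covmul C y i - \sum_j C i j ^+ 2) * fw
    - 2 * gw * (covmul C y i * covmul C y i).
  rewrite (eq_bigr (fun j => (y i * (C i j * y j) - C i j ^+ 2) * fw
      - 2 * gw * (C i j * y j * covmul C y i))); last first.
    move=> j _; have -> : \sum_k C i k * (y k * y j) = y j * covmul C y i.
      by rewrite /covmul mulr_sumr; apply: eq_bigr => k _; ring.
    by ring.
  by rewrite sumrB -mulr_suml sumrB -!mulr_sumr -mulr_suml.
under [RHS]eq_bigr do rewrite E.
by rewrite sumrB -mulr_suml sumrB -mulr_sumr mulrA.
Qed.

End GaussianQuadraticForm.

Section QuadraticFormMoments.
Context d (T : measurableType d) (R : realType) (P : probability T R) (n : nat).
Variables (Y : 'I_n -> T -> R) (C : 'I_n -> 'I_n -> R).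
Hypothesis G : gaussian_vector P Y C.
Implicit Types (f g : R -> R) (i j k l : 'I_n).
Local Notation Q := (sqnorm Y).
Local Notation dom := (dominated Y).
Local Notation V := (covquad Y C).
Local Notation F := (fun w => Q w - covtrace C).

Let dom_int m X : (m <= 2)%N -> dom m X -> P.-integrable setT (EFin \o X).
Proof. exact: (dominated_integrable G). Qed.

Lemma ibp_pair_one : ibp_pair P Y C (fun=> 1) (fun=> 0).
Proof.
apply: (ibp_pair_lipschitz G (lexx 0)) => [x y|x].
  by rewrite subrr normr0 mul0r.
by under eq_fun do rewrite subrr mulr0; exact: cvg_cst.
Qed.

Lemma ibp_pair_id : ibp_pair P Y C (fun q => q) (fun=> 1).
Proof.
apply: (ibp_pair_lipschitz G (ler01)) => [x y|x]; first by rewrite mul1r.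
by under eq_fun do rewrite opprB addrC subrK mulfV ?pnatr_eq0//; exact: cvg_cst.
Qed.

Lemma dominated_quadratic : dom 1 F.
Proof. by apply: dominatedB; [exact: dominated_sqnorm G|exact: dominated_cst]. Qed.

Lemma quadratic_mean : \int[P]_w F w = 0.
Proof.
rewrite -[RHS](quadratic_stein G ibp_pair_one); apply: eq_Rintegral => w _; ring.
Qed.

Lemma covquad_mean : \int[P]_w V w = hs2 C.
Proof.
have := covquad_stein G ibp_pair_one.
under eq_Rintegral do rewrite mulr1 mul0r mulr0 subr0.
have ic : P.-integrable setT (EFin \o (fun=> hs2 C)).
  exact: finite_measure_integrable_cst.
rewrite (RintegralB measurableT (dom_int (m := 1) isT (dominated_covquad G)) ic).
by rewrite Rintegral_prob_cst => /eqP; rewrite subr_eq0 => /eqP.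
Qed.

(** Stein's identity with [f] the identity function. *)
Lemma quadratic_variance : \int[P]_w (F w ^+ 2) = 2 * hs2 C.
Proof.
have dF := dominated_quadratic; have dV := dominated_covquad G.
have H := quadratic_stein G ibp_pair_id.
rewrite -covquad_mean -RintegralZl//; last exact: (dom_int (m := 1) isT dV).
transitivity (\int[P]_w (((F w) * Q w - 2 * (1 * V w)) + (2 * V w - covtrace C * F w))).
  by apply: eq_Rintegral => w _; ring.
have iF := dom_int (m := 1) isT dF; have iV := dom_int (m := 1) isT dV.
have i1 : P.-integrable setT (EFin \o (fun w => F w * Q w - 2 * (1 * V w))).
  apply: integrable_sub.
    exact: (dom_int (m := 2) isT (dominatedM dF (dominated_sqnorm G))).
  apply: integrable_scale.
  exact: (dom_int (m := 1) isT (dominatedM (dominated_cst Y 0 1) dV)).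
have i2 := integrable_scale 2 iV; have i3 := integrable_scale (covtrace C) iF.
rewrite (RintegralD measurableT i1 (integrable_sub i2 i3)) H add0r.
rewrite (RintegralB measurableT i2 i3) [X in _ - X]RintegralZl//.
by rewrite quadratic_mean mulr0 subr0.
Qed.

Lemma coord4_integrable i j k l :
  P.-integrable setT (EFin \o (fun w => Y i w * Y j w * (Y k w * Y l w))).
Proof.
exact: (dom_int (m := 2) isT (dominatedM (dominated_coord2 G i j) (dominated_coord2 G k l))).
Qed.

Lemma linform4_fourth i j k l (p q r : R) :
  P.-integrable setT (EFin \o (fun w => (Y i w + p * Y j w + q * Y k w + r * Y l w) ^+ 4)) /\
  \int[P]_w ((Y i w + p * Y j w + q * Y k w + r * Y l w) ^+ 4) =
  3 * (C i i + p ^+ 2 * C j j + q ^+ 2 * C k k + r ^+ 2 * C l l + 2 * p * C i j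
    + 2 * q * (C i k + p * C j k) + 2 * r * (C i l + p * C j l + q * C k l)) ^+ 2.
Proof.
pose e a b := (b == a :> 'I_n)%:R : R.
pose v m := e i m + p * e j m + q * e k m + r * e l m.
have [s es N] := G.2 v.
have EL w : linform Y v w = Y i w + p * Y j w + q * Y k w + r * Y l w.
  rewrite (linform_shift Y (fun m => e i m + p * e j m + q * e k m)).
  rewrite (linform_shift Y (fun m => e i m + p * e j m)).
  by rewrite (linform_shift Y (e i)) linform_delta.
have S a (u : 'I_n -> R) t b : \sum_m C a m * (u m + t * e b m) = \sum_m C a m * u m + t * C a b.
  under eq_bigr do rewrite mulrDr.
  rewrite big_split/=; congr (_ + _); rewrite (bigD1 b)//= /e eqxx mulr1 mulrC.
  by rewrite big1 ?addr0// => m /negbTE ->; rewrite !mulr0.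
have S0 a b : \sum_m C a m * e b m = C a b.
  rewrite (bigD1 b)//= /e eqxx mulr1.
  by rewrite big1 ?addr0// => m /negbTE ->; rewrite !mulr0.
have EC : covform C v = C i i + p ^+ 2 * C j j + q ^+ 2 * C k k + r ^+ 2 * C l l + 2 * p * C i j
    + 2 * q * (C i k + p * C j k) + 2 * r * (C i l + p * C j l + q * C k l).
  rewrite (covform_shift G (fun m => e i m + p * e j m + q * e k m)).
  rewrite (covform_shift G (fun m => e i m + p * e j m)).
  rewrite (covform_shift G (e i)) covform_delta !S !S0.
  rewrite (cov_sym G l i) (cov_sym G l j) (cov_sym G l k) (cov_sym G k i).
  rewrite (cov_sym G k j) (cov_sym G j i); ring.
have iN := centered_normal_expr_integrable N (k := 4) isT.
have := centered_normal_fourth N.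
rewrite (exprM s 2 2) es EC => <-; split.
  by move: iN; congr (P.-integrable _ _); apply/funext => w /=; rewrite EL.
by apply: eq_Rintegral => w _; rewrite EL.
Qed.

(** Isserlis' formula, by polarization of the fourth moment of linear forms. *)
Lemma isserlis i j k l : \int[P]_w (Y i w * Y j w * (Y k w * Y l w)) =
  C i j * C k l + C i k * C j l + C i l * C j k.
Proof.
pose s : seq (R * R * R) := [:: (1, 1, 1); (1, 1, -1); (1, -1, 1); (1, -1, -1);
  (-1, 1, 1); (-1, 1, -1); (-1, -1, 1); (-1, -1, -1)].
pose h (e : R * R * R) w := e.1.1 * e.1.2 * e.2 / 192 *
  (Y i w + e.1.1 * Y j w + e.1.2 * Y k w + e.2 * Y l w) ^+ 4.
transitivity (\int[P]_w \sum_(e <- s) h e w).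
  by apply: eq_Rintegral => w _; rewrite /s !big_cons big_nil /h /=; field.
rewrite Rintegral_bigsum; last first.
  move=> e; apply: integrable_scale.
  exact: (linform4_fourth i j k l e.1.1 e.1.2 e.2).1.
have E e : \int[P]_w h e w = e.1.1 * e.1.2 * e.2 / 192 * (3 * (C i i + e.1.1 ^+ 2 * C j j
    + e.1.2 ^+ 2 * C k k + e.2 ^+ 2 * C l l + 2 * e.1.1 * C i j
    + 2 * e.1.2 * (C i k + e.1.1 * C j k)
    + 2 * e.2 * (C i l + e.1.1 * C j l + e.1.2 * C k l)) ^+ 2).
  have [I <-] := linform4_fourth i j k l e.1.1 e.1.2 e.2.
  by rewrite RintegralZl.
under eq_bigr do rewrite E.
by rewrite /s !big_cons big_nil /=; field.
Qed.

Lemma covquad_sqr_mean : \int[P]_w (V w ^+ 2) = hs2 C ^+ 2 + 2 * hs4 C.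
Proof.
transitivity (\int[P]_w \sum_i \sum_j \sum_k \sum_l
    C i j * C k l * (Y i w * Y j w * (Y k w * Y l w))).
  apply: eq_Rintegral => w _; rewrite /covquad /covform expr2 mulr_suml.
  apply: eq_bigr => i _; rewrite mulr_suml; apply: eq_bigr => j _.
  rewrite mulr_sumr; apply: eq_bigr => k _; rewrite mulr_sumr.
  by apply: eq_bigr => l _; ring.
have I i j k l : P.-integrable setT (EFin \o (fun w =>
    C i j * C k l * (Y i w * Y j w * (Y k w * Y l w)))).
  by apply: integrable_scale; exact: coord4_integrable.
rewrite Rintegral_bigsum; last by move=> i; do 3 apply: integrable_bigsum => ?; exact: I.
rewrite (eq_bigr (fun i => \sum_j \sum_k \sum_l C i j * C k l *
    (C i j * C k l + C i k * C j l + C i l * C j k))); last first.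
  move=> i _; rewrite Rintegral_bigsum; last by move=> j; do 2 apply: integrable_bigsum => ?; exact: I.
  apply: eq_bigr => j _; rewrite Rintegral_bigsum; last by move=> k; apply: integrable_bigsum => ?; exact: I.
  apply: eq_bigr => k _; rewrite Rintegral_bigsum; last by move=> l; exact: I.
  by apply: eq_bigr => l _; rewrite RintegralZl ?isserlis//; exact: coord4_integrable.
have H1 : hs2 C ^+ 2 = \sum_i \sum_j \sum_k \sum_l C i j * C k l * (C i j * C k l).
  rewrite /hs2 expr2 mulr_suml; apply: eq_bigr => i _.
  rewrite mulr_suml; apply: eq_bigr => j _; rewrite mulr_sumr; apply: eq_bigr => k _.
  by rewrite mulr_sumr; apply: eq_bigr => l _; ring.
have H2 : hs4 C = \sum_i \sum_j \sum_k \sum_l C i j * C k l * (C i k * C j l).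
  rewrite /hs4; apply: eq_bigr => i _.
  rewrite (eq_bigr (fun l => \sum_j \sum_k C i j * C k l * (C i k * C j l))).
    by rewrite exchange_big/=; apply: eq_bigr => j _; rewrite exchange_big.
  move=> l _; rewrite expr2 mulr_suml; apply: eq_bigr => j _.
  by rewrite mulr_sumr; apply: eq_bigr => k _; ring.
have H3 : hs4 C = \sum_i \sum_j \sum_k \sum_l C i j * C k l * (C i l * C j k).
  rewrite H2; apply: eq_bigr => i _; apply: eq_bigr => j _.
  rewrite exchange_big/=; apply: eq_bigr => k _; apply: eq_bigr => l _.
  by rewrite (cov_sym G l k); ring.
rewrite H1 mulr_natl mulr2n {1}H2 H3 -!big_split/=; apply: eq_bigr => i _.
rewrite -!big_split/=; apply: eq_bigr => j _.
rewrite -!big_split/=; apply: eq_bigr => k _.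
rewrite -!big_split/=; apply: eq_bigr => l _; ring.
Qed.

Lemma covquad_variance : \int[P]_w ((V w - hs2 C) ^+ 2) = 2 * hs4 C.
Proof.
have dV := dominated_covquad G.
transitivity (\int[P]_w (V w ^+ 2 + (hs2 C ^+ 2 - 2 * hs2 C * V w))).
  by apply: eq_Rintegral => w _; ring.
have ic : P.-integrable setT (EFin \o (fun=> hs2 C ^+ 2)).
  exact: finite_measure_integrable_cst.
have iV : P.-integrable setT (EFin \o (fun w => 2 * hs2 C * V w)).
  by apply: integrable_scale; exact: (dom_int (m := 1) isT dV).
rewrite RintegralD//; [|exact: (dom_int (m := 2) isT (dominatedM dV dV))|exact: integrable_sub].
rewrite RintegralB// RintegralZl//; last exact: (dom_int (m := 1) isT dV).
rewrite covquad_sqr_mean covquad_mean Rintegral_prob_cst; ring.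
Qed.

End QuadraticFormMoments.

(** * A Gaussian tail bound for quadratic forms *)

Section LeftQuotient.
Context (R : realType).

Lemma left_quotient_cvg (f : R -> R) (x l : R) : is_derive (x : R) (1 : R) f l ->
  N.+1%:R * (f x - f (x - N.+1%:R^-1)) @[N --> \oo] --> l.
Proof.
move=> h.
have /cvg_ex[l' Hl'] := @ex_derive _ _ _ _ _ _ _ h.
have el : l' = l.
  rewrite -(@derive_val _ _ _ _ _ _ _ h); apply/esym; exact/cvg_lim.
rewrite {}el in Hl'; apply/cvgrPdist_le => e e0.
have /cvgrPdist_le/(_ _ e0) := Hl'.
rewrite near_withinE => /nbhs_ballP[dl /= dl0 Hd].
near=> N; pose v : R := - N.+1%:R^-1.
have n0 : (0 : R) < N.+1%:R by rewrite ltr0n.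
have v0 : v != 0 by rewrite oppr_eq0 invr_eq0 gt_eqF.
have := Hd v _ v0.
rewrite /ball /= sub0r normrN /v normrN gtr0_norm ?invr_gt0// => H.
have -> : N.+1%:R * (f x - f (x - N.+1%:R^-1)) =
   (- N.+1%:R^-1)^-1 *: (f (- N.+1%:R^-1 *: 1 + x) - f x).
  by rewrite [_ *: 1]mulr1 [_ + x]addrC invrN invrK /GRing.scale/=; ring.
apply: H; rewrite invf_plt ?posrE//.
apply: (@lt_le_trans _ _ N%:R); last by rewrite ler_nat.
by near: N; exact: nbhs_infty_gtr.
Unshelve. all: by end_near. Qed.

Lemma expR_quadratic (x : R) : `|expR x - 1 - x| <= x ^+ 2 * expR `|x|.
Proof.
have D (y : R) : is_derive (y : R) (1 : R) (fun y => expR y - y) (expR y - 1).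
  exact: (is_derive_sub (is_derive_expR y) (is_derive_idfun y)).
have [c c0x] := mean_value 0 x D; rewrite expR0 !subr0 => e.
have -> : expR x - 1 - x = (expR c - 1) * x by rewrite -e; ring.
have cx : `|c| <= `|x|.
  move: c0x; rewrite /Num.min /Num.max; case: ltP => x0 /andP[c1 c2].
    by rewrite !ger0_norm// ltW.
  by rewrite !ler0_norm// lerN2.
have [b b0c] := mean_value 0 c (@is_derive_expR R); rewrite expR0 subr0 => ->.
rewrite !normrM (ger0_norm (expR_ge0 _)) -[x ^+ 2]real_normK ?num_real//.
have bx : expR b <= expR `|x|.
  rewrite ler_expR; move: b0c; rewrite /Num.min /Num.max; case: ltP => c0 /andP[_ b2].
    by apply: (le_trans b2); apply: le_trans cx; exact: ler_norm.
  exact: (le_trans b2).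
rewrite expr2 [_ * expR `|x|]mulrC mulrA.
by rewrite ler_wpM2r// ler_pM// expR_ge0.
Qed.

Lemma expR_lipschitz (K x y : R) : x <= K -> y <= K ->
  `|expR x - expR y| <= expR K * `|x - y|.
Proof.
move=> xK yK; apply: (mean_value_le (@is_derive_expR R)) => c /andP[_ cm].
rewrite ger0_norm ?expR_ge0// ler_expR (le_trans cm)// ge_max yK xK//.
Qed.

End LeftQuotient.

Section QuadraticFormTail.
Context d (T : measurableType d) (R : realType) (P : probability T R) (n : nat).
Variables (Y : 'I_n -> T -> R) (C : 'I_n -> 'I_n -> R).
Hypothesis G : gaussian_vector P Y C.
Local Notation Q := (sqnorm Y).
Local Notation dom := (dominated Y).
Local Notation V := (covquad Y C).
Local Notation tr := (covtrace C).
Local Notation F := (fun w => Q w - tr).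

Let dom_int m X : (m <= 2)%N -> dom m X -> P.-integrable setT (EFin \o X).
Proof. exact: (dominated_integrable G). Qed.

Lemma Rintegral_indic (A : set T) : measurable A -> \int[P]_w \1_A w = fine (P A).
Proof. by move=> mA; rewrite /Rintegral integral_indic// setIT. Qed.

(** Exponential moments of [Q] are not known to exist in advance; truncation at
[K] keeps every function bounded, and the estimates do not depend on [K]. *)
Definition trunc_exp (K u q : R) := expR (u * Num.min (q - tr) K).
Definition trunc_exp' (K u q : R) := if q - tr <= K then u * expR (u * (q - tr)) else 0.

Lemma ibp_pair_trunc_exp (K u : R) : 0 <= u ->
  ibp_pair P Y C (trunc_exp K u) (trunc_exp' K u).
Proof.
move=> u0; have L0 : 0 <= expR (u * K) * u by rewrite mulr_ge0// expR_ge0.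
apply: (ibp_pair_lipschitz G L0) => [x y|x].
  apply: (le_trans (@expR_lipschitz _ (u * K) _ _ _ _)).
  - by rewrite ler_wpM2l// ge_min lexx orbT.
  - by rewrite ler_wpM2l// ge_min lexx orbT.
  rewrite -mulrA ler_wpM2l ?expR_ge0// -mulrBr normrM (ger0_norm u0) ler_wpM2l//.
  apply: (le_trans (min_dist_le _ _ _)).
  by rewrite opprB addrA subrK.
rewrite /trunc_exp'; case: (leP (x - tr) K) => xK.
  have D : is_derive (x : R) (1 : R) (fun q => expR (u * (q - tr))) (u * expR (u * (x - tr))).
    have D1 := is_derive_scale u (is_derive_sub (is_derive_idfun x) (is_derive_cstfun tr x)).
    by apply: (is_derive_eq (is_derive_expRf D1)); ring.
  have E : (fun N => N.+1%:R * (trunc_exp K u x - trunc_exp K u (x - N.+1%:R^-1))) =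
      (fun N => N.+1%:R * (expR (u * (x - tr)) - expR (u * (x - N.+1%:R^-1 - tr)))).
    apply/funext => N; rewrite /trunc_exp !min_l//.
    by apply: le_trans xK; rewrite lerD2r gerBl invr_ge0.
  rewrite E; exact: left_quotient_cvg D.
apply: cvg_eventually; near=> N.
have n0 : (0 : R) < N.+1%:R by rewrite ltr0n.
have h : N.+1%:R^-1 < x - tr - K.
  rewrite invf_plt ?posrE ?subr_gt0//.
  apply: (@lt_le_trans _ _ N%:R); last by rewrite ler_nat.
  by near: N; exact: nbhs_infty_gtr.
rewrite /trunc_exp !min_r ?subrr ?mulr0//; last exact: ltW.
by move: h; move: (N.+1%:R^-1) => v h; lra.
Unshelve. all: by end_near. Qed.

Let meas_trunc (K : R) : measurable_fun setT (fun w => Num.min (F w) K).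
Proof.
apply: measurable_minr => //; apply: measurable_funB => //; exact: measurable_sqnorm G.
Qed.

Let trunc_bound (K : R) w : `|Num.min (F w) K| <= `|tr| + `|K|.
Proof.
have h1 := ler_norm tr; have h2 := ler_norm (- K); have h3 := ler_norm K.
have h4 := sqnorm_ge0 Y w; have h5 := normr_ge0 tr; have h6 := normr_ge0 K.
rewrite normrN in h2; rewrite ler_norml /Num.min.
by case: ltP => h; apply/andP; split; lra.
Qed.

(** Let [M u] be the mean of [trunc_exp K u] and [N] the mean of its product with
[V]. Stein's identity gives [M' <= 2 * u * N]. The same identity for [V], with
[C * C <= lam * C], gives [N <= M / 2 + 2 * u * lam * N], hence [N <= M] as soon
as [4 * u * lam <= 1]. It remains to integrate [M' <= 2 * u * M]. *)
Lemma trunc_exp_mean_le (lam s K : R) : hs2 C = 2^-1 -> 0 <= lam ->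
  hs4 C <= lam ^+ 4 -> 0 <= s -> 4 * s * lam <= 1 ->
  \int[P]_w trunc_exp K s (Q w) <= expR (s ^+ 2).
Proof.
move=> hs lam0 hl s0 sl.
pose Z w := Num.min (F w) K; pose B := `|tr| + `|K|.
have B0 : 0 <= B by rewrite addr_ge0.
pose M u := \int[P]_w expR (u * Z w); pose M' u := \int[P]_w (Z w * expR (u * Z w)).
have mZ : measurable_fun setT Z by exact: meas_trunc.
have ZB w : `|Z w| <= B by exact: trunc_bound.
have me u : measurable_fun setT (fun w => expR (u * Z w)).
  by apply: measurable_expR; exact: measurable_funM.
have eB u w : expR (u * Z w) <= expR (`|u| * B).
  by rewrite ler_expR (le_trans (ler_norm _))// normrM ler_wpM2l.
have de u : dom 0 (fun w => expR (u * Z w)).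
  apply: (@dominated_bounded _ _ _ _ _ _ (expR (`|u| * B))) => // w.
  by rewrite ger0_norm ?expR_ge0.
have dZ : dom 0 Z by exact: dominated_bounded ZB.
have ie u := dom_int (m := 0) isT (de u).
have iZe u := dom_int (m := 0) isT (dominatedM dZ (de u)).
have DM (u : R) : is_derive (u : R) (1 : R) M (M' u).
  apply: (@quadratic_is_derive _ _ _ _ (expR (`|u| * B) * (B ^+ 2 * expR B))) => h h1.
  rewrite /M /M' -RintegralB// -RintegralZl// -RintegralB//; last 2 first.
  - exact: integrable_sub.
  - exact: integrable_scale.
  have ii := integrable_sub (integrable_sub (ie (u + h)) (ie u)) (integrable_scale h (iZe u)).
  apply: (le_trans (le_normr_Rintegral measurableT ii)).
  rewrite -[leRHS](Rintegral_prob_cst P).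
  apply: le_Rintegral => //; first exact: integrable_norm.
    exact: finite_measure_integrable_cst.
  move=> w _; have -> : expR ((u + h) * Z w) - expR (u * Z w) - h * (Z w * expR (u * Z w))
      = expR (u * Z w) * (expR (h * Z w) - 1 - h * Z w).
    by rewrite mulrDl expRD; ring.
  rewrite normrM (ger0_norm (expR_ge0 _)) -mulrA ler_pM ?expR_ge0//.
  apply: (le_trans (expR_quadratic _)).
  have hZ : `|h * Z w| <= `|h| * B by rewrite normrM ler_wpM2l.
  have e1 : expR `|h * Z w| <= expR B.
    by rewrite ler_expR (le_trans hZ)// ler_piMl.
  rewrite -[(h * Z w) ^+ 2]real_normK ?num_real// -[h ^+ 2]real_normK ?num_real//.
  rewrite [leRHS](_ : _ = (`|h| * B) ^+ 2 * expR B); last by ring.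
  by rewrite ler_pM ?expR_ge0 ?sqr_ge0// ler_pXn2r ?nnegrE// mulr_ge0.
have ineq u : 0 <= u <= s -> M' u <= 2 * u * M u.
  move=> /andP[u0 us].
  have ib := ibp_pair_trunc_exp K u0.
  have H1 := quadratic_stein G ib; have H2 := covquad_stein G ib.
  have E w : trunc_exp K u (Q w) = expR (u * Z w) by [].
  have g0 w : 0 <= trunc_exp' K u (Q w).
    by rewrite /trunc_exp'; case: ifP => // _; rewrite mulr_ge0// expR_ge0.
  have gle w : trunc_exp' K u (Q w) <= u * expR (u * Z w).
    rewrite /trunc_exp' /Z; case: (leP (Q w - tr) K) => h //.
    by rewrite mulr_ge0// expR_ge0.
  have dg : dom 0 (fun w => trunc_exp' K u (Q w)).
    have [_ mg _ _] := ib.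
    apply: (@dominated_bounded _ _ _ _ _ _ (u * expR (`|u| * B))).
      by apply: measurableT_comp => //; exact: measurable_sqnorm G.
    by move=> w; rewrite ger0_norm// (le_trans (gle w))// ler_wpM2l.
  have dV := dominated_covquad G; have dV2 := dominated_covquad2 G.
  pose N := \int[P]_w (V w * expR (u * Z w)).
  have iN := dom_int (m := 1) isT (dominatedM dV (de u)).
  have iF := dom_int (m := 1) isT (dominatedM (dominated_quadratic G) (de u)).
  have igV := dom_int (m := 1) isT (dominatedM dg dV).
  have igV2 := dom_int (m := 1) isT (dominatedM dg dV2).
  have N0 : 0 <= N.
    by apply: Rintegral_ge0 => w _; rewrite mulr_ge0 ?expR_ge0// (covquad_ge0 G).
  have A1 : M' u <= 2 * u * N.
    apply: (@le_trans _ _ (\int[P]_w (F w * expR (u * Z w)))).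
      apply: le_Rintegral => // w _; rewrite ler_wpM2r ?expR_ge0//.
      by rewrite /Z ge_min lexx.
    have -> : \int[P]_w (F w * expR (u * Z w)) =
        \int[P]_w (2 * (trunc_exp' K u (Q w) * V w)).
      apply/eqP; rewrite -subr_eq0 -RintegralB//; last exact: integrable_scale.
      by rewrite -[X in _ == X]H1.
    rewrite /N -RintegralZl//; apply: le_Rintegral => //.
    - exact: integrable_scale.
    - exact: integrable_scale.
    move=> w _; rewrite -mulrA ler_wpM2l// [V w * _]mulrC mulrA ler_wpM2r//.
    exact: (covquad_ge0 G).
  have A2 : N - 2^-1 * M u <= 2 * u * lam * N.
    have -> : N - 2^-1 * M u = \int[P]_w (2 * (trunc_exp' K u (Q w) * covquad2 Y C w)).
      rewrite /N /M -RintegralZl// -RintegralB//; last exact: integrable_scale.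
      apply/eqP; rewrite -subr_eq0 -RintegralB//; last 2 first.
      - by apply: integrable_sub => //; exact: integrable_scale.
      - exact: integrable_scale.
      rewrite -[X in _ == X]H2; apply/eqP; apply: eq_Rintegral => w _.
      by rewrite hs -E mulrBl.
    rewrite /N -RintegralZl//; apply: le_Rintegral => //.
    - exact: integrable_scale.
    - exact: integrable_scale.
    move=> w _; rewrite -!mulrA ler_wpM2l//.
    have V20 : 0 <= covquad2 Y C w by exact: dot_ge0.
    have V2V : covquad2 Y C w <= lam * V w.
      exact: (covmul_sqr_le (cov_sym G) (covform_ge0 G)).
    apply: (le_trans (ler_pM (g0 w) V20 (gle w) V2V)).
    by rewrite le_eqVlt; apply/orP; left; apply/eqP; ring.
  have M0 : 0 <= M u by apply: Rintegral_ge0 => w _; exact: expR_ge0.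
  have ul : 4 * u * lam <= 1.
    by apply: le_trans sl; rewrite ler_wpM2r// ler_wpM2l.
  have NM : N <= M u by nra.
  by apply: (le_trans A1); rewrite ler_wpM2l// mulr_ge0.
pose D u := - (M u * expR (- u ^+ 2)).
have DD (u : R) : is_derive (u : R) (1 : R) D ((2 * u * M u - M' u) * expR (- u ^+ 2)).
  have D1 := is_derive_expRf (is_derive_opp (is_derive_expn 1 (is_derive_idfun u))).
  by apply: (is_derive_eq (is_derive_opp (is_derive_mul (DM u) D1))); ring.
have : D 0 <= D s.
  apply: (is_derive_nondecreasing DD) => // u us.
  by rewrite mulr_ge0 ?expR_ge0// subr_ge0 ineq.
rewrite /D expr0n oppr0 expR0 mulr1 lerN2.
have -> : M 0 = 1.
  rewrite /M; under eq_Rintegral do rewrite mul0r expR0.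
  exact: Rintegral_prob_cst.
by rewrite expRN ler_pdivrMr ?expR_gt0// mul1r.
Qed.

(** Chernoff's bound, for the truncation at the level [y] itself. *)
Lemma quadratic_tail (lam s y : R) : hs2 C = 2^-1 -> 0 <= lam ->
  hs4 C <= lam ^+ 4 -> 0 <= s -> 4 * s * lam <= 1 ->
  fine (P [set w | y < F w]) <= expR (s ^+ 2 - s * y).
Proof.
move=> hs lam0 hl s0 sl.
have mF : measurable_fun setT F by exact: dominated_measurable (dominated_quadratic G).
have mA : measurable [set w | y < F w].
  rewrite (_ : [set w | y < F w] = F @^-1` `]y, +oo[%classic).
    by rewrite -[X in measurable X]setTI; apply: mF.
  by apply/seteqP; split => w /=; rewrite in_itv/= andbT.
rewrite -Rintegral_indic// expRD mulrC.
have ie : P.-integrable setT (EFin \o (fun w => trunc_exp y s (Q w))).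
  have [m1 _ [K K0 b] _] := ibp_pair_trunc_exp y s0.
  apply: (dom_int (m := 1)) => //; apply: (@dominated_comp_linear _ _ _ _ _ _ _ G _ K) => //.
  by move=> q /b[].
apply: (@le_trans _ _ (\int[P]_w (expR (- (s * y)) * trunc_exp y s (Q w)))).
  apply: le_Rintegral => //; [exact: integrable_indic|exact: integrable_scale|].
  move=> w _; rewrite indicE; case: (boolP (w \in _)) => h.
    rewrite inE/= in h; rewrite /trunc_exp min_r ?(ltW h)//.
    by rewrite -expRD addrC subrr expR0.
  by rewrite mulr_ge0// expR_ge0.
rewrite RintegralZl// ler_wpM2l ?expR_ge0//.
exact: (@trunc_exp_mean_le lam).
Qed.

End QuadraticFormTail.

(** * The standard normal distribution function *)

Section NormalCdf.
Context (R : realType).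
Implicit Types (x w z : R).
Local Notation mu := (@lebesgue_measure R).
Local Notation phi := (normal_pdf (0 : R) 1).
Local Notation Phi := (@std_normal_cdf R).

Lemma normal_pdf1E x : phi x = normal_peak 1 * expR (- (x ^+ 2 / 2)).
Proof.
by rewrite normal_pdf_gt0E// expr1n; congr (_ * expR _); rewrite mulNr.
Qed.

Lemma normal_peak1_gt0 : 0 < normal_peak (1 : R).
Proof. by apply: normal_peak_gt0; rewrite oner_eq0. Qed.

Lemma normal_pdf1_gt0 x : 0 < phi x.
Proof. by rewrite normal_pdf1E mulr_gt0 ?expR_gt0 ?normal_peak1_gt0. Qed.

Lemma normal_pdf1_le x : phi x <= expR (- (x ^+ 2 / 2)).
Proof.
rewrite normal_pdf1E ler_piMl ?expR_ge0//.
rewrite /normal_peak invf_le1; last first.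
  by rewrite sqrtr_gt0 expr1n mul1r mulrn_wgt0// pi_gt0.
rewrite -[leLHS]sqrtr1 ler_sqrt expr1n mul1r; last first.
  by rewrite mulrn_wge0// pi_ge0.
by have := pi_ge2 R; rewrite mulr2n; lra.
Qed.

Lemma is_derive_normal_pdf1 x : is_derive (x : R) (1 : R) phi (- x * phi x).
Proof.
have E : (phi : R -> R) = fun y => normal_peak 1 * expR (- 2^-1 * y ^+ 2).
  by apply/funext => y; rewrite normal_pdf1E; congr (_ * expR _); lra.
rewrite E; have D := is_derive_expRf (is_derive_scale (- 2^-1) (is_derive_expn 1 (is_derive_idfun x))).
by apply: (is_derive_eq (is_derive_scale (normal_peak 1) D)); field.
Qed.

Lemma std_normal_cdfE z : Phi z = \int[mu]_(t in `]-oo, z]) phi t.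
Proof. by []. Qed.

Lemma is_derive_std_normal_cdf z : is_derive (z : R) (1 : R) Phi (phi z).
Proof.
have cp : continuous (phi : R -> R) by exact: continuous_normal_pdf.
have [||||d1 d2] := @continuous_FTC1 R phi -oo%O z (z + 1).
- by rewrite ltrDl.
- apply: (integrableS _ _ (@subsetT _ _)) => //; exact: integrable_normal_pdf.
- by rewrite ltNyr.
- exact: cp.
by apply: DeriveDef; [exact: d1|rewrite -derive1E; exact: d2].
Qed.

Lemma std_normal_cdf_ge0 z : 0 <= Phi z.
Proof. by rewrite fine_ge0. Qed.

Lemma std_normal_cdf_le z w : z <= w -> Phi z <= Phi w.
Proof.
move=> zw; apply: (is_derive_nondecreasing is_derive_std_normal_cdf) => // x _.
exact/ltW/normal_pdf1_gt0.
Qed.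

(** On [x <= - N] one has [N * phi x <= `|x| * phi x], an integrable bound. *)
Lemma cvg_mul_std_normal_cdfN :
  N%:R * Phi (- N%:R) @[N --> \oo] --> (0 : R).
Proof.
have iphi : mu.-integrable setT (EFin \o phi) by exact: integrable_normal_pdf.
have mphi : measurable_fun setT (phi : R -> R) by exact: measurable_normal_pdf.
have ix : mu.-integrable setT (EFin \o (fun x => `|x * phi x|)).
  apply: integrable_norm; apply: (@normal_poly_integrable _ _ _ 1) => //.
  by move=> x; rewrite mul1r -[X in `|X|]expr1 norm_expr_le.
have E N : N%:R * Phi (- N%:R) =
    \int[mu]_x ((fun x => N%:R * phi x) \_ (`]-oo, (- N%:R)]%classic)) x.
  rewrite -Rintegral_mkcond RintegralZl//.
  exact: (integrableS _ _ (@subsetT _ _)).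
have Z : \int[mu]_x (cst (0 : R) x) = 0 by rewrite /Rintegral integral0.
suff H : \int[mu]_x ((fun x => N%:R * phi x) \_ (`]-oo, (- N%:R)]%classic)) x
    @[N --> \oo] --> \int[mu]_x (cst (0 : R) x).
  by rewrite Z in H; under eq_fun do rewrite E.
have mI N : measurable (`]-oo, (- N%:R)]%classic : set R) by exact: measurable_itv.
apply: (@Rintegral_cvg _ _ _ mu _ _ (fun x => `|x * phi x|)) => //.
- move=> N; apply/(measurable_restrictT _ (mI N)); apply: measurable_funTS.
  by apply: measurable_funM.
- move=> x; apply: cvg_eventually; near=> N.
  rewrite /patch; case: (boolP (x \in _)) => // xN; exfalso.
  move: xN; rewrite inE/= in_itv/= => xN.
  have : `|x| < N%:R by near: N; exact: nbhs_infty_gtr.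
  rewrite ltr_norml => /andP[+ _]; rewrite ltNge => /negP; apply.
  exact: xN.
- move=> N x; rewrite /patch; case: (boolP (x \in _)) => xN; last by rewrite normr0.
  rewrite !normrM ler_wpM2r//.
  move: xN; rewrite inE/= in_itv/= => xN.
  by rewrite normr_nat -[`|x|]normrN (le_trans _ (ler_norm _))// lerNr.
Unshelve. all: by end_near. Qed.

(** The function has the nonnegative derivative [Phi], and its limit at minus
infinity is nonnegative. *)
Lemma std_normal_cdf_mills w : 0 <= phi w + w * Phi w.
Proof.
have D x : is_derive (x : R) (1 : R) (fun x => phi x + x * Phi x) (Phi x).
  apply: (is_derive_eq (is_derive_add (is_derive_normal_pdf1 x)
    (is_derive_mul (is_derive_idfun x) (is_derive_std_normal_cdf x)))); ring.
rewrite leNgt; apply/negP => kw.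
have e0 : 0 < - (phi w + w * Phi w) by rewrite oppr_gt0.
have /cvgrPdist_lt/(_ _ e0)[N0 _ H] := cvg_mul_std_normal_cdfN.
pose N := maxn N0 (Num.truncn (`|w|)).+1.
have := H N (leq_maxl _ _); rewrite sub0r normrN.
rewrite ger0_norm ?mulr_ge0 ?std_normal_cdf_ge0//.
rewrite ltNge => /negP; apply; rewrite lerNl.
have wN : - N%:R <= w.
  rewrite lerNl; apply: (le_trans (ler_norm _)); rewrite normrN.
  apply: (@le_trans _ _ (Num.truncn `|w|).+1%:R); first exact/ltW/truncnS_gt.
  by rewrite ler_nat leq_maxr.
have := is_derive_nondecreasing D (fun x _ => std_normal_cdf_ge0 x) wN.
by apply: le_trans; rewrite mulNr lerDr ltW// normal_pdf1_gt0.
Qed.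

(** The sum [Phi x + Phi (- x)] has zero derivative and tends to [1]. *)
Lemma std_normal_cdf_sym z : Phi (- z) = 1 - Phi z.
Proof.
have D x : is_derive (x : R) (1 : R) (fun x => Phi x + Phi (- x)) 0.
  have D1 := @is_derive_compf R Phi (fun y => - y) x _ _ (is_derive_std_normal_cdf (- x))
    (is_derive_opp (is_derive_idfun x)).
  apply: (is_derive_eq (is_derive_add (is_derive_std_normal_cdf x) D1)).
  by rewrite !normal_pdf1E sqrrN; ring.
suff : Phi 0 + Phi (- 0) = 1 by rewrite (is_derive_eq0_cst 0 z D); lra.
have cN : Phi (- N.+1%:R) @[N --> \oo] --> (0 : R).
  have := cvg_mul_std_normal_cdfN; rewrite -(cvg_shiftS (fun N => N%:R * Phi (- N%:R))).
  move=> h; apply: (squeeze_cvgr _ (cvg_cst 0) h).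
  apply: nearW => N; rewrite std_normal_cdf_ge0/= ler_peMl ?std_normal_cdf_ge0//.
  by rewrite ler1n.
have iphi : mu.-integrable setT (EFin \o phi) by exact: integrable_normal_pdf.
have mphi : measurable_fun setT (phi : R -> R) by exact: measurable_normal_pdf.
have cP : Phi N.+1%:R @[N --> \oo] --> (1 : R).
  have Z : \int[mu]_x phi x = 1 by rewrite /Rintegral integral_normal_pdf.
  suff H : \int[mu]_x (phi \_ (`]-oo, N.+1%:R]%classic)) x
      @[N --> \oo] --> \int[mu]_x phi x.
    by rewrite Z in H; under eq_fun do rewrite std_normal_cdfE Rintegral_mkcond.
  have mI N : measurable (`]-oo, N.+1%:R]%classic : set R) by exact: measurable_itv.
  apply: (@Rintegral_cvg _ _ _ mu _ _ phi) => //.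
  - move=> N; apply/(measurable_restrictT _ (mI N)); exact: measurable_funTS.
  - move=> x; apply: cvg_eventually; near=> N.
    rewrite /patch ifT// inE/= in_itv/=.
    apply: (@le_trans _ _ N%:R); last by rewrite ler_nat.
    by near: N; exact: nbhs_infty_ger.
  - move=> N x; rewrite /patch; case: ifP => _; rewrite ?normr0 ?normal_pdf_ge0//.
    by rewrite ger0_norm ?normal_pdf_ge0.
have h : Phi N.+1%:R + Phi (- N.+1%:R) @[N --> \oo] --> (1 + 0 : R) by exact: cvgD.
rewrite addr0 in h.
have h2 : (fun N => Phi N.+1%:R + Phi (- N.+1%:R)) = fun=> Phi 0 + Phi (- 0).
  by apply/funext => N; rewrite (is_derive_eq0_cst _ 0 D).
rewrite h2 in h.
exact: (cvg_unique _ (cvg_cst (Phi 0 + Phi (- 0))) h).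
Unshelve. all: by end_near. Qed.

Lemma std_normal_cdf_le1 z : Phi z <= 1.
Proof. by rewrite -subr_ge0 -std_normal_cdf_sym std_normal_cdf_ge0. Qed.

Lemma std_normal_tail_mills z : z * (1 - Phi z) <= phi z.
Proof.
have := std_normal_cdf_mills (- z); rewrite std_normal_cdf_sym !normal_pdf1E sqrrN; lra.
Qed.

Lemma std_normal_tail_le z : 0 <= z -> 1 - Phi z <= 2 * expR (- (z ^+ 2 / 4)).
Proof.
move=> z0; have p0 : 0 <= 1 - Phi z by rewrite subr_ge0 std_normal_cdf_le1.
have e0 := expR_gt0 (- (z ^+ 2 / 4)).
have [z1|z1] := leP 1 z.
  apply: (@le_trans _ _ (z * (1 - Phi z))); first by rewrite ler_peMl.
  apply: (le_trans (std_normal_tail_mills z)); apply: (le_trans (normal_pdf1_le z)).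
  apply: (@le_trans _ _ (expR (- (z ^+ 2 / 4)))); last by lra.
  by rewrite ler_expR; have := sqr_ge0 z; lra.
have := std_normal_cdf_ge0 z.
have : 1 - z ^+ 2 / 4 <= expR (- (z ^+ 2 / 4)) by exact: expR_ge1Dx.
have : z ^+ 2 <= 1 by rewrite exprn_ile1// ltW.
by move=> *; lra.
Qed.

End NormalCdf.

(** * The solution of Stein's equation *)

Section SteinSolution.
Context (R : realType) (z : R).
Implicit Types (x w : R).
Local Notation phi := (normal_pdf (0 : R) 1).
Local Notation Phi := (@std_normal_cdf R).

Definition stein_left w := Phi w * (1 - Phi z) / phi w.
Definition stein_right w := Phi z * (1 - Phi w) / phi w.
Definition stein_left' w := (1 - Phi z) * (1 + w * Phi w / phi w).
Definition stein_right' w := Phi z * (- 1 + w * (1 - Phi w) / phi w).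

(** The bounded solution of [g w - w * f w = (w <= z) - Phi z] with [g] the
left derivative of [f]. *)
Definition stein_sol w := if w <= z then stein_left w else stein_right w.
Definition stein_sol' w := if w <= z then stein_left' w else stein_right' w.

Let phi0 w : 0 < phi w. Proof. exact: normal_pdf1_gt0. Qed.
Let Psi_ge0 w : 0 <= 1 - Phi w. Proof. by rewrite subr_ge0 std_normal_cdf_le1. Qed.

Lemma stein_equation w : stein_sol' w - w * stein_sol w = (w <= z)%R%:R - Phi z.
Proof.
have p0 : phi w != 0 by rewrite gt_eqF.
rewrite /stein_sol' /stein_sol; case: leP => _; rewrite /= ?mulr1n ?mulr0n.
  by rewrite /stein_left' /stein_left; field.
by rewrite /stein_right' /stein_right; field.
Qed.

Lemma is_derive_inv_normal_pdf1 w :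
  is_derive (w : R) (1 : R) (fun x => (phi x)^-1) (w / phi w).
Proof.
have p0 : normal_peak (1 : R) != 0 by rewrite gt_eqF// normal_peak1_gt0.
have -> : (fun x => (phi x)^-1) = fun x => (normal_peak 1)^-1 * expR (2^-1 * x ^+ 2).
  apply/funext => x; rewrite normal_pdf1E invfM -expRN opprK; congr (_ * expR _); lra.
have D := is_derive_expRf (is_derive_scale 2^-1 (is_derive_expn 1 (is_derive_idfun w))).
apply: (is_derive_eq (is_derive_scale (normal_peak 1)^-1 D)).
rewrite normal_pdf1E invfM -expRN opprK.
have -> : w ^+ 2 / 2 = 2^-1 * w ^+ 2 by lra.
by field.
Qed.

Lemma is_derive_stein_left w : is_derive (w : R) (1 : R) stein_left (stein_left' w).
Proof.
have p0 : phi w != 0 by rewrite gt_eqF.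
have D := is_derive_mul (is_derive_mul (is_derive_std_normal_cdf w)
  (is_derive_cstfun (1 - Phi z) w)) (is_derive_inv_normal_pdf1 w).
by apply: (is_derive_eq D); rewrite /stein_left'; field.
Qed.

Lemma is_derive_stein_right w : is_derive (w : R) (1 : R) stein_right (stein_right' w).
Proof.
have p0 : phi w != 0 by rewrite gt_eqF.
have D := is_derive_mul (is_derive_mul (is_derive_cstfun (Phi z) w)
  (is_derive_sub (is_derive_cstfun 1 w) (is_derive_std_normal_cdf w)))
  (is_derive_inv_normal_pdf1 w).
by apply: (is_derive_eq D); rewrite /stein_right'; field.
Qed.

Lemma stein_left'_bound w : w <= z -> 0 <= stein_left' w <= 2.
Proof.
move=> wz; have m1 := std_normal_cdf_mills w; have m2 := std_normal_tail_mills w.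
have Pw0 := std_normal_cdf_ge0 w; have Pw1 := std_normal_cdf_le1 w.
have Pz0 := Psi_ge0 z; have Pz1 := std_normal_cdf_ge0 z; have wzP := std_normal_cdf_le wz.
have p0 := phi0 w.
have -> : stein_left' w = (1 - Phi z) * (phi w + w * Phi w) / phi w.
  by rewrite /stein_left'; field; rewrite gt_eqF.
apply/andP; split; first by rewrite divr_ge0 ?mulr_ge0// ltW.
rewrite ler_pdivrMr//.
have [w0|w0] := leP w 0; first by nra.
apply: (@le_trans _ _ ((1 - Phi w) * (phi w + w * Phi w))).
  by rewrite ler_wpM2r// lerD2l lerN2.
by nra.
Qed.

Lemma stein_right'_bound w : z <= w -> - 2 <= stein_right' w <= 0.
Proof.
move=> wz; have m1 := std_normal_cdf_mills w; have m2 := std_normal_tail_mills w.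
have Pw0 := std_normal_cdf_ge0 w; have Pw1 := std_normal_cdf_le1 w.
have Pz0 := Psi_ge0 z; have Pz1 := std_normal_cdf_ge0 z; have wzP := std_normal_cdf_le wz.
have p0 := phi0 w.
have -> : stein_right' w = - (Phi z * (phi w - w * (1 - Phi w)) / phi w).
  by rewrite /stein_right'; field; rewrite gt_eqF.
have h : 0 <= phi w - w * (1 - Phi w) by rewrite subr_ge0.
apply/andP; split; last by rewrite oppr_le0 divr_ge0 ?mulr_ge0// ltW.
rewrite lerN2 ler_pdivrMr//.
apply: (@le_trans _ _ (Phi w * (phi w - w * (1 - Phi w)))); first by rewrite ler_wpM2r.
by have [w0|w0] := leP w 0; nra.
Qed.

Lemma stein_sol'_bound w : `|stein_sol' w| <= 2.
Proof.
rewrite /stein_sol' ler_norml; case: (leP w z) => h.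
  by have /andP[h1 h2] := stein_left'_bound h; apply/andP; split; lra.
by have /andP[h1 h2] := stein_right'_bound (ltW h); apply/andP; split; lra.
Qed.

(** For [0 <= w <= z / 2] the ratio [phi z / phi w] is at most
[expR (- 3 * z ^ 2 / 8)]; negative [w] contribute with the favourable sign. *)
Lemma stein_sol'_left_bound w : 0 <= z -> w <= z / 2 ->
  `|stein_sol' w| <= 3 * expR (- (z ^+ 2 / 4)).
Proof.
move=> z0 wz2; have wz : w <= z by lra.
rewrite /stein_sol' wz; have /andP[h0 _] := stein_left'_bound wz.
rewrite ger0_norm// /stein_left' mulrDr mulr1.
have t := std_normal_tail_le z0; have e0 := expR_gt0 (- (z ^+ 2 / 4)).
have p0 := phi0 w; have Pz0 := Psi_ge0 z.
have Pw0 := std_normal_cdf_ge0 w; have Pw1 := std_normal_cdf_le1 w.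
suff : (1 - Phi z) * (w * Phi w / phi w) <= expR (- (z ^+ 2 / 4)) by lra.
have [w0|w0] := leP w 0.
  apply: (@le_trans _ _ 0); last exact: ltW.
  by rewrite mulr_ge0_le0// pmulr_lle0 ?invr_gt0// mulr_le0_ge0.
have -> : (1 - Phi z) * (w * Phi w / phi w) = (1 - Phi z) * (w * Phi w) / phi w.
  by rewrite mulrA.
apply: (@le_trans _ _ (phi z / phi w)).
  rewrite ler_pM2r ?invr_gt0//; apply: le_trans (std_normal_tail_mills z).
  by rewrite [z * _]mulrC ler_wpM2l//; nra.
rewrite !normal_pdf1E -mulf_div divff ?gt_eqF ?normal_peak1_gt0// mul1r.
rewrite -expRB ler_expR.
have : w ^+ 2 <= (z / 2) ^+ 2 by rewrite ler_pXn2r ?nnegrE ?divr_ge0// ltW.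
by have := sqr_ge0 z; lra.
Qed.

Lemma stein_leftE_right : stein_left z = stein_right z.
Proof. by []. Qed.

Lemma stein_sol_lipschitz x w : `|stein_sol x - stein_sol w| <= 2 * `|x - w|.
Proof.
wlog xw : x w / x <= w.
  move=> H; have [|/ltW] := leP x w; first exact: H.
  by move=> /H; rewrite distrC [`|w - x|]distrC.
have L a b : a <= b -> b <= z -> `|stein_left a - stein_left b| <= 2 * (b - a).
  move=> ab bz; have [c /andP[c1 c2] e] := mean_value_on ab (fun x _ => is_derive_stein_left x).
  rewrite distrC e normrM (ger0_norm (_ : 0 <= b - a)) ?subr_ge0//.
  rewrite ler_wpM2r ?subr_ge0//.
  have /andP[g0 g2] := stein_left'_bound (le_trans c2 bz).
  by rewrite ger0_norm.
have Rg a b : z <= a -> a <= b -> `|stein_right a - stein_right b| <= 2 * (b - a).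
  move=> za ab; have [c /andP[c1 c2] e] := mean_value_on ab (fun x _ => is_derive_stein_right x).
  rewrite distrC e normrM (ger0_norm (_ : 0 <= b - a)) ?subr_ge0//.
  rewrite ler_wpM2r ?subr_ge0//.
  have /andP[g0 g2] := stein_right'_bound (le_trans za c1).
  by rewrite ler0_norm// lerNl.
rewrite [`|x - w|]distrC (ger0_norm (_ : 0 <= w - x)) ?subr_ge0//.
rewrite /stein_sol; case: (leP x z) => xz; case: (leP w z) => wz.
- exact: L.
- rewrite -(subrK (stein_left z) (stein_left x)) -addrA.
  apply: (le_trans (ler_normD _ _)); rewrite stein_leftE_right.
  have := L _ _ xz (lexx z); have := Rg _ _ (lexx z) (ltW wz).
  by rewrite stein_leftE_right => h1 h2; lra.
- lra.
- exact: (Rg _ _ (ltW xz)).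
Qed.

Lemma stein_sol_left_derivative x :
  N.+1%:R * (stein_sol x - stein_sol (x - N.+1%:R^-1)) @[N --> \oo] --> stein_sol' x.
Proof.
rewrite /stein_sol'; case: (leP x z) => xz.
  have E : (fun N => N.+1%:R * (stein_sol x - stein_sol (x - N.+1%:R^-1))) =
      (fun N => N.+1%:R * (stein_left x - stein_left (x - N.+1%:R^-1))).
    apply/funext => N; rewrite /stein_sol xz ifT//.
    by apply: le_trans xz; rewrite gerBl invr_ge0.
  by rewrite E; exact: left_quotient_cvg (is_derive_stein_left x).
apply: cvg_trans (left_quotient_cvg (is_derive_stein_right x)).
apply: near_eq_cvg; near=> N.
have h : z < x - N.+1%:R^-1.
  rewrite ltrBrDr addrC -ltrBrDr invf_plt ?posrE ?subr_gt0 ?ltr0n//.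
  apply: (@lt_le_trans _ _ N%:R); last by rewrite ler_nat.
  by near: N; exact: nbhs_infty_gtr.
by rewrite /stein_sol !leNgt xz h.
Unshelve. all: by end_near. Qed.

End SteinSolution.

(** * A nonuniform Berry-Esseen bound for quadratic forms *)

Section QuadraticFormBerryEsseen.
Context d (T : measurableType d) (R : realType) (P : probability T R) (n : nat).
Variables (Y : 'I_n -> T -> R) (C : 'I_n -> 'I_n -> R).
Hypothesis G : gaussian_vector P Y C.
Local Notation Q := (sqnorm Y).
Local Notation dom := (dominated Y).
Local Notation V := (covquad Y C).
Local Notation tr := (covtrace C).
Local Notation F := (fun w => Q w - tr).

Let dom_int m X : (m <= 2)%N -> dom m X -> P.-integrable setT (EFin \o X).
Proof. exact: (dominated_integrable G). Qed.

Lemma dominated_cauchy_schwarz X Z : dom 1 X -> dom 1 Z ->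
  (\int[P]_w (X w * Z w)) ^+ 2 <= \int[P]_w (X w ^+ 2) * \int[P]_w (Z w ^+ 2).
Proof.
move=> dX dZ; have iXX := dom_int (m := 2) isT (dominatedM dX dX).
have iXZ := dom_int (m := 2) isT (dominatedM dX dZ).
have iZZ := dom_int (m := 2) isT (dominatedM dZ dZ).
apply: quadratic_discriminant => [|t]; first by apply: Rintegral_ge0 => w _; exact: sqr_ge0.
have i1 := integrable_scale (2 * t) iXZ; have i2 := integrable_scale (t ^+ 2) iZZ.
rewrite -(RintegralZl _ measurableT iXZ) -(RintegralZl _ measurableT iZZ).
rewrite -(RintegralD measurableT iXX i1).
rewrite -(RintegralD measurableT (integrable_add iXX i1) i2).
apply: Rintegral_ge0 => w _; rewrite [leRHS](_ : _ = (X w + t * Z w) ^+ 2) ?sqr_ge0//.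
ring.
Qed.

Lemma quadratic_measurable : measurable_fun setT F.
Proof. exact: dominated_measurable (dominated_quadratic G). Qed.

Let mset_le z : measurable [set w | F w <= z].
Proof.
rewrite (_ : [set w | F w <= z] = F @^-1` `]-oo, z]%classic).
  by rewrite -[X in measurable X]setTI; apply: quadratic_measurable.
by apply/seteqP; split => w /=; rewrite in_itv/=.
Qed.

Let mset_gt z : measurable [set w | z < F w].
Proof.
rewrite (_ : [set w | z < F w] = F @^-1` `]z, +oo[%classic).
  by rewrite -[X in measurable X]setTI; apply: quadratic_measurable.
by apply/seteqP; split => w /=; rewrite in_itv/= andbT.
Qed.

Hypothesis hs : hs2 C = 2^-1.

Lemma dominated_defect : dom 1 (fun w => 1 - 2 * V w).
Proof.
apply: dominatedB; first exact: dominated_cst.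
exact: dominatedZ (dominated_covquad G).
Qed.

Lemma defect_sqr_mean : \int[P]_w (`|1 - 2 * V w| ^+ 2) = 8 * hs4 C.
Proof.
have := covquad_variance G; have dV := dominated_covquad G.
have dVc : dom 1 (fun w => V w - hs2 C).
  by apply: dominatedB => //; exact: dominated_cst.
move=> e; transitivity (4 * \int[P]_w ((V w - hs2 C) ^+ 2)); last by rewrite e; ring.
rewrite -RintegralZl//; last exact: (dom_int (m := 2) isT (dominatedM dVc dVc)).
by apply: eq_Rintegral => w _; rewrite real_normK ?num_real// hs; field.
Qed.

Lemma dominated_norm_defect : dom 1 (fun w => `|1 - 2 * V w|).
Proof.
have [m [K K0 b]] := dominated_defect; split; first exact: measurableT_comp.
by exists K => // w; rewrite normr_id.
Qed.

Lemma dominated_indic (B : set T) : measurable B -> dom 0 (\1_B : T -> R).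
Proof.
move=> mB; apply: (@dominated_bounded _ _ _ _ _ _ 1).
  exact: measurable_indic.
by move=> w; rewrite indicE; case: (_ \in _); rewrite ?normr1 ?normr0.
Qed.

Lemma indic_defect_mean_le (B : set T) : measurable B ->
  \int[P]_w (\1_B w * `|1 - 2 * V w|) <=
    Num.sqrt (fine (P B)) * Num.sqrt (8 * hs4 C).
Proof.
move=> mB; have p0 : 0 <= fine (P B) by rewrite fine_ge0.
have h0 : 0 <= 8 * hs4 C by rewrite mulr_ge0// hs4_ge0.
apply: sqr_le_sqr; first by rewrite mulr_ge0 ?sqrtr_ge0.
apply: (le_trans (dominated_cauchy_schwarz
  (dominatedW (leqnSn 0) (dominated_indic mB)) dominated_norm_defect)).
rewrite defect_sqr_mean exprMn !sqr_sqrtr// ler_wpM2r//.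
rewrite -(Rintegral_indic P mB).
rewrite le_eqVlt; apply/orP; left; apply/eqP; apply: eq_Rintegral => w _.
by rewrite indicE; case: (_ \in _); rewrite ?expr1n ?expr0n.
Qed.

Lemma ibp_pair_stein (z : R) :
  ibp_pair P Y C (fun q => stein_sol z (q - tr)) (fun q => stein_sol' z (q - tr)).
Proof.
apply: (ibp_pair_lipschitz G (ler0n R 2)) => [x y|x].
  apply: (le_trans (stein_sol_lipschitz _ _ _)).
  by rewrite opprB addrA subrK.
have := @stein_sol_left_derivative R z (x - tr).
by under eq_fun do rewrite addrAC.
Qed.

Lemma dominated_stein (z : R) : dom 0 (fun w => stein_sol' z (F w)).
Proof.
have [_ mg _ _] := ibp_pair_stein z.
apply: (@dominated_bounded _ _ _ _ _ _ 2) => [|w]; last exact: stein_sol'_bound.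
exact: (measurableT_comp mg (measurable_sqnorm G)).
Qed.

(** Stein's equation at [F], integrated, and then [E[F f(F)] = E[2 V f'(F)]]: the
distance to the normal law is controlled by the fluctuations of [2 * V]. *)
Lemma quadratic_cdf_dist (z : R) (g := fun w => stein_sol' z (F w)) :
  `|fine (P [set w | F w <= z]) - std_normal_cdf z| <=
  \int[P]_w (`|g w| * `|1 - 2 * V w|).
Proof.
have ib := ibp_pair_stein z.
have H := quadratic_stein G ib.
have [mf mg [K K0 b] _] := ib.
have dg : dom 0 g := dominated_stein z.
have df : dom 1 (fun w => stein_sol z (F w)).
  by apply: (dominated_comp_linear G mf K0) => q /b[].
have dF := dominated_quadratic G; have dD := dominated_defect.
have dV := dominated_covquad G.
have iff_ := dom_int (m := 2) isT (dominatedM dF df).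
have igV := dom_int (m := 1) isT (dominatedM dg dV).
have ig := dom_int (m := 0) isT dg.
have igD := dom_int (m := 1) isT (dominatedM dg dD).
have i1 : P.-integrable setT (EFin \o (\1_[set w | F w <= z] : T -> R)).
  exact: integrable_indic.
have ic : P.-integrable setT (EFin \o (fun=> std_normal_cdf z)).
  exact: finite_measure_integrable_cst.
have -> : fine (P [set w | F w <= z]) - std_normal_cdf z =
    \int[P]_w (g w * (1 - 2 * V w)).
  rewrite -(Rintegral_indic P (mset_le z)) -{1}(Rintegral_prob_cst P (std_normal_cdf z)).
  rewrite -(RintegralB measurableT i1 ic).
  transitivity (\int[P]_w (g w * (1 - 2 * V w) -
      (F w * stein_sol z (F w) - 2 * (g w * V w)))).
    apply: eq_Rintegral => w _.
    have := stein_equation z (F w); rewrite indicE mem_setE /= -/(g w) => e.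
    rewrite [LHS](_ : _ = g w - F w * stein_sol z (F w)); last by rewrite e.
    by ring.
  rewrite RintegralB//; last by apply: integrable_sub => //; exact: integrable_scale.
  by rewrite H subr0.
apply: (le_trans (le_normr_Rintegral measurableT igD)).
by rewrite le_eqVlt; apply/orP; left; apply/eqP; apply: eq_Rintegral => w _; rewrite normrM.
Qed.

(** Chernoff's bound at the level [z / 2] with the exponent
[s = min (z / 4, 1 / (4 * lam))] and [lam = A `^ (1 / 2)]. The square root of the
probability halves the exponent, and [2 `^ (- 13 / 4) <= 1 / 4]. *)
Lemma quadratic_tail_half (A z : R) : 0 < A -> hs4 C <= A ^+ 2 -> 0 <= z ->
  Num.sqrt (fine (P [set w | z / 2 < F w])) <=
  expR (- (1 / 8) * Num.min (z ^+ 2 / 8) (2 `^ (- (13 / 4)) * A `^ (- (1 / 2)) * z)).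
Proof.
move=> A0 hA z0; pose lam := Num.sqrt A.
have lam0 : 0 < lam by rewrite sqrtr_gt0.
have lam4 : lam ^+ 4 = A ^+ 2 by rewrite (exprM _ 2 2) sqr_sqrtr// ltW.
have Al : A `^ (- (1 / 2)) = lam^-1.
  by rewrite powRN div1r powR12_sqrt// ltW.
have t4 : (2 : R) `^ (- (13 / 4)) <= 1 / 4.
  apply: (@le_trans _ _ ((2 : R) `^ (- 2))); first by rewrite ler_powR ?ler1n//; lra.
  by rewrite powRN powR_mulrn// div1r lef_pV2 ?posrE// expr2; lra.
pose s := Num.min (z / 4) (4 * lam)^-1.
have s0 : 0 <= s by rewrite le_min divr_ge0// invr_ge0 mulr_ge0// ltW.
have sl : 4 * s * lam <= 1.
  have : s <= (4 * lam)^-1 by rewrite ge_min lexx orbT.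
  rewrite -[(_)^-1]mul1r ler_pdivlMr ?mulr_gt0//; lra.
have hl : hs4 C <= lam ^+ 4 by rewrite lam4.
have tail := quadratic_tail G (z / 2) hs (ltW lam0) hl s0 sl.
have sz : s ^+ 2 - s * (z / 2) <= - (s * z / 4).
  have : s <= z / 4 by rewrite ge_min lexx.
  by move=> h; nra.
have e2 : expR (- (s * z / 4)) = expR (- (s * z / 8)) ^+ 2.
  by rewrite -expRM_natl; congr expR; lra.
apply: (@le_trans _ _ (expR (- (s * z / 8)))).
  rewrite -[leRHS]ger0_norm ?expR_ge0// -sqrtr_sqr -e2 ler_sqrt ?expR_ge0//.
  by apply: (le_trans tail); rewrite ler_expR.
rewrite ler_expR Al mulNr lerN2.
have il : 0 < lam^-1 by rewrite invr_gt0.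
set b := _ * z; have mina : Num.min (z ^+ 2 / 8) b <= z ^+ 2 / 8 by rewrite ge_min lexx.
have minb : Num.min (z ^+ 2 / 8) b <= b by rewrite ge_min lexx orbT.
rewrite /s; case: (leP (z / 4) (4 * lam)^-1) => h1.
  by have := sqr_ge0 z; lra.
apply: (@le_trans _ _ (1 / 8 * b)); first by rewrite ler_wpM2l.
have -> : (4 * lam)^-1 * z / 8 = 1 / 8 * (1 / 4 * lam^-1 * z).
  by field; rewrite gt_eqF.
rewrite ler_wpM2l// ler_wpM2r// ler_wpM2r// ltW//.
Qed.

(** The derivative of the Stein solution is of order [expR (- z ^ 2 / 4)] on
[F <= z / 2]; on the complement it is at most [2], and the Cauchy-Schwarz
inequality brings in the tail of [F]. For [z < 0] the first exponential on
the right is at least [1], and a uniform estimate suffices. *)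
Lemma quadratic_form_berry_esseen (A z : R) : 0 < A -> 72 * hs4 C <= A ^+ 2 ->
  `|fine (P [set w | F w <= z]) - std_normal_cdf z| <=
  (Num.sqrt 2 * expR (- (1 / 8) *
     Num.min (z ^+ 2 / 8) (2 `^ (- (13 / 4)) * A `^ (- (1 / 2)) * z))
   + expR (- (z ^+ 2 / 4))) * A.
Proof.
move=> A0 hA; have h4 := hs4_ge0 C.
pose k := Num.sqrt (8 * hs4 C); have k0 : 0 <= k by exact: sqrtr_ge0.
(* [k] is the L2 norm of [1 - 2 * V], and [72 = 3 ^ 2 * 8] *)
have kA : 3 * k <= A.
  apply: sqr_le_sqr; first exact: ltW.
  by rewrite exprMn sqr_sqrtr; [lra|rewrite mulr_ge0].
set E := expR (_ * Num.min _ _); set e := expR _.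
have E0 : 0 < E by exact: expR_gt0. have e0 : 0 < e by exact: expR_gt0.
have s2 : 1 <= Num.sqrt (2 : R) by rewrite -[leLHS]sqrtr1 ler_sqrt// ler1n.
apply: (le_trans (quadratic_cdf_dist z)).
have D1 := dominated_norm_defect.
have iD := dom_int (m := 1) isT D1.
have mT : measurable [set: T] by [].
have PT : fine (P [set: T]) = 1 by rewrite probability_setT.
have H1 := indic_defect_mean_le mT.
rewrite PT sqrtr1 mul1r -/k in H1.
have H1' : \int[P]_w `|1 - 2 * V w| <= k.
  apply: le_trans H1; rewrite le_eqVlt; apply/orP; left; apply/eqP.
  by apply: eq_Rintegral => w _; rewrite indicT mul1r.
have igD : P.-integrable setT (EFin \o (fun w => `|stein_sol' z (F w)| * `|1 - 2 * V w|)).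
  have := integrable_norm (dom_int (m := 1) isT (dominatedM (dominated_stein z) dominated_defect)).
  by congr (P.-integrable _ _); apply/funext => w /=; rewrite normrM.
have [z0|z0] := ltP z 0.
  apply: (@le_trans _ _ (2 * k)).
    apply: (@le_trans _ _ (\int[P]_w (2 * `|1 - 2 * V w|))); last first.
      by rewrite RintegralZl// ler_wpM2l.
    apply: le_Rintegral => //; first exact: integrable_scale.
    by move=> w _; rewrite ler_wpM2r// stein_sol'_bound.
  have E1 : 1 <= E.
    rewrite -[leLHS]expR0 ler_expR mulNr oppr_ge0 pmulr_rle0//.
    rewrite ge_min; apply/orP; right.
    by rewrite pmulr_rle0 ?(ltW z0)// mulr_gt0 ?powR_gt0.
  apply: (@le_trans _ _ A); first by lra.
  by rewrite ler_peMl ?(ltW A0)// (le_trans (mulr_ege1 s2 E1))// lerDl ltW.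
pose B := [set w | z / 2 < F w].
have mB : measurable B by exact: mset_gt.
have dB := dominatedM (dominated_indic mB) D1.
have iB := dom_int (m := 1) isT dB.
have H2 := indic_defect_mean_le mB; rewrite -/k in H2.
have hs4A : hs4 C <= A ^+ 2 by lra.
have tail := quadratic_tail_half A0 hs4A z0; rewrite -/E -/B in tail.
apply: (@le_trans _ _ (\int[P]_w (3 * e * `|1 - 2 * V w| + 2 * (\1_B w * `|1 - 2 * V w|)))).
  apply: le_Rintegral => //.
    by apply: integrable_add; exact: integrable_scale.
  move=> w _; rewrite mulrA -mulrDl ler_wpM2r// indicE.
  case: (boolP (w \in B)) => wB.
    by rewrite mulr1 ler_wpDl ?mulr_ge0 ?(ltW e0)// stein_sol'_bound.
  rewrite mulr0 addr0 stein_sol'_left_bound//.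
  by move: wB; rewrite notin_setE /B/= => /negP; rewrite -leNgt.
rewrite RintegralD//; [|exact: integrable_scale|exact: integrable_scale].
rewrite RintegralZl// RintegralZl//.
have kE : Num.sqrt (fine (P B)) * k <= E * k by rewrite ler_wpM2r.
have h1 : 3 * e * \int[P]_w `|1 - 2 * V w| <= e * A.
  rewrite [3 * e]mulrC -mulrA ler_wpM2l ?(ltW e0)//; lra.
have h2 : 2 * \int[P]_w (\1_B w * `|1 - 2 * V w|) <= 2 * (E * k) by lra.
have h3 : 2 * (E * k) <= Num.sqrt 2 * E * A.
  rewrite mulrCA [Num.sqrt 2 * E]mulrC -mulrA ler_wpM2l ?(ltW E0)//.
  by apply: (@le_trans _ _ A); [lra|rewrite ler_peMl// ltW].
by rewrite mulrDl; lra.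
Qed.

End QuadraticFormBerryEsseen.

(** * Sums over closed walks and power sums *)

Section CycleBound.
Context (R : realType) (n : nat).
Implicit Types (C m w : 'I_n -> 'I_n -> R).

Lemma path_sum_le w (W : R) : (forall i j, 0 <= w i j) ->
  (forall i, \sum_j w i j <= W) ->
  \sum_x \sum_y \sum_z \sum_t w x y * w y z * w z t <= n%:R * W ^+ 3.
Proof.
move=> w0 wW.
have -> : n%:R * W ^+ 3 = \sum_(x < n) W ^+ 3.
  by rewrite sumr_const card_ord mulr_natl.
apply: ler_sum => x _.
have W0 : 0 <= W by apply: le_trans (wW x); apply: sumr_ge0.
have h1 y z : \sum_t w x y * w y z * w z t <= w x y * w y z * W.
  by rewrite -mulr_sumr ler_wpM2l// mulr_ge0.
have h2 y : \sum_z \sum_t w x y * w y z * w z t <= w x y * W * W.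
  apply: (@le_trans _ _ (\sum_z w x y * w y z * W)); first by apply: ler_sum.
  by rewrite -mulr_suml -mulr_sumr ler_wpM2r// ler_wpM2l.
apply: (@le_trans _ _ (\sum_y w x y * W * W)); first by apply: ler_sum.
rewrite -!mulr_suml [W ^+ 3]exprS expr2 mulrA.
by rewrite ler_wpM2r// ler_wpM2r.
Qed.

Lemma amgm4 (x y z t : R) : x * y * (z * t) <= 4^-1 * (x ^+ 4 + y ^+ 4 + z ^+ 4 + t ^+ 4).
Proof.
have h1 : 0 <= (x * y - z * t) ^+ 2 by exact: sqr_ge0.
have h2 : 0 <= (x ^+ 2 - y ^+ 2) ^+ 2 by exact: sqr_ge0.
have h3 : 0 <= (z ^+ 2 - t ^+ 2) ^+ 2 by exact: sqr_ge0.
nra.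
Qed.

(** A closed walk of length four is weighted by the geometric mean of its four
paths of length three, whose weights are controlled by row sums alone. *)
Lemma hs4_le C m (K W : R) : 0 <= K -> (forall i j, 0 <= m i j) ->
  (forall i j, m i j = m j i) -> (forall i j, `|C i j| <= K * m i j ^+ 3) ->
  (forall i j, C i j = C j i) ->
  (forall i, \sum_j m i j ^+ 4 <= W) -> hs4 C <= K ^+ 4 * (n%:R * W ^+ 3).
Proof.
move=> K0 m0 ms Cm Cs mW; pose w i j := m i j ^+ 4.
have w0 i j : 0 <= w i j by rewrite exprn_ge0.
have ws i j : w i j = w j i by rewrite /w ms.
have PB := path_sum_le w0 mW.
set B := n%:R * W ^+ 3 in PB *.
have S1 : \sum_i \sum_l \sum_j \sum_k w i j * w j l * w i k <= B.
  apply: le_trans PB; rewrite exchange_big/= le_eqVlt; apply/orP; left; apply/eqP.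
  apply: eq_bigr => l _; rewrite exchange_big/=; apply: eq_bigr => j _.
  apply: eq_bigr => i _; apply: eq_bigr => k _.
  by rewrite (ws i j) (ws j l) [w j i * _]mulrC.
have S2 : \sum_i \sum_l \sum_j \sum_k w i j * w j l * w k l <= B.
  apply: le_trans PB; rewrite le_eqVlt; apply/orP; left; apply/eqP.
  apply: eq_bigr => i _; rewrite exchange_big/=; apply: eq_bigr => j _.
  by apply: eq_bigr => l _; apply: eq_bigr => k _; rewrite (ws k l).
have S3 : \sum_i \sum_l \sum_j \sum_k w i j * w i k * w k l <= B.
  apply: le_trans PB; rewrite le_eqVlt; apply/orP; left; apply/eqP.
  rewrite [RHS]exchange_big/=; apply: eq_bigr => i _.
  rewrite exchange_big/=; apply: eq_bigr => j _.
  rewrite exchange_big/=; apply: eq_bigr => k _.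
  by apply: eq_bigr => l _; rewrite (ws i j).
have S4 : \sum_i \sum_l \sum_j \sum_k w j l * w i k * w k l <= B.
  apply: le_trans PB; rewrite le_eqVlt; apply/orP; left; apply/eqP.
  apply: eq_bigr => i _; rewrite [RHS]exchange_big/=; apply: eq_bigr => l _.
  rewrite exchange_big/=; apply: eq_bigr => k _; apply: eq_bigr => j _.
  by rewrite (ws j l); ring.
have term i l j k : C i j * C j l * (C i k * C k l) <=
    K ^+ 4 * (4^-1 * (w i j * w j l * w i k + w i j * w j l * w k l
      + w i j * w i k * w k l + w j l * w i k * w k l)).
  apply: (le_trans (ler_norm _)); rewrite !normrM.
  set a := m i j; set b := m j l; set c := m i k; set e := m k l.
  have H : `|C i j| * `|C j l| * (`|C i k| * `|C k l|) <=
      K * a ^+ 3 * (K * b ^+ 3) * (K * c ^+ 3 * (K * e ^+ 3)).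
    by rewrite !ler_pM ?mulr_ge0// /a /b /c /e Cm.
  apply: (le_trans H).
  have -> : K * a ^+ 3 * (K * b ^+ 3) * (K * c ^+ 3 * (K * e ^+ 3)) =
    K ^+ 4 * ((a * b * c) * (a * b * e) * ((a * c * e) * (b * c * e))) by ring.
  rewrite ler_wpM2l ?exprn_ge0//; apply: (le_trans (amgm4 _ _ _ _)).
  by rewrite /w -/a -/b -/c -/e !exprMn.
have -> : hs4 C = \sum_i \sum_l \sum_j \sum_k C i j * C j l * (C i k * C k l).
  apply: eq_bigr => i _; apply: eq_bigr => l _; rewrite expr2 mulr_suml.
  by apply: eq_bigr => j _; rewrite mulr_sumr.
apply: (@le_trans _ _ (\sum_i \sum_l \sum_j \sum_k
    K ^+ 4 * (4^-1 * (w i j * w j l * w i k + w i j * w j l * w k l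
      + w i j * w i k * w k l + w j l * w i k * w k l)))).
  do 4 (apply: ler_sum => ? _); exact: term.
have -> : \sum_i \sum_l \sum_j \sum_k
    K ^+ 4 * (4^-1 * (w i j * w j l * w i k + w i j * w j l * w k l
      + w i j * w i k * w k l + w j l * w i k * w k l)) =
    K ^+ 4 * (4^-1 * (\sum_i \sum_l \sum_j \sum_k w i j * w j l * w i k
     + \sum_i \sum_l \sum_j \sum_k w i j * w j l * w k l
     + \sum_i \sum_l \sum_j \sum_k w i j * w i k * w k l
     + \sum_i \sum_l \sum_j \sum_k w j l * w i k * w k l)).
  rewrite -!big_split/= !mulr_sumr; apply: eq_bigr => i _.
  rewrite -!big_split/= !mulr_sumr; apply: eq_bigr => l _.
  rewrite -!big_split/= !mulr_sumr; apply: eq_bigr => j _.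
  by rewrite -!big_split/= !mulr_sumr.
rewrite ler_wpM2l ?exprn_ge0//; lra.
Qed.

End CycleBound.

Section PowerSums.
Context (R : realType).
Implicit Types (q : R).

Lemma is_derive_powR (a x : R) : 0 < x ->
  is_derive (x : R) (1 : R) (fun y => y `^ a) (a * x `^ (a - 1)).
Proof. exact: is_derive1_powR. Qed.

(** Lag zero is given the weight of lag one, so that negative powers are
meaningful on the diagonal. *)
Definition pos_nat (r : nat) : R := (maxn r 1)%:R.

Lemma pos_natS r : pos_nat r.+1 = r.+1%:R.
Proof. by rewrite /pos_nat (maxn_idPl _). Qed.

(** Comparison with the integral of [x `^ (- q)]; the terms [0] and [1] make up
the constant [2]. *)
Lemma power_sum_le q (G : R -> R) (N : nat) : 0 <= q -> (1 <= N)%N ->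
  (forall x, 0 < x -> is_derive (x : R) (1 : R) G (x `^ (- q))) ->
  \sum_(0 <= r < N) pos_nat r `^ (- q) <= 2 + (G N%:R - G 1).
Proof.
move=> q0 N1 DG.
have step (r : nat) : (1 <= r)%N -> r.+1%:R `^ (- q) <= G r.+1%:R - G r%:R.
  move=> r1; have r0 : (0 : R) < r%:R by rewrite ltr0n.
  have rr : (r%:R : R) <= r.+1%:R by rewrite ler_nat.
  have Dr (x : R) : r%:R <= x <= r.+1%:R -> is_derive (x : R) (1 : R) G (x `^ (- q)).
    by move=> /andP[x1 _]; apply: DG; exact: lt_le_trans x1.
  have [c /andP[c1 c2] ->] := mean_value_on rr Dr.
  have c0 : 0 < c by exact: lt_le_trans c1.
  have -> : r.+1%:R - r%:R = (1 : R) by rewrite -natr1; ring.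
  rewrite mulr1 !powRN lef_pV2 ?posrE ?powR_gt0//.
  by apply: ge0_ler_powR => //; rewrite nnegrE ltW.
have main M : \sum_(0 <= r < M.+2) pos_nat r `^ (- q) <= 2 + (G M.+1%:R - G 1).
  elim: M => [|M IH].
    by rewrite !big_nat_recr//= big_nil add0r /pos_nat /= !powR1; lra.
  rewrite big_nat_recr//= pos_natS; have := step M.+1 isT; lra.
case: N N1 => // M _; apply: le_trans (main M).
by rewrite [leRHS]big_nat_recr//= lerDl powR_ge0.
Qed.

End PowerSums.

(** * The covariance of fractional Gaussian noise *)

Section IncrementCovariance.
Context (R : realType).
Implicit Types (h x : R).

(** Covariance of unit increments at time lag [x], with [h] twice the Hurst
index. *)
Definition incr_cov h x : R := 2^-1 * (`|x + 1| `^ h + `|x - 1| `^ h - 2 * `|x| `^ h).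

Lemma incr_covN h x : incr_cov h (- x) = incr_cov h x.
Proof.
have -> : - x = -1 * x by ring.
rewrite /incr_cov (_ : -1 * x + 1 = - (x - 1)); last by ring.
by rewrite (_ : -1 * x - 1 = - (x + 1)) ?mulN1r ?normrN; [lra|ring].
Qed.

Definition lag (i j : nat) : nat := (i - j + (j - i))%N.

Lemma incr_cov_lag h (i j : nat) : incr_cov h (i%:R - j%:R) = incr_cov h (lag i j)%:R.
Proof.
rewrite /lag; case: (leqP i j) => ij.
  rewrite (eqP ij) add0n natrB// -opprB incr_covN //.
have ji := ltnW ij.
by rewrite (eqP ji) addn0 natrB.
Qed.

Lemma lagC i j : lag i j = lag j i. Proof. by rewrite /lag addnC. Qed.

Lemma incr_cov0 h : 0 < h -> incr_cov h 0 = 1.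
Proof.
move=> h0; rewrite /incr_cov add0r sub0r normrN normr1 normr0 powR1 powR0 ?gt_eqF//; lra.
Qed.

(** Away from the origin the covariance is half a second difference of
[x `^ h]. *)
Lemma incr_cov_second_diff h x : 2 <= x -> exists2 c, x - 1 <= c <= x + 1 &
  incr_cov h x = 2^-1 * (h * (h - 1) * c `^ (h - 2)).
Proof.
move=> x2; have x1 : 0 < x - 1 by lra.
have D (y : R) : x - 1 <= y <= x -> is_derive (y : R) (1 : R)
    (fun y => (y + 1) `^ h - y `^ h) (h * (y + 1) `^ (h - 1) - h * y `^ (h - 1)).
  move=> /andP[y1 y2]; have y0 : 0 < y by lra. have y10 : 0 < y + 1 by lra.
  have D1 := is_derive_powR h y0; have D2 := is_derive_powR h y10.
  have D3 := is_derive_add (is_derive_idfun y) (is_derive_cstfun 1 y).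
  have D4 := @is_derive_compf R (fun y => y `^ h) (fun y => y + 1) y _ _ D2 D3.
  by apply: (is_derive_eq (is_derive_sub D4 D1)); rewrite addr0 mulr1.
have xx : x - 1 <= x by lra.
have [c /andP[c1 c2] e] := mean_value_on xx D.
have D' (y : R) : c <= y <= c + 1 -> is_derive (y : R) (1 : R)
    (fun y => h * y `^ (h - 1)) (h * ((h - 1) * y `^ (h - 1 - 1))).
  move=> /andP[y1 y2]; have y0 : 0 < y by lra.
  exact: is_derive_scale (is_derive_powR (h - 1) y0).
have cc : c <= c + 1 by lra.
have [b /andP[b1 b2] e'] := mean_value_on cc D'.
exists b; first by apply/andP; split; lra.
rewrite /incr_cov !ger0_norm; [|lra|lra|lra].
have -> : h - 2 = h - 1 - 1 by lra.
move: e e'; rewrite subrK.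
have -> : x - (x - 1) = 1 by lra.
have -> : c + 1 - c = 1 by lra.
rewrite !mulr1 => e e'; rewrite -mulrA -e' -e; lra.
Qed.

Lemma incr_cov_le h (r : nat) : 0 < h -> h <= 3 / 2 ->
  `|incr_cov h r%:R| <= 2 * pos_nat R r `^ (h - 2).
Proof.
move=> h0 h32; case: r => [|[|r]].
- by rewrite incr_cov0// normr1 /pos_nat /= powR1; lra.
- rewrite /incr_cov /pos_nat /= !powR1 subrr normr0 powR0 ?gt_eqF// !normr1 powR1.
  have -> : `|1 + 1 : R| = 2 by rewrite ger0_norm.
  have e1 : (2 : R) `^ h <= 4.
    apply: (@le_trans _ _ ((2 : R) `^ 2%:R)); first by rewrite ler_powR ?ler1n//; lra.
    by rewrite powR_mulrn// expr2; lra.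
  by have := powR_ge0 (2 : R) h; rewrite ler_norml => *; apply/andP; split; lra.
rewrite pos_natS; set x : R := r.+2%:R.
have x2 : 2 <= x by rewrite ler_nat.
have [c /andP[c1 c2] ->] := incr_cov_second_diff h x2.
have cp : c `^ (h - 2) <= 4 * x `^ (h - 2).
  have x20 : 0 < x / 2 by lra.
  apply: (@le_trans _ _ ((x / 2) `^ (h - 2))).
    have -> : h - 2 = - (2 - h) by lra.
    rewrite !powRN lef_pV2 ?posrE ?powR_gt0//; [|lra].
    by apply: ge0_ler_powR; rewrite ?nnegrE; lra.
  rewrite powRM ?invr_ge0//.
  rewrite mulrC ler_wpM2r ?powR_ge0//.
  have -> : h - 2 = - (2 - h) by lra.
  rewrite -powR_inv1// -powRrM mulN1r opprK.
  apply: (@le_trans _ _ ((2 : R) `^ 2%:R)); first by rewrite ler_powR ?ler1n//; lra.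
  by rewrite powR_mulrn// expr2; lra.
have c0 := powR_ge0 c (h - 2).
rewrite normrM ger0_norm ?invr_ge0// normrM (ger0_norm c0).
have hh : `|h * (h - 1)| <= 1 by rewrite ler_norml; apply/andP; split; nra.
have := ler_wpM2r c0 hh; rewrite mul1r; lra.
Qed.

(** For [h = 3 / 2] half the second difference is [3 / 8 * c `^ (- 1 / 2)], with
square [9 / 64 / c]. *)
Lemma incr_cov_sqr_ge (r : nat) : (9 / 64) / r.+1%:R <= incr_cov (3 / 2) r%:R ^+ 2 :> R.
Proof.
have h32 : (0 : R) < 3 / 2 by lra.
case: r => [|[|r]].
- by rewrite (incr_cov0 h32) expr1n; lra.
- rewrite /incr_cov subrr normr0 powR0 ?gt_eqF//.
  rewrite normr1 powR1 addr0 mulr1.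
  have -> : `|1 + 1 : R| = 2 by rewrite ger0_norm.
  have -> : (2 : R) `^ (3 / 2) = 2 * Num.sqrt 2.
    rewrite (_ : 3 / 2 = 1 + 2^-1); last by lra.
    by rewrite powRD ?pnatr_eq0 ?implybT// powRr1// powR12_sqrt.
  have s2 : 7 / 5 <= Num.sqrt (2 : R).
    rewrite -[leLHS]ger0_norm; last by lra.
    by rewrite -sqrtr_sqr ler_sqrt//; lra.
  nra.
set x : R := r.+2%:R; have x2 : 2 <= x by rewrite ler_nat.
have [c /andP[c1 c2] ->] := incr_cov_second_diff (3 / 2) x2.
have c0 : 0 < c by lra.
have -> : (3 / 2 : R) - 2 = - 2^-1 by lra.
rewrite powRN powR12_sqrt ?(ltW c0)//.
rewrite [leRHS](_ : _ = 9 / 64 / c); last first.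
  have s0 : Num.sqrt c != 0 by rewrite sqrtr_eq0 -ltNge.
  by rewrite -[in RHS](sqr_sqrtr (ltW c0)); field.
rewrite ler_wpM2l ?lef_pV2 ?posrE//.
by rewrite -natr1 -/x.
Qed.

Variable n : nat.

Definition incr_cov_mx h (i j : 'I_n) : R := incr_cov h (i%:R - j%:R).

(** Each lag occurs at most twice in a row. *)
Lemma lag_sum_le (g : nat -> R) (i : 'I_n) : (forall r, 0 <= g r) ->
  \sum_(j < n) g (lag i j) <= 2 * \sum_(0 <= r < n) g r.
Proof.
move=> g0; rewrite -(big_mkord xpredT (fun j => g (lag i j))).
have in_ := ltn_ord i.
have mono a b : (a <= b)%N -> \sum_(0 <= r < a) g r <= \sum_(0 <= r < b) g r.
  by move=> ab; rewrite [leRHS](big_cat_nat _ ab)//= lerDl sumr_ge0.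
rewrite (@big_cat_nat _ _ _ i.+1 0 _)//= mulr_natl mulr2n; apply: lerD.
  rewrite big_nat_rev /= add0n.
  apply: le_trans (mono _ _ in_); rewrite le_eqVlt; apply/orP; left; apply/eqP.
  apply: eq_big_nat => j /andP[_ ji]; congr g; rewrite /lag subSS.
  by rewrite ltnS in ji; rewrite subKn// (eqP (leq_subr _ _)) addn0.
rewrite -{1}[i.+1]add0n big_addn.
apply: (@le_trans _ _ (\sum_(0 <= r < (n - i.+1).+1) g r)).
  rewrite [leRHS]big_nat_recl//= ler_wpDl//.
  rewrite le_eqVlt; apply/orP; left; apply/eqP.
  apply: eq_big_nat => j _; congr g; rewrite /lag.
  by rewrite addnS subSn ?leq_addl// addnK (eqP (leqW (leq_addl _ _))).
by apply: mono; rewrite -subSn// subSS leq_subr.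
Qed.

(** With [m = pos_nat `^ (- (2 - h) / 3)], the cube of [m] controls the covariance
and its fourth power has the row sums that enter the walk bound. *)
Lemma hs4_incr_cov_le h : 0 < h -> h <= 3 / 2 ->
  hs4 (incr_cov_mx h) <= 16 * (n%:R *
    (2 * \sum_(0 <= r < n) pos_nat R r `^ (- (4 * (2 - h) / 3))) ^+ 3).
Proof.
move=> h0 h32.
pose m (i j : 'I_n) : R := pos_nat R (lag i j) `^ (- ((2 - h) / 3)).
have mX (i j : 'I_n) k : m i j ^+ k = pos_nat R (lag i j) `^ (- ((2 - h) / 3) * k%:R).
  by rewrite powRrM powR_mulrn ?powR_ge0.
have := @hs4_le R n (incr_cov_mx h) m 2
  (2 * \sum_(0 <= r < n) pos_nat R r `^ (- (4 * (2 - h) / 3))).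
have -> : (2 : R) ^+ 4 = 16 by ring.
apply => //.
- by move=> i j; exact: powR_ge0.
- by move=> i j; rewrite /m lagC.
- move=> i j; rewrite mX /incr_cov_mx incr_cov_lag.
  have -> : - ((2 - h) / 3) * 3%:R = h - 2 by field.
  exact: incr_cov_le.
- by move=> i j; rewrite /incr_cov_mx -opprB incr_covN.
- move=> i; under eq_bigr do rewrite mX.
  have -> : - ((2 - h) / 3) * 4%:R = - (4 * (2 - h) / 3) by field.
  apply: (lag_sum_le (g := fun r => pos_nat R r `^ (- (4 * (2 - h) / 3)))) => r.
  exact: powR_ge0.
Qed.

(** The diagonal alone. *)
Lemma hs2_incr_cov_ge h : 0 < h -> n%:R <= hs2 (incr_cov_mx h).
Proof.
move=> h0; have -> : (n%:R : R) = \sum_(i < n) 1 by rewrite sumr_const card_ord.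
apply: ler_sum => i _; rewrite (bigD1 i)//= /incr_cov_mx subrr incr_cov0// expr1n.
by rewrite lerDl; apply: sumr_ge0 => j _; exact: sqr_ge0.
Qed.

Lemma harmonic_ge (k : nat) : ln k.+1%:R <= \sum_(0 <= r < k) r.+1%:R^-1 :> R.
Proof.
elim: k => [|k IH]; first by rewrite ln1 big_nil.
rewrite big_nat_recr//=.
have k0 : (0 : R) < k.+1%:R by rewrite ltr0n.
have -> : (k.+2%:R : R) = k.+1%:R * (1 + k.+1%:R^-1).
  by rewrite mulrDr mulr1 mulfV ?gt_eqF// natr1.
rewrite lnM ?posrE ?addr_gt0 ?invr_gt0//.
by apply: lerD => //; apply: le_ln1Dx; rewrite (@lt_trans _ _ 0)// ?ltrN10 ?invr_gt0.
Qed.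

(** Pair [k] with [n - 1 - k]: the product of [k + 1] and [n - k] is at least
[n]. *)
Lemma sum_ln_ge : 2^-1 * (n%:R * ln n%:R) <= \sum_(0 <= k < n) ln k.+1%:R :> R.
Proof.
suff : n%:R * ln n%:R <= 2 * \sum_(0 <= k < n) ln k.+1%:R :> R by lra.
rewrite mulr_natl [in leRHS]mulr_natl mulr2n.
rewrite {2}big_nat_rev/= add0n -big_split/=.
have -> : ln n%:R *+ n = \sum_(0 <= k < n) ln n%:R :> R.
  by rewrite big_const_nat subn0 iter_addr addr0.
apply: ler_sum_nat => k /andP[_ kn].
rewrite -lnM ?posrE ?ltr0n// ler_ln ?posrE -?natrM ?ltr0n ?muln_gt0// ?(leq_ltn_trans _ kn)//.
rewrite ler_nat subnSK// mulSn.
have : (k * 1 <= k * (n - k))%N by rewrite leq_mul2l subn_gt0 kn orbT.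
by rewrite muln1 => h; rewrite -{1}(subnK (ltnW kn)) leq_add2l.
Qed.

(** At [H = 3 / 4] the squared correlations are not summable: each row contributes
a harmonic sum. *)
Lemma hs2_incr_cov_ge_log : 9 / 128 * (n%:R * ln n%:R) <= hs2 (incr_cov_mx (3 / 2)).
Proof.
apply: (@le_trans _ _ (9 / 64 * \sum_(0 <= k < n) ln k.+1%:R)).
  by have := sum_ln_ge; lra.
rewrite mulr_sumr big_mkord /hs2; apply: ler_sum => i _.
apply: (@le_trans _ _ (\sum_(0 <= j < i.+1) incr_cov (3 / 2) (i%:R - j%:R) ^+ 2)).
  apply: (@le_trans _ _ (\sum_(0 <= r < i.+1) (9 / 64) / r.+1%:R)).
    rewrite -mulr_sumr ler_wpM2l//.
    apply: le_trans (harmonic_ge i.+1).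
    by rewrite ler_ln ?posrE ?ltr0n// ler_nat.
  rewrite [leRHS]big_nat_rev/= add0n; apply: ler_sum_nat => r /andP[_ ri].
  rewrite incr_cov_lag (_ : lag _ _ = r) ?incr_cov_sqr_ge//.
  rewrite ltnS in ri.
  by rewrite /lag subSS subKn// (eqP (leq_subr _ _)) addn0.
rewrite -(big_mkord xpredT (fun j => incr_cov (3 / 2) (i%:R - j%:R) ^+ 2)).
rewrite [leRHS](@big_cat_nat _ _ _ i.+1 0 _)//= lerDl sumr_ge0// => j _.
exact: sqr_ge0.
Qed.

End IncrementCovariance.

(** * The rate of convergence *)

Section Rate.
Context (R : realType).
Implicit Types (q : R) (N : nat).

Definition power_sum q N : R := \sum_(0 <= r < N) pos_nat R r `^ (- q).

Lemma is_derive_primitive_powR q : q != 1 -> forall x : R, 0 < x ->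
  is_derive x 1 (fun y : R => (1 - q)^-1 * y `^ (1 - q)) (x `^ (- q)).
Proof.
move=> q1 x x0; have D := is_derive_scale (1 - q)^-1 (is_derive_powR (1 - q) x0).
have q10 : 1 - q != 0 by rewrite subr_eq0 eq_sym.
apply: (is_derive_eq D); rewrite mulrA mulVf// mul1r; congr (_ `^ _); lra.
Qed.

Lemma power_sum_gt1 q N : 1 < q -> (1 <= N)%N -> power_sum q N <= 2 + (q - 1)^-1.
Proof.
move=> q1 N1; have q0 : 0 <= q by lra.
have qn1 : q != 1 by rewrite gt_eqF.
apply: (le_trans (power_sum_le q0 N1 (is_derive_primitive_powR qn1))).
rewrite lerD2l powR1 mulr1 -[1 - q]opprB invrN mulNr opprK.
have := mulr_ge0 (_ : 0 <= (q - 1)^-1) (powR_ge0 N%:R (- (q - 1))).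
rewrite invr_ge0; have -> : 0 <= q - 1 by lra.
by move=> /(_ isT); lra.
Qed.

Lemma power_sum_lt1 q N : 0 <= q -> q < 1 -> (1 <= N)%N ->
  power_sum q N <= (2 + (1 - q)^-1) * N%:R `^ (1 - q).
Proof.
move=> q0 q1 N1; have qn1 : q != 1 by rewrite lt_eqF.
apply: (le_trans (power_sum_le q0 N1 (is_derive_primitive_powR qn1))).
have i0 : 0 <= (1 - q)^-1 by rewrite invr_ge0; lra.
have u1 : 1 <= (N%:R : R) `^ (1 - q).
  apply: (@le_trans _ _ (1 `^ (1 - q))); first by rewrite powR1.
  by apply: ge0_ler_powR; rewrite ?nnegrE ?ler1n//; lra.
rewrite powR1 mulr1 mulrDl addrA; nra.
Qed.

Lemma power_sum_eq1 N : (2 <= N)%N -> power_sum 1 N <= (2 / ln 2 + 1) * ln N%:R.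
Proof.
move=> N2; have N1 := ltnW N2.
have D (x : R) : 0 < x -> is_derive x 1 (@ln R) (x `^ (- 1)).
  by move=> x0; rewrite powR_inv1 ?ltW//; exact: is_derive1_ln.
apply: (le_trans (power_sum_le ler01 N1 D)).
have l2 : 0 < ln (2 : R) by rewrite ln_gt0// ltr1n.
rewrite ln1 subr0 mulrDl mul1r lerD2r mulrAC -mulrA ler_peMr//.
by rewrite ler_pdivlMr// mul1r ler_ln ?posrE ?ltr0n// ler_nat.
Qed.

(** What the four regimes have in common: [e] is the shape of the rate and [L] a
lower bound for [s2]. The constant [1 + X] replaces the square root of [X]. *)
Lemma rate_conclude (X e L s2 s4 : R) : 0 <= X -> 0 <= L -> L <= s2 ->
  18 * s4 <= X * (e * L) ^+ 2 -> 18 * s4 <= ((1 + X) * e) ^+ 2 * s2 ^+ 2.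
Proof.
move=> X0 L0 Ls h; apply: (le_trans h); rewrite !exprMn mulrA.
apply: ler_pM; [exact: mulr_ge0 X0 (sqr_ge0 _)|exact: sqr_ge0| |].
  by rewrite ler_wpM2r ?sqr_ge0//; nra.
by rewrite lerXn2r ?nnegrE//; lra.
Qed.

(** The factor [128 = 2 ^ 4 * 2 ^ 3] comes from the fourth power of the covariance
bound and the third power of the two-sided lag sum. *)
Definition cycle_const (C : R) : R := 18 * 128 * C ^+ 3.

Lemma cycle_const_ge0 C : 0 <= C -> 0 <= cycle_const C.
Proof. by move=> C0; apply: mulr_ge0; [apply: mulr_ge0|apply: exprn_ge0]. Qed.

Lemma hs4_power_sum_le h n (C u : R) : 0 < h -> h <= 3 / 2 ->
  power_sum (4 * (2 - h) / 3) n <= C * u ->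
  18 * hs4 (@incr_cov_mx R n h) <= cycle_const C * (n%:R * u ^+ 3).
Proof.
move=> h0 h32 U; have := hs4_incr_cov_le n h0 h32.
rewrite -/(power_sum _ _).
have U0 : 0 <= power_sum (4 * (2 - h) / 3) n.
  by apply: sumr_ge0 => r _; exact: powR_ge0.
have U3 : power_sum (4 * (2 - h) / 3) n ^+ 3 <= (C * u) ^+ 3.
  by rewrite lerXn2r ?nnegrE// (le_trans U0).
have := ler_wpM2l (ler0n R n) U3.
rewrite /cycle_const !exprMn; lra.
Qed.

(** With [U] the power sum of exponent [q = 4 * (2 - 2 * H) / 3], the sum [hs4] is
at most a multiple of [n * U ^ 3], and [q] crosses [1] at [H = 5 / 8]: [U] is
bounded, logarithmic or of order [n `^ (1 - q)]. The sum [hs2] is at least [n],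
and at least a multiple of [n * ln n] when [H = 3 / 4]. *)
Lemma berry_esseen_rate_bound (H : R) : 0 < H -> H <= 3 / 4 ->
  exists2 cH : R, 0 < cH & forall n, (2 <= n)%N ->
    0 < berry_esseen_rate H cH n /\
    18 * hs4 (@incr_cov_mx R n (2 * H)) <=
      berry_esseen_rate H cH n ^+ 2 * hs2 (@incr_cov_mx R n (2 * H)) ^+ 2.
Proof.
move=> H0 H34; have h0 : 0 < 2 * H by lra. have h32 : 2 * H <= 3 / 2 by lra.
have pos (X : R) : 0 <= X -> 0 < 1 + X by lra.
pose q := 4 * (2 - 2 * H) / 3.
have n0 n : (2 <= n)%N -> 0 < n%:R :> R by move=> n2; rewrite ltr0n (ltn_trans _ n2).
have ln0 n : (2 <= n)%N -> 0 < ln n%:R :> R by move=> n2; rewrite ln_gt0 ?ltr1n.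
case: (ltP H (5 / 8)) => c1.
  have E cH n : berry_esseen_rate H cH n = cH * (1 / Num.sqrt n%:R).
    by rewrite /berry_esseen_rate c1.
  have q1 : 1 < q by rewrite /q; lra.
  have i0 : 0 <= (q - 1)^-1 by rewrite invr_ge0; lra.
  have X0 : 0 <= cycle_const (2 + (q - 1)^-1) by apply: cycle_const_ge0; lra.
  exists (1 + cycle_const (2 + (q - 1)^-1)) => [|n n2]; first exact: pos.
  have s0 : 0 < Num.sqrt n%:R :> R by rewrite sqrtr_gt0 n0.
  split; first by rewrite E (mulr_gt0 (pos _ X0))// divr_gt0.
  rewrite E; apply: (rate_conclude X0 (ler0n R n) (hs2_incr_cov_ge n h0)).
  rewrite (_ : (_ * n%:R) ^+ 2 = n%:R * 1 ^+ 3).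
    apply: hs4_power_sum_le => //; rewrite mulr1.
    exact: power_sum_gt1 (ltnW n2).
  have := sqr_sqrtr (ltW (n0 _ n2)); move: (Num.sqrt _) s0 => t t0 <-.
  by field; rewrite gt_eqF.
have [c2|c2] := eqVneq H (5 / 8).
  have E cH n : berry_esseen_rate H cH n = cH * (ln n%:R `^ (3 / 2) / Num.sqrt n%:R).
    by rewrite /berry_esseen_rate c2 ltxx eqxx.
  have q1 : q = 1 by rewrite /q c2; field.
  have l2 : 0 < ln (2 : R) by rewrite ln_gt0// ltr1n.
  have i0 : 0 <= 2 / ln (2 : R) by rewrite divr_ge0// ltW.
  have X0 : 0 <= cycle_const (2 / ln (2 : R) + 1) by apply: cycle_const_ge0; lra.
  exists (1 + cycle_const (2 / ln (2 : R) + 1)) => [|n n2]; first exact: pos.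
  have s0 : 0 < Num.sqrt n%:R :> R by rewrite sqrtr_gt0 n0.
  split; first by rewrite E (mulr_gt0 (pos _ X0))// divr_gt0 ?powR_gt0 ?ln0.
  rewrite E; apply: (rate_conclude X0 (ler0n R n) (hs2_incr_cov_ge n h0)).
  rewrite (_ : (_ * n%:R) ^+ 2 = n%:R * ln n%:R ^+ 3).
    apply: hs4_power_sum_le => //; rewrite -/q q1.
    exact: power_sum_eq1.
  have -> : ln n%:R ^+ 3 = (ln n%:R `^ (3 / 2)) ^+ 2 :> R.
    rewrite -!powR_mulrn ?powR_ge0 ?(ltW (ln0 _ n2))// -powRrM; congr (_ `^ _).
    by field.
  have := sqr_sqrtr (ltW (n0 _ n2)); move: (Num.sqrt _) s0 => t t0 <-.
  by field; rewrite gt_eqF.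
have q0 : 0 <= q by rewrite /q; lra.
have c3 : 5 / 8 < H by rewrite lt_neqAle eq_sym c2.
have {c2}c2 : (H == 5 / 8) = false by exact: negbTE.
have c1' : (H < 5 / 8) = false by rewrite ltNge ltW.
have q1 : q < 1 by rewrite /q; lra.
have i0 : 0 <= (1 - q)^-1 by rewrite invr_ge0; lra.
have C0 : 0 <= cycle_const (2 + (1 - q)^-1) by apply: cycle_const_ge0; lra.
case: (ltP H (3 / 4)) => c4.
  have E cH n : berry_esseen_rate H cH n = cH * (1 / n%:R `^ (3 - 4 * H)).
    by rewrite /berry_esseen_rate c1' c2 c4.
  exists (1 + cycle_const (2 + (1 - q)^-1)) => [|n n2]; first exact: pos.
  have p0 : 0 < n%:R `^ (3 - 4 * H) :> R by apply: powR_gt0; exact: n0.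
  split; first by rewrite E (mulr_gt0 (pos _ C0))// divr_gt0.
  rewrite E; apply: (rate_conclude C0 (ler0n R n) (hs2_incr_cov_ge n h0)).
  rewrite (_ : (_ * n%:R) ^+ 2 = n%:R * (n%:R `^ (1 - q)) ^+ 3).
    by apply: hs4_power_sum_le => //; apply: power_sum_lt1 => //; exact: ltnW.
  have nn0 : n%:R != 0 :> R by apply: lt0r_neq0; exact: n0.
  have -> : (n%:R `^ (1 - q)) ^+ 3 = n%:R / (n%:R `^ (3 - 4 * H)) ^+ 2 :> R.
    rewrite -!powR_mulrn ?powR_ge0// -!powRrM -powRN.
    transitivity (n%:R `^ (1 + - ((3 - 4 * H) * 2%:R)) : R).
      by congr (_ `^ _); rewrite /q; field.
    by rewrite powRD ?nn0 ?implybT// powRr1.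
  by field; rewrite gt_eqF.
have E cH n : berry_esseen_rate H cH n = cH * (1 / ln n%:R).
  by rewrite /berry_esseen_rate c1' c2 ltNge c4.
have {c4}H34' : H = 3 / 4 by apply/eqP; rewrite eq_le H34.
have h' : 2 * H = 3 / 2 by rewrite H34'; field.
have X0 : 0 <= cycle_const (2 + (1 - q)^-1) * (128 / 9) ^+ 2.
  by apply: mulr_ge0 C0 (sqr_ge0 _).
exists (1 + cycle_const (2 + (1 - q)^-1) * (128 / 9) ^+ 2) => [|n n2]; first exact: pos.
split; first by rewrite E (mulr_gt0 (pos _ X0))// divr_gt0 ?ln0.
have L := @hs2_incr_cov_ge_log R n; rewrite -h' in L.
rewrite E; apply: (rate_conclude X0 _ L).
  by rewrite mulr_ge0 ?mulr_ge0// ?ltW ?ln0//; lra.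
rewrite (_ : _ * (_ * _) ^+ 2 = cycle_const (2 + (1 - q)^-1) * (n%:R * (n%:R `^ (1 - q)) ^+ 3)).
  by apply: hs4_power_sum_le => //; apply: power_sum_lt1 => //; exact: ltnW.
have -> : (n%:R `^ (1 - q)) ^+ 3 = n%:R :> R.
  rewrite -powR_mulrn ?powR_ge0// -powRrM -[RHS]powRr1//; congr (_ `^ _).
  by rewrite /q H34'; field.
have l0 := ln0 _ n2; by field; rewrite gt_eqF.
Qed.

End Rate.

(** * Increments of fractional Brownian motion *)

Section CenteredLaw.
Context d (T : measurableType d) (R : realType) (P : probability T R).

Lemma gaussian_law_mean (X : T -> R) (m s : R) : measurable_fun setT X -> 0 <= s ->
  (forall A, measurable A -> P (X @^-1` A) = if s == 0 then \d_m A else normal_prob m s A) ->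
  \int[P]_w X w = m.
Proof.
move=> mX s0 law; pose GR := measurableTypeR R.
have mX' : measurable_fun setT (X : T -> GR) by exact: mX.
pose Xm := isMeasurableFun.Build _ _ _ _ (X : T -> GR) mX'.
pose X' : {RV P >-> GR} := HB.pack (X : T -> GR) Xm.
have mE : measurable_fun setT (EFin : GR -> \bar R) by exact: EFin_measurable.
have mN : measurable_fun setT (fun x : GR => `|x%:E|%E).
  by exact: (measurableT_comp _ mE).
have eqI (nu : {measure set GR -> \bar R}) :
    (forall A, measurable A -> P (X @^-1` A) = nu A) -> forall g : R -> \bar R,
    (\int[distribution P X']_x g x = \int[nu]_x g x)%E.
  by move=> e g; apply: eq_measure_integral => A mA _; exact: e.
have iX (nu : {measure set GR -> \bar R}) :
    (forall A, measurable A -> P (X @^-1` A) = nu A) ->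
    (\int[nu]_x `|x%:E| < +oo)%E -> \int[P]_w X w = fine (\int[nu]_x x%:E)%E.
  move=> e fin; rewrite /Rintegral -(eqI nu e).
  rewrite (@integral_distribution _ _ _ _ _ P X' EFin)//.
  apply/integrableP; split; first exact/measurable_EFinP.
  by rewrite -(@ge0_integral_distribution _ _ _ _ _ P X' (fun x => `|x%:E|%E))// (eqI nu e).
case: (eqVneq s 0) law => [_|sn0] law.
  rewrite (iX (\d_(m : GR)) law) ?integral_dirac ?diracT ?mul1e//.
  by rewrite /= ltry.
have sp : 0 < s by rewrite lt_def sn0.
have [/integrableP[_ fin] mean] := normal_mean m sp.
by rewrite (iX (normal_prob m s) law)// -[RHS]mean.
Qed.

Lemma expectation_Rintegral (X : T -> R) (x : R) : ('E_P[X] = x%:E)%E ->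
  \int[P]_w X w = x.
Proof. by rewrite unlock /Rintegral => ->. Qed.

Lemma centered_gaussian (X : T -> R) : measurable_fun setT X ->
  gaussian_variable P X -> \int[P]_w X w = 0 -> exists s, centered_normal P X s.
Proof.
move=> mX [m [s [s0 law]]]; rewrite (gaussian_law_mean mX s0 law) => m0.
by move: law; rewrite m0 => law; exists s; split; [exact: s0|exact: mX|exact: law].
Qed.

Lemma integrable_mul_normal (X Z : T -> R) (s t : R) :
  centered_normal P X s -> centered_normal P Z t ->
  P.-integrable setT (EFin \o (fun w => X w * Z w)).
Proof.
move=> NX NZ; have iX := centered_normal_expr_integrable NX (isT : (2 <= 8)%N).
have iZ := centered_normal_expr_integrable NZ (isT : (2 <= 8)%N).
apply: (dom_integrable (integrable_add iX iZ)).
  by case: NX NZ => _ mX _ [_ mZ _]; exact: measurable_funM.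
move=> w; have h1 : 0 <= (X w - Z w) ^+ 2 by exact: sqr_ge0.
have h2 : 0 <= (X w + Z w) ^+ 2 by exact: sqr_ge0.
rewrite ler_norml; apply/andP; split; nra.
Qed.

Lemma gaussian_vector_of_law n (Y : 'I_n -> T -> R) (C : 'I_n -> 'I_n -> R) :
  (forall a, exists s, centered_normal P (linform Y a) s) ->
  (forall i j, \int[P]_w (Y i w * Y j w) = C i j) -> gaussian_vector P Y C.
Proof.
move=> N E; split=> [i j|a].
  by rewrite -!E; apply: eq_Rintegral => w _; rewrite mulrC.
have NY i : exists s, centered_normal P (Y i) s.
  have [s Ns] := N (fun j => (j == i)%:R); exists s.
  by rewrite (_ : Y i = linform Y (fun j => (j == i)%:R))//; apply/funext => w; rewrite linform_delta.
have iYY i j : P.-integrable setT (EFin \o (fun w => Y i w * Y j w)).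
  by have [s Ns] := NY i; have [t Nt] := NY j; exact: integrable_mul_normal Ns Nt.
have [s Ns] := N a; exists s => //; rewrite -(centered_normal_sqr Ns) /covform.
have -> : \int[P]_w (linform Y a w ^+ 2) =
    \int[P]_w (\sum_i \sum_j a i * a j * (Y i w * Y j w)).
  apply: eq_Rintegral => w _; rewrite expr2 /linform mulr_suml; apply: eq_bigr => i _.
  by rewrite mulr_sumr; apply: eq_bigr => j _; rewrite mulrACA.
rewrite Rintegral_bigsum => [|i]; last first.
  by apply: integrable_bigsum => j; exact: integrable_scale.
apply: eq_bigr => i _; rewrite Rintegral_bigsum => [|j]; last exact: integrable_scale.
by apply: eq_bigr => j _; rewrite RintegralZl// E.
Qed.

End CenteredLaw.

Section FractionalBrownianMotion.
Context d (T : measurableType d) (R : realType) (P : probability T R).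
Variables (H : R) (B : R -> {RV P >-> R}).
Hypothesis FB : fractional_brownian_motion H B.
Implicit Types s t : R.

Let mB t : measurable_fun setT (B t : T -> R). Proof. exact: measurable_funPT. Qed.

Lemma fbm_normal t : 0 <= t -> exists s, centered_normal P (B t) s.
Proof.
move=> t0; have [GB E0 _ _] := FB; apply: centered_gaussian => //.
  have := GB 1%N (fun=> t) (fun=> 1) (fun=> t0).
  by under eq_fun do rewrite big_ord1 mul1r.
by apply: expectation_Rintegral; exact: E0.
Qed.

(** A linear combination is normal by definition of a Gaussian process, and its
mean vanishes by linearity. *)
Lemma fbm_combination_normal m (t a : 'I_m -> R) : (forall i, 0 <= t i) ->
  exists s, centered_normal P (fun w => \sum_(i < m) a i * B (t i) w) s.
Proof.
move=> t0; have [GB E0 _ _] := FB.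
have iB i : P.-integrable setT (EFin \o (fun w => B (t i) w)).
  have [s Ns] := fbm_normal (t0 i).
  exact: (centered_normal_expr_integrable Ns (isT : (1 <= 8)%N)).
apply: centered_gaussian; [|exact: GB|].
  by apply: measurable_sum => i; apply: measurable_funM.
rewrite Rintegral_bigsum => [|i]; last exact: integrable_scale.
rewrite big1// => i _; rewrite RintegralZl// (_ : \int[P]_w _ = 0) ?mulr0//.
by apply: expectation_Rintegral; exact: E0.
Qed.

Let cov s t : R := 2^-1 * (t `^ (2 * H) + s `^ (2 * H) - `|t - s| `^ (2 * H)).

Lemma fbm_increments_cov (s0 s1 t0 t1 : R) :
  0 <= s0 -> 0 <= s1 -> 0 <= t0 -> 0 <= t1 ->
  \int[P]_w ((B t1 w - B t0 w) * (B s1 w - B s0 w)) =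
  2^-1 * (`|t1 - s0| `^ (2 * H) + `|t0 - s1| `^ (2 * H)
    - `|t1 - s1| `^ (2 * H) - `|t0 - s0| `^ (2 * H)).
Proof.
move=> hs0 hs1 ht0 ht1; have [_ _ EC _] := FB.
have iBB s t : 0 <= s -> 0 <= t -> P.-integrable setT (EFin \o (fun w => B t w * B s w)).
  move=> hs ht; have [a Na] := fbm_normal hs; have [b Nb] := fbm_normal ht.
  exact: integrable_mul_normal Nb Na.
have IC s t : 0 <= s -> 0 <= t -> \int[P]_w (B t w * B s w) = cov s t.
  by move=> hs ht; apply: expectation_Rintegral; exact: EC.
under eq_Rintegral do rewrite mulrBl !mulrBr opprB.
have i11 := iBB s1 t1 hs1 ht1. have i01 := iBB s0 t1 hs0 ht1.
have i10 := iBB s1 t0 hs1 ht0. have i00 := iBB s0 t0 hs0 ht0.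
rewrite (RintegralD measurableT (integrable_sub i11 i01) (integrable_sub i00 i10)).
rewrite (RintegralB measurableT i11 i01) (RintegralB measurableT i00 i10) !IC// /cov.
by lra.
Qed.

End FractionalBrownianMotion.

Section NormalizedIncrements.
Context d (T : measurableType d) (R : realType) (P : probability T R).
Variables (H : R) (B : R -> {RV P >-> R}).
Hypothesis FB : fractional_brownian_motion H B.
Hypothesis H_gt0 : 0 < H.
Variables (n : nat) (sigma : R).
Hypotheses (n_gt0 : (0 < n)%N) (sigma_gt0 : 0 < sigma).

Definition normalized_increment (k : 'I_n) (w : T) : R :=
  Num.sqrt (n%:R `^ (2 * H) / sigma) * (B (k.+1%:R / n%:R) w - B (k%:R / n%:R) w).

Definition normalized_cov (i j : 'I_n) : R := incr_cov_mx (2 * H) i j / sigma.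

Let scale_ge0 : 0 <= n%:R `^ (2 * H) / sigma.
Proof. by rewrite divr_ge0 ?powR_ge0 ?ltW. Qed.

Lemma normalized_increment_cov i j :
  \int[P]_w (normalized_increment i w * normalized_increment j w) = normalized_cov i j.
Proof.
have t0 k : 0 <= k%:R / n%:R :> R by rewrite divr_ge0.
have iBB s t : 0 <= s -> 0 <= t -> P.-integrable setT (EFin \o (fun w => B t w * B s w)).
  move=> hs ht; have [a Na] := fbm_normal FB hs; have [b Nb] := fbm_normal FB ht.
  exact: integrable_mul_normal Nb Na.
have inc (k : 'I_n) : exists s, centered_normal P
    (fun w => B (k.+1%:R / n%:R) w - B (k%:R / n%:R) w) s.
  pose t (x : 'I_2) : R := (if x == ord0 then k.+1%:R else k%:R) / n%:R.
  pose a (x : 'I_2) : R := if x == ord0 then 1 else -1.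
  have [|s] := fbm_combination_normal FB (t := t) a.
    by move=> x; rewrite /t; case: ifP.
  under eq_fun do rewrite !big_ord_recl big_ord0 /a /t /= mul1r mulN1r addr0.
  by exists s.
have [s Ns] := inc i; have [t Nt] := inc j.
under eq_Rintegral do rewrite mulrACA -expr2 sqr_sqrtr//.
rewrite RintegralZl//; last exact: integrable_mul_normal Ns Nt.
rewrite (fbm_increments_cov FB)// /normalized_cov /incr_cov_mx /incr_cov.
have N0 : 0 < n%:R :> R by rewrite ltr0n.
have N1 : n%:R != 0 :> R by rewrite gt_eqF.
have S x : `|x / n%:R| `^ (2 * H) = `|x| `^ (2 * H) * (n%:R `^ (2 * H))^-1.
  rewrite normrM [`|_^-1|]ger0_norm ?invr_ge0// powRM ?invr_ge0//.
  by rewrite -[n%:R^-1]powR_inv1// -powRrM mulN1r powRN.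
rewrite -!mulrBl !S.
have -> : i.+1%:R - j%:R = i%:R - j%:R + 1 :> R by rewrite -natr1; ring.
have -> : i%:R - j.+1%:R = i%:R - j%:R - 1 :> R by rewrite -natr1; ring.
have -> : i.+1%:R - j.+1%:R = i%:R - j%:R :> R by rewrite -!natr1; ring.
have p0 : n%:R `^ (2 * H) != 0 :> R by rewrite gt_eqF// powR_gt0.
have s0 : sigma != 0 by rewrite gt_eqF.
by field; rewrite p0 s0.
Qed.

Lemma normalized_increment_gaussian :
  gaussian_vector P normalized_increment normalized_cov.
Proof.
apply: gaussian_vector_of_law normalized_increment_cov => a.
pose K := Num.sqrt (n%:R `^ (2 * H) / sigma).
(* a combination of [n] increments is a combination of [n + n] values *)
pose t (x : 'I_(n + n)) : R :=
  (match fintype.split x with inl k => k.+1%:R | inr k => k%:R end) / n%:R.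
pose b (x : 'I_(n + n)) : R :=
  match fintype.split x with inl k => a k * K | inr k => - (a k * K) end.
have [|s] := fbm_combination_normal FB (t := t) b.
  by move=> x; rewrite /t; case: (fintype.split x) => k; rewrite divr_ge0.
exists s; rewrite (_ : linform _ _ = fun w => \sum_x b x * B (t x) w)//.
apply/funext => w; rewrite big_split_ord /linform /= -big_split/=.
apply: eq_bigr => k _; rewrite /normalized_increment -/K /b /t.
rewrite (unsplitK (inl k)) (unsplitK (inr k)).
by ring.
Qed.

Lemma sqnorm_normalized_increment w :
  sqnorm normalized_increment w - covtrace normalized_cov =
  n%:R `^ (2 * H) / sigma *
    \sum_(k < n) ((B (k.+1%:R / n%:R) w - B (k%:R / n%:R) w) ^+ 2
                  - n%:R `^ (- (2 * H))).
Proof.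
rewrite /sqnorm /covtrace mulr_sumr -sumrB; apply: eq_bigr => k _.
rewrite /normalized_increment exprMn sqr_sqrtr// mulrBr; congr (_ - _).
rewrite /normalized_cov /incr_cov_mx subrr incr_cov0; last by rewrite mulr_gt0.
have p0 : n%:R `^ (2 * H) != 0 :> R by rewrite gt_eqF// powR_gt0// ltr0n.
have s0 : sigma != 0 by rewrite gt_eqF.
by rewrite powRN; field; rewrite p0 s0.
Qed.

Lemma hs2_normalized_cov : hs2 normalized_cov = hs2 (@incr_cov_mx R n (2 * H)) / sigma ^+ 2.
Proof.
rewrite /hs2 mulr_suml; apply: eq_bigr => i _; rewrite mulr_suml.
by apply: eq_bigr => j _; rewrite /normalized_cov exprMn exprVn.
Qed.

Lemma hs4_normalized_cov : hs4 normalized_cov = hs4 (@incr_cov_mx R n (2 * H)) / sigma ^+ 4.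
Proof.
rewrite /hs4 mulr_suml; apply: eq_bigr => i _; rewrite mulr_suml.
apply: eq_bigr => l _; rewrite -[4%N]/(2 * 2)%N exprM -exprVn -exprMn mulr_suml.
congr (_ ^+ _); apply: eq_bigr => j _; rewrite /normalized_cov.
by rewrite mulrACA -invfM expr2.
Qed.

End NormalizedIncrements.

Theorem theorem5p1 (R : realType) (H : R) (H_gt0 : 0 < H) (H_le : H <= 3 / 4) :
  exists cH : R, 0 < cH /\
    forall (d : measure_display) (T : measurableType d) (P : probability T R)
           (B : R -> {RV P >-> R}),
      fractional_brownian_motion H B ->
    forall sigma : nat -> R,
      (forall n : nat, (1 <= n)%N ->
         0 < sigma n /\
         'E_P[(fun w => quadratic_variation_stat H B sigma n w ^+ 2)%R]%E = 1%E) ->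
    exists c : R, 0 < c /\
      forall (n : nat) (z : R), (2 <= n)%N ->
        let F := quadratic_variation_stat H B sigma n in
        let A := berry_esseen_rate H cH n in
        `| fine (P [set w | F w <= z]) - std_normal_cdf z | <=
          (Num.sqrt 2 *
             expR (- (1 / 8) *
                   Num.min (z ^+ 2 / 8)
                           (2 `^ (- (13 / 4)) * A `^ (- (1 / 2)) * z))
           + c * expR (- (z ^+ 2 / 4))) * A.
Proof.
have [cH cH0 rate] := berry_esseen_rate_bound H_gt0 H_le.
exists cH; split=> // d T P B FB sigma Hs; exists 1; split=> // n z n2.
have n0 : (0 < n)%N := ltnW n2.
have [s0 EF] := Hs n n0; cbv zeta.
set F := quadratic_variation_stat H B sigma n; set A := berry_esseen_rate H cH n.
rewrite [1 * expR _]mul1r.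
pose Y := normalized_increment H B (n := n) (sigma n).
pose C := @normalized_cov R H n (sigma n).
have G : gaussian_vector P Y C by exact: normalized_increment_gaussian.
have FE w : F w = sqnorm Y w - covtrace C by rewrite sqnorm_normalized_increment.
have := rate n n2; rewrite -/A => -[A0 hsA].
(* the normalization [E F ^ 2 = 1] fixes the scale of [C] *)
have hs : hs2 C = 2^-1.
  have := quadratic_variance G; rewrite (_ : \int[P]_w _ = 1); first by lra.
  rewrite -[RHS](expectation_Rintegral EF); apply: eq_Rintegral => w _.
  by rewrite -FE.
have hs4C : 72 * hs4 C <= A ^+ 2.
  have e2 := hs2_normalized_cov H n (sigma n); rewrite -/C hs in e2.
  rewrite /C hs4_normalized_cov.
  have S2 : 0 < sigma n ^+ 2 by rewrite exprn_gt0.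
  have S4 : sigma n ^+ 4 = (2 * hs2 (@incr_cov_mx R n (2 * H))) ^+ 2.
    rewrite [4%N](_ : _ = 2 * 2)%N// exprM; congr (_ ^+ _).
    have := congr1 (fun x => x * sigma n ^+ 2) e2.
    by rewrite mulfVK ?gt_eqF//; lra.
  rewrite mulrA ler_pdivrMr ?exprn_gt0// S4 [X in _ <= _ * X]exprMn; lra.
have := quadratic_form_berry_esseen G hs z A0 hs4C.
by under eq_set do rewrite -FE.
Qed.
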